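(* Let $U(t)$ be the solution of the Stratonovich SDE on $\mathbb{C}^M$ $$dU=\mathbf{i}\left[\frac1{h^2}AU+\lambda F(U)U\right]dt+\mathbf{i}Z(U)\circ d\beta(t),\qquad U(0)=c_*\left(u_0(x_1),\dots,u_0(x_M)\right)^T,$$ with the notation of the context. Then it possesses the charge conservation law $$\|U(t)\|^2=\|U(0)\|^2,\qquad\forall\,t\ge0,\quad\mathbb{P}\text{-a.s.},$$ where $\|U(t)\|=\left(\|P(t)\|^2+\|Q(t)\|^2\right)^{\frac12}=\left(\sum_{m=1}^M\left(|p_m(t)|^2+|q_m(t)|^2\right)\right)^{\frac12}$ and $P(t)=(p_1(t),\dots,p_M(t))^T$, $Q(t)=(q_1(t),\dots,q_M(t))^T$ are the real and imaginary parts of $U(t)$.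
   Context: Notation. $M,K\in\mathbb{N}$ with $M\le K$; $h=\frac1{M+1}$; $x_j=jh$, $j=1,\dots,M$; $e_k(x)=\sqrt2\sin(k\pi x)$; $\eta_k>0$ with $\sum_{k=1}^\infty\eta_k<\infty$; $\lambda\in\{1,-1\}$; $u_0:[0,1]\to\mathbb{C}$ is a given initial function and $c_*$ is a normalizing constant. $\beta(t)=(\beta_1(t),\dots,\beta_K(t))^T$ is a vector of independent real Brownian motions on a filtered probability space $(\Omega,\mathcal{F},(\mathcal{F}_t)_{t\ge0},\mathbb{P})$. $A\in\mathbb{R}^{M\times M}$ is the tridiagonal matrix with $-2$ on the diagonal and $1$ on the sub- and super-diagonals. For $U=(u_1,\dots,u_M)^T\in\mathbb{C}^M$, $F(U)=\mathrm{diag}\{|u_1|^2,\dots,|u_M|^2\}$ and $Z(U)=\mathrm{diag}\{u_1,\dots,u_M\}E_{MK}\Lambda$, where $E_{MK}=(e_k(x_j))_{1\le j\le M,\,1\le k\le K}$ and $\Lambda=\mathrm{diag}\{\sqrt{\eta_1},\dots,\sqrt{\eta_K}\}$. Equivalently, in Itô form, $\mathbf{i}Z(U)\circ d\beta=-\hat EU\,dt+\mathbf{i}\sum_{k=1}^K\sqrt{\eta_k}E_kU\,d\beta_k$ with $E_k=\mathrm{diag}\{e_k(x_1),\dots,e_k(x_M)\}$ and $\hat E=\frac12\sum_{k=1}^K\eta_kE_k^2$. *)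

(* Defs.v *)
From mathcomp Require Import all_boot all_order all_algebra.
From mathcomp Require Import all_classical all_reals all_analysis.
From mathcomp Require Import complex.

Set Implicit Arguments.
Unset Strict Implicit.
Unset Printing Implicit Defensive.

Import Order.TTheory GRing.Theory Num.Theory.
Import numFieldNormedType.Exports.

Local Open Scope classical_set_scope.
Local Open Scope ring_scope.
Local Open Scope complex_scope.

(** Time is the half-line [0, +oo[.  Processes and filtrations are indexed by
    all of R, but every condition below only concerns nonnegative times. *)

Section processes.
Context (R : realType) (d : measure_display) (T : measurableType d).
Context (P : probability T R) (F : R -> set (set T)).

Definition filtration : Prop :=
  (forall t, 0 <= t -> sigma_algebra [set: T] (F t) /\ F t `<=` measurable) /\
  (forall s t, 0 <= s -> s <= t -> F s `<=` F t).

Definition measurable_wrt (G : set (set T)) (X : T -> R) : Prop :=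
  forall B : set R, measurable B -> G (X @^-1` B).

Definition adapted (X : R -> T -> R) : Prop :=
  forall t, 0 <= t -> measurable_wrt (F t) (X t).

Definition as_continuous (X : R -> T -> R) : Prop :=
  {ae P, forall w, {within `[0, +oo[, continuous (X ^~ w)}}.

(** A K-dimensional Brownian motion relative to F.  The product formula says
    at once that the increment over [s, t] is independent of F s, that its K
    coordinates are mutually independent, and that each of them has law
    N(0, t - s) ([normal_prob] takes the standard deviation). *)
Definition brownian_motion (K : nat) (B : 'I_K -> R -> T -> R) : Prop :=
  [/\ forall k, adapted (B k),
      forall k, as_continuous (B k),
      forall k, {ae P, forall w, B k 0 w = 0}
    & forall s t, 0 <= s -> s < t ->
      forall (A : set T) (D : 'I_K -> set R),
        F s A -> (forall k, measurable (D k)) ->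
        P [set w | A w /\ forall k, D k (B k t w - B k s w)] =
        (P A * \prod_(k < K) normal_prob 0 (Num.sqrt (t - s)) (D k))%E].

(** Martingale property E[L t | F s] = L s, in integrated form. *)
Definition martingale (L : R -> T -> R) : Prop :=
  [/\ adapted L,
      forall t, 0 <= t -> P.-integrable [set: T] (EFin \o L t)
    & forall s t, 0 <= s -> s <= t -> forall A, F s A ->
      (\int[P]_(w in A) (L t w)%:E = \int[P]_(w in A) (L s w)%:E)%E].

Definition stopping_time (tau : T -> \bar R) : Prop :=
  (forall w, (0 <= tau w)%E) /\
  (forall t, 0 <= t -> F t [set w | (tau w <= t%:E)%E]).

Definition stopped (L : R -> T -> R) (tau : T -> \bar R) : R -> T -> R :=
  fun t w => L (fine (Order.min t%:E (tau w))) w.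

Definition local_martingale (L : R -> T -> R) : Prop :=
  adapted L /\
  exists tau : nat -> T -> \bar R,
    [/\ forall n, stopping_time (tau n),
        {ae P, forall w, nondecreasing_seq (tau ^~ w) /\
                         (tau ^~ w @ \oo --> +oo%E)}
      & forall n, martingale (stopped L (tau n))].

Definition continuous_semimartingale (X : R -> T -> R) : Prop :=
  [/\ adapted X,
      as_continuous X
    & exists L V : R -> T -> R,
      [/\ local_martingale L /\ as_continuous L,
          adapted V /\ as_continuous V,
          {ae P, forall w, L 0 w = 0 /\ V 0 w = 0},
          {ae P, forall w, forall t, 0 <= t -> bounded_variation 0 t (V ^~ w)}
        & {ae P, forall w, forall t, 0 <= t -> X t w = X 0 w + L t w + V t w}]].

(** Convergence to 0 in probability of nonnegative variables.  The exceptional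
    events are enclosed in measurable ones, so that the notion makes sense
    before any measurability of the D n is known; for measurable D n it is the
    usual P(D n >= e) --> 0. *)
Definition cvg0_in_probability (D : nat -> T -> \bar R) : Prop :=
  forall e p : R, 0 < e -> 0 < p ->
    \forall n \near \oo, exists2 A : set T,
      measurable A /\ (P A <= p%:E)%E
      & forall w, ~ A w -> (D n w < e%:E)%E.

(** Simple process: value xi i on ]tau i, tau i.+1] for i < n, and 0 outside. *)
Record simple_process := SimpleProcess {
  sp_size : nat;
  sp_time : nat -> R;
  sp_coef : nat -> T -> R;
  sp_time0 : 0 <= sp_time 0%N;
  sp_time_nd : forall i, sp_time i <= sp_time i.+1;
  sp_coef_meas : forall i, measurable_wrt (F (sp_time i)) (sp_coef i);
  sp_coef_bnd : forall i, exists c : R, forall w, `|sp_coef i w| <= c }.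

Definition sp_val (S : simple_process) (s : R) (w : T) : R :=
  \sum_(i < sp_size S)
    sp_coef S i w * \1_(`]sp_time S i, sp_time S i.+1]%classic) s.

Definition sp_integral (S : simple_process) (B : R -> T -> R) (t : R) (w : T) : R :=
  \sum_(i < sp_size S)
    sp_coef S i w *
    (B (Num.min (sp_time S i.+1) t) w - B (Num.min (sp_time S i) t) w).

(** J is (a version of) the Ito integral of X against the Brownian motion B
    over [0, t]: the limit in probability of the integrals of simple processes
    S n such that \int_0^t |S n - X|^2 ds --> 0 in probability. *)
Definition is_ito_integral (X B : R -> T -> R) (t : R) (J : T -> R) : Prop :=
  exists S : nat -> simple_process,
    cvg0_in_probability (fun n w =>
      (\int[lebesgue_measure]_(s in `[0%R, t]) ((sp_val (S n) s w - X s w) ^+ 2)%:E)%E) /\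
    cvg0_in_probability (fun n w => (`|sp_integral (S n) B t w - J w|)%:E).

(** As in [itv_partition 0 t p], p lists the points of a subdivision of
    [0, t] except the initial point 0. *)
Definition covariation_sum (X Y : R -> T -> R) (t : R) (p : seq R) (w : T) : R :=
  \sum_(i < size p)
    (X (nth t (0 :: p) i.+1) w - X (nth t (0 :: p) i) w) *
    (Y (nth t (0 :: p) i.+1) w - Y (nth t (0 :: p) i) w).

Definition mesh_to0 (t : R) (p : nat -> seq R) : Prop :=
  forall e : R, 0 < e -> \forall n \near \oo,
    forall i, (i < size (p n))%N ->
      nth t (0 :: p n) i.+1 - nth t (0 :: p n) i < e.

(** C is (a version of) the quadratic covariation [X, Y]_t. *)
Definition is_covariation (X Y : R -> T -> R) (t : R) (C : T -> R) : Prop :=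
  forall p : nat -> seq R,
    (forall n, itv_partition 0 t (p n)) -> mesh_to0 t p ->
    cvg0_in_probability (fun n w => (`|covariation_sum X Y t (p n) w - C w|)%:E).

(** I is (a version of) \int_0^t X o dB = \int_0^t X dB + 1/2 [X, B]_t, for X a
    continuous semimartingale. *)
Definition is_stratonovich_integral (X B : R -> T -> R) (t : R) (I : T -> R) : Prop :=
  continuous_semimartingale X /\
  exists J C : T -> R,
    [/\ is_ito_integral X B t J,
        is_covariation X B t C
      & {ae P, forall w, I w = J w + 2^-1 * C w}].

Definition is_stratonovich_integral_C (X : R -> T -> R[i]) (B : R -> T -> R)
    (t : R) (I : T -> R[i]) : Prop :=
  is_stratonovich_integral (fun s w => complex.Re (X s w)) B t
    (fun w => complex.Re (I w)) /\
  is_stratonovich_integral (fun s w => complex.Im (X s w)) B t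
    (fun w => complex.Im (I w)).

(** I is (a version of) the vector \int_0^t G o dB, with coordinates
    \sum_k \int_0^t G_jk o dB_k. *)
Definition is_stratonovich_integral_mx (M K : nat)
    (G : R -> T -> 'M[R[i]]_(M, K)) (B : 'I_K -> R -> T -> R)
    (t : R) (I : T -> 'cV[R[i]]_M) : Prop :=
  exists J : 'I_M -> 'I_K -> T -> R[i],
    (forall j k, is_stratonovich_integral_C (fun s w => G s w j k) (B k) t (J j k)) /\
    (forall w, I w = \col_j \sum_(k < K) J j k w).

Definition time_integral (M : nat) (f : R -> 'cV[R[i]]_M) (t : R) : 'cV[R[i]]_M :=
  \col_j ((\int[lebesgue_measure]_(s in `[0, t]) complex.Re (f s j 0)) +i*
          (\int[lebesgue_measure]_(s in `[0, t]) complex.Im (f s j 0))).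

(** U solves dU = a(U) dt + g(U) o dB, U(0) = U0. *)
Definition stratonovich_solution (M K : nat)
    (a : 'cV[R[i]]_M -> 'cV[R[i]]_M) (g : 'cV[R[i]]_M -> 'M[R[i]]_(M, K))
    (B : 'I_K -> R -> T -> R) (U0 : 'cV[R[i]]_M)
    (U : R -> T -> 'cV[R[i]]_M) : Prop :=
  [/\ forall j, adapted (fun t w => complex.Re (U t w j 0)) /\
                adapted (fun t w => complex.Im (U t w j 0)),
      forall j, as_continuous (fun t w => complex.Re (U t w j 0)) /\
                as_continuous (fun t w => complex.Im (U t w j 0)),
      {ae P, forall w, U 0 w = U0}
    & forall t, 0 <= t -> exists I : T -> 'cV[R[i]]_M,
        is_stratonovich_integral_mx (fun s w => g (U s w)) B t I /\
        {ae P, forall w,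
          U t w = U 0 w + time_integral (fun s => a (U s w)) t + I w}].

End processes.

Section discretization.
Context (R : realType) (M K : nat).

Definition step : R := (M.+1%:R)^-1.

(** Indices start at 0 in Rocq: j : 'I_M stands for the node x_(j+1), and
    k : 'I_K for the mode e_(k+1). *)
Definition node (j : 'I_M) : R := j.+1%:R * step.

Definition e_ (k : nat) (x : R) : R := Num.sqrt 2 * sin (k%:R * pi * x).

Definition A_mx : 'M[R]_M :=
  \matrix_(i, j) (if i == j then - 2
                  else if (i.+1 == j :> nat) || (j.+1 == i :> nat) then 1 else 0).

Definition E_mx : 'M[R]_(M, K) := \matrix_(j, k) e_ k.+1 (node j).

Definition Lambda_mx (eta : nat -> R) : 'M[R]_K :=
  diag_mx (\row_(k < K) Num.sqrt (eta k.+1)).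

Definition mxC (m n : nat) (X : 'M[R]_(m, n)) : 'M[R[i]]_(m, n) :=
  map_mx (real_complex R) X.

Definition F_mx (U : 'cV[R[i]]_M) : 'M[R[i]]_M :=
  diag_mx (\row_j `|U j 0| ^+ 2).

Definition Z_mx (eta : nat -> R) (U : 'cV[R[i]]_M) : 'M[R[i]]_(M, K) :=
  diag_mx U^T *m mxC (E_mx *m Lambda_mx eta).

Definition nls_drift (lambda : R) (U : 'cV[R[i]]_M) : 'cV[R[i]]_M :=
  'i *: (((step ^+ 2)^-1)%:C *: (mxC A_mx *m U) + lambda%:C *: (F_mx U *m U)).

Definition nls_noise (eta : nat -> R) (U : 'cV[R[i]]_M) : 'M[R[i]]_(M, K) :=
  'i *: Z_mx eta U.

Definition nls_init (c : R[i]) (u0 : R -> R[i]) : 'cV[R[i]]_M :=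
  c *: \col_j u0 (node j).

Definition charge_norm (U : 'cV[R[i]]_M) : R :=
  Num.sqrt (\sum_(m < M) (`|complex.Re (U m 0)| ^+ 2 + `|complex.Im (U m 0)| ^+ 2)).

End discretization.

(* Main.v *)
Require Import Defs.
From mathcomp Require Import all_boot all_order all_algebra.
From mathcomp Require Import all_classical all_reals all_analysis.
From mathcomp Require Import complex.
From mathcomp Require Import measurable_realfun ring lra.

Set Implicit Arguments.
Unset Strict Implicit.
Unset Printing Implicit Defensive.

Import Order.TTheory GRing.Theory Num.Theory.
Import numFieldNormedType.Exports.

Local Open Scope classical_set_scope.
Local Open Scope ring_scope.

(** Along a partition of [0, t] the charge telescopes exactly in midpoint form:
    |u(t)|^2 - |u(0)|^2 = sum_i 2 Re (conj (ubar_i) (u(t_(i+1)) - u(t_i))), where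
    ubar_i is the mean of u at the endpoints of the i-th interval.  Inserting the
    equation, the drift contributes integrals of 2 Re (conj (ubar_i - u) a(u)),
    since Re (conj u a(u)) = 0, and these vanish with the mesh.  The Stratonovich
    integral of G over the i-th interval is Gbar_i times the increment of beta
    up to errors whose weighted sum tends to 0 in probability, and the main terms
    cancel because G is i u times a real number.

    The error is a sum of three parts: an Ito integral of a small integrand,
    controlled by the isometry after truncation; its product with the increments
    of u, controlled by the tightness of the quadratic variation of u; and the
    difference of two discrete covariations, for which the weights are frozen on a
    coarser grid, where convergence of the covariation applies.  Tightness of the
    quadratic variation comes from the semimartingale decomposition: for the
    martingale part one applies the martingale property to a convex function that
    is quadratic near 0 and grows linearly. *)

(** * Convergence in probability *)

(** [stratonovich_solution] gives, at each fixed time, some version of the noise integral, with no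
    regularity in time, and does not state that [U] is a semimartingale. The product rule is
    therefore replaced by finite sums, and versions are compared only at finitely many grid points.
    The semimartingale property belongs to the integrands [nls_noise]. It passes to [U], in the form
    of tight quadratic variation, because the first noise column multiplies each coordinate of [i U]
    by a nonzero real number: [sin (pi x)] does not vanish at interior nodes, and [M <= K] provides
    this column as soon as [M > 0]. The number [N] of coarse intervals is fixed before the
    refinement factor [m] is sent to infinity, so the Ito estimates must be uniform in [m]. Freezing
    the weights requires [N] to be a multiple of a number that depends on the noise term; factorials
    serve all terms at once. *)

Section with_high_probability.
Context (R : realType) (d : measure_display) (T : measurableType d).
Context (P : probability T R).

(* The exceptional event is only enclosed in a measurable one, as in
   [cvg0_in_probability]. *)
Definition whp (p : R) (Q : T -> Prop) : Prop :=
  exists2 A : set T, measurable A /\ (P A <= p%:E)%E & forall w, ~ A w -> Q w.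

Lemma whpS (p p' : R) (Q Q' : T -> Prop) :
  p <= p' -> (forall w, Q w -> Q' w) -> whp p Q -> whp p' Q'.
Proof.
move=> pp' QQ' [A [mA PA] AQ]; exists A.
  by split => //; apply: le_trans PA _; rewrite lee_fin.
by move=> w /AQ /QQ'.
Qed.

Lemma whpI (p1 p2 : R) (Q1 Q2 : T -> Prop) :
  whp p1 Q1 -> whp p2 Q2 -> whp (p1 + p2) (fun w => Q1 w /\ Q2 w).
Proof.
move=> [A [mA PA] AQ] [B [mB PB] BQ]; exists (A `|` B).
  split; first exact: measurableU.
  by apply: le_trans (measureU2 _ mA mB) _; rewrite EFinD leeD.
by move=> w AB; split; [apply: AQ | apply: BQ] => H; apply: AB; [left|right].
Qed.

Lemma whp_ae (p : R) (Q : T -> Prop) : 0 <= p -> {ae P, forall w, Q w} -> whp p Q.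
Proof.
move=> p0 [A [mA PA] AQ]; exists A.
  by split => //; rewrite PA lee_fin.
by move=> w nA; apply: contrapT => nQ; apply: nA; apply: AQ.
Qed.

Lemma whp_forall (n : nat) (Q : nat -> T -> Prop) :
  (forall i, (i < n)%N -> forall p, 0 < p -> whp p (Q i)) ->
  forall p, 0 < p -> whp p (fun w => forall i, (i < n)%N -> Q i w).
Proof.
elim: n => [_ p p0|n IH H p p0].
  by apply: whp_ae; [exact: ltW | apply: aeW].
have p2 : 0 < p / 2 by rewrite divr_gt0.
have H1 := IH (fun i ilt => H i (ltnW ilt)) _ p2.
apply: whpS (whpI H1 (H n (ltnSn n) _ p2)); first by rewrite -splitr.
move=> w [h1 h2] i; rewrite ltnS leq_eqVlt => /predU1P[->//|]; exact: h1.
Qed.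

(** The measurable enclosures for [p = 1 / (n + 1)] intersect in a null set that contains every
    failure of [Q]. *)
Lemma ae_whp (Q : T -> Prop) :
  (forall p, 0 < p -> whp p Q) -> {ae P, forall w, Q w}.
Proof.
move=> H.
have H' n : whp (n.+1%:R^-1) Q by apply: H; rewrite invr_gt0.
pose A n := projT1 (cid2 (H' n)).
have mA n : measurable (A n) by rewrite /A; case: cid2 => /= B [].
have PA n : (P (A n) <= (n.+1%:R^-1)%:E)%E by rewrite /A; case: cid2 => /= B [].
have AQ n w : ~ A n w -> Q w by rewrite /A; case: cid2 => /= B _; apply.
exists (\bigcap_n A n); split.
- exact: bigcapT_measurable.
- apply/eqP; rewrite -measure_le0; apply/lee_addgt0Pr => e e0; rewrite add0e.
  have [n ne] : exists n, n.+1%:R^-1 <= e.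
    exists (Num.truncn e^-1).
    rewrite -[leRHS]invrK lef_pV2 ?posrE ?invr_gt0//.
    exact: ltW (truncnS_gt _).
  apply: le_trans (le_trans (PA n) _); last by rewrite lee_fin.
  apply: le_measure; rewrite ?inE//; first exact: bigcapT_measurable.
  exact: bigcap_inf.
- move=> w /= nQ n _; apply: contrapT => nA; exact: nQ (AQ _ _ nA).
Qed.

Lemma whp_markov (f : T -> R) (a c : R) :
  measurable_fun setT f -> (forall w, 0 <= f w) -> 0 < c ->
  (\int[P]_w (f w)%:E <= a%:E)%E -> whp (a / c) (fun w => f w < c).
Proof.
move=> mf f0 c0 fa.
exists [set w | c <= f w]; last by move=> w /= /negP; rewrite -ltNge.
have -> : [set w | c <= f w] = setT `&` [set w | (c%:E <= `|(EFin \o f) w|)%E].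
  by apply/seteqP; split => w /=; rewrite lee_fin ger0_norm// => -[].
split.
  apply: emeasurable_fun_c_infty => //; apply: measurableT_comp => //.
  exact/measurable_EFinP.
have := @le_integral_abse _ _ _ P setT measurableT (EFin \o f) c.
move=> /(_ _ c0) H; rewrite EFinM muleC lee_pdivlMl//.
apply: le_trans (H _) _; first exact/measurable_EFinP.
apply: le_trans fa; apply: ge0_le_integral => //=.
- by apply/measurable_EFinP; apply: measurableT_comp.
- exact/measurable_EFinP.
- by move=> x _; rewrite lee_fin ger0_norm.
Qed.

(** Continuity of [P] from above. It turns a pathwise finiteness statement, where [n] depends on
    [w], into one [n] valid outside an event of probability [p]: moduli of continuity, bounds,
    variations and localizing times are all treated this way. *)
Lemma probability_decreasing_small (A : nat -> set T) :
  (forall n, measurable (A n)) -> (forall n, A n.+1 `<=` A n) ->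
  {ae P, forall w, exists n, ~ A n w} ->
  forall p : R, 0 < p -> exists n, (P (A n) <= p%:E)%E.
Proof.
move=> mA dA HA p p0.
have niA : nonincreasing_seq A.
  apply/nonincreasing_seqP => n; exact/subsetPset/dA.
have mI : measurable (\bigcap_n A n) by exact: bigcapT_measurable.
have PI : P (\bigcap_n A n) = 0%E.
  apply: measure_negligible => //; apply: negligibleS HA => w /= Aw [n]; apply.
  exact: Aw.
have H : P \o A @ \oo --> 0%E.
  rewrite -PI; apply: (@nonincreasing_cvg_mu _ T R P A) => //.
  exact: le_lt_trans (probability_le1 _ (mA 0%N)) (ltry _).
have : \forall n \near \oo, (P (A n) < p%:E)%E.
  apply: (H [set x | (x < p%:E)%E]); apply: open_nbhs_nbhs; split => /=.
    exact: open_ereal_lt_ereal.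
  by rewrite lte_fin.
by move=> [n _ /(_ n (leqnn n)) /= h]; exists n; exact: ltW.
Qed.

End with_high_probability.

(** * Increments of Brownian motion *)

Section normal_moments.
Context (R : realType) (s : R) (s0 : 0 < s).
Let N := normal_prob 0 s.
Local Notation mu := (@lebesgue_measure R).
Local Open Scope ereal_scope.

(** The Radon-Nikodym density of [N] and [normal_pdf] have the same integral over every measurable
    set, hence agree almost everywhere. *)
Lemma ge0_integral_normal_prob (f : R -> \bar R) :
  measurable_fun setT f -> (forall x, 0 <= f x) ->
  \int[N]_x f x = \int[mu]_x (f x * (normal_pdf 0 s x)%:E).
Proof.
move=> mf f0; have dom := @normal_prob_dominates R 0%R s.
have := @Radon_Nikodym_SigmaFinite.change_of_variables _ _ R N mu dom f setT f0
  measurableT mf.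
rewrite /N /= => <-; apply: ae_eq_integral => //.
- apply: emeasurable_funM => //; apply: (measurable_int mu).
  exact: Radon_Nikodym_SigmaFinite.f_integrable.
- apply: emeasurable_funM => //; apply/measurable_EFinP.
  exact: measurable_normal_pdf.
- apply: ae_eqe_mul2l; apply: integral_ae_eq => //.
  + exact: Radon_Nikodym_SigmaFinite.f_integrable.
  + by apply/measurable_EFinP; exact: measurable_normal_pdf.
  + by move=> E _ mE; rewrite -Radon_Nikodym_SigmaFinite.f_integral.
Qed.

Lemma normal_pdfNx (x : R) : normal_pdf 0 s (- x) = normal_pdf 0 s x.
Proof.
by rewrite normal_pdfE ?gt_eqF// /normal_fun !subr0 sqrrN.
Qed.

(** [x ^+ 2] times the density of deviation [s] is dominated by [8 * s ^+ 2] times the density of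
    deviation [sqrt 2 * s]. The constant 8 bounds [4 * sqrt 2], and it is the 8 of the later
    isometry estimates. *)
Lemma normal_second_moment : \int[N]_x (x ^+ 2)%:E <= (8 * s ^+ 2)%:E.
Proof.
rewrite ge0_integral_normal_prob; last 2 first.
- by apply/measurable_EFinP; apply: measurable_funX.
- by move=> x; rewrite lee_fin sqr_ge0.
pose s' : R := (Num.sqrt 2 * s)%R.
have s'0 : (0 < s')%R by rewrite mulr_gt0 // sqrtr_gt0.
have s'2 : (s' ^+ 2 = 2 * s ^+ 2)%R by rewrite exprMn sqr_sqrtr.
have sp : (0 < s ^+ 2)%R by rewrite exprn_gt0.
have sqrt2 : (Num.sqrt 2 <= 2 :> R)%R.
  by have := sqr_sqrtr (ler0n R 2); have := sqrtr_ge0 (2 : R); nra.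
have peak : (normal_peak s = Num.sqrt 2 * normal_peak s')%R.
  rewrite /normal_peak s'2.
  rewrite (_ : (2 * s ^+ 2 * pi) *+ 2 = 2 * (s ^+ 2 * pi *+ 2))%R; last by ring.
  by rewrite sqrtrM// invfM mulrA divff ?mul1r// gt_eqF// sqrtr_gt0.
apply: (@le_trans _ _ (\int[mu]_x ((8 * s ^+ 2)%:E * (normal_pdf 0 s' x)%:E))); last first.
  rewrite ge0_integralZl//.
  - by rewrite integral_normal_pdf mule1.
  - by apply/measurable_EFinP; exact: measurable_normal_pdf.
  - by move=> x _; rewrite lee_fin normal_pdf_ge0.
  - by rewrite lee_fin mulr_ge0// ltW.
apply: ge0_le_integral => //.
- by move=> x _; rewrite -EFinM lee_fin mulr_ge0 ?sqr_ge0 ?normal_pdf_ge0.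
- apply: emeasurable_funM; apply/measurable_EFinP; first exact: measurable_funX.
  exact: measurable_normal_pdf.
- apply: emeasurable_funM; apply/measurable_EFinP => //.
  exact: measurable_normal_pdf.
move=> x _; rewrite -!EFinM lee_fin !normal_pdfE ?gt_eqF//.
rewrite peak /normal_fun !subr0 s'2.
(* [y * exp (- 2 y) <= exp (- y)] with [y = x^2 / (4 s^2)] *)
set y := (x ^+ 2 / (4 * s ^+ 2))%R.
have -> : (- x ^+ 2 / (s ^+ 2 *+ 2) = - y + - y)%R.
  by rewrite /y; field; rewrite gt_eqF.
have -> : (- x ^+ 2 / ((2 * s ^+ 2) *+ 2) = - y)%R.
  by rewrite /y; field; rewrite gt_eqF.
have -> : (x ^+ 2 = 4 * s ^+ 2 * y)%R by rewrite /y; field; rewrite gt_eqF.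
rewrite expRD.
have y0 : (0 <= y)%R by rewrite divr_ge0 ?sqr_ge0// mulr_ge0// ltW.
have e0 := expR_gt0 (- y).
have ye : (y * expR (- y) <= 1)%R.
  rewrite expRN ler_pdivrMr ?expR_gt0// mul1r.
  by apply: le_trans (expR_ge1Dx _); rewrite lerDr.
have p0 := normal_peak_ge0 s'.
have q0 : (0 <= Num.sqrt 2 :> R)%R by rewrite sqrtr_ge0.
rewrite [leLHS](_ : _ = (4 * s ^+ 2 * (normal_peak s' * expR (- y))) *
  (Num.sqrt 2 * (y * expR (- y))))%R; last by ring.
rewrite [leRHS](_ : _ = (4 * s ^+ 2 * (normal_peak s' * expR (- y))) * 2)%R; last by ring.
apply: ler_wpM2l; first by rewrite !mulr_ge0// ltW.
by apply: le_trans sqrt2; rewrite ler_piMr.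
Qed.

Lemma integrable_normal_prob_id : N.-integrable setT (EFin : R -> \bar R).
Proof.
apply/integrableP; split; first exact/measurable_EFinP.
apply: (@le_lt_trans _ _ (\int[N]_x (1 + (x ^+ 2)%:E))).
  apply: ge0_le_integral => //=.
  - by apply/measurable_EFinP; exact: (@normr_measurable R setT).
  - apply: emeasurable_funD => //; apply/measurable_EFinP.
    exact: measurable_funX.
  - move=> x _; rewrite lee_fin; have [x0|x0] := ger0P x; nra.
rewrite ge0_integralD//=; last 2 first.
- by move=> x _; rewrite lee_fin sqr_ge0.
- by apply/measurable_EFinP; exact: measurable_funX.
rewrite integral_cst//= mul1e; apply: lte_add_pinfty.
  by rewrite /N probability_setT ltry.
exact: le_lt_trans normal_second_moment (ltry _).
Qed.

(** The density is even, so [x -> - x] exchanges the positive and negative parts of the integrand,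
    whose integrals are finite. *)
Lemma normal_first_moment : \int[N]_x x%:E = 0.
Proof.
rewrite integralE.
suff H : \int[N]_x ((fun x : R => x%:E)^\- x) = \int[N]_x ((fun x : R => x%:E)^\+ x).
  rewrite H subee//; apply: integrable_pos_fin_num => //.
  exact: integrable_normal_prob_id.
rewrite !ge0_integral_normal_prob//; last 2 first.
- by apply: measurable_funepos; apply/measurable_EFinP.
- by apply: measurable_funeneg; apply/measurable_EFinP.
(* [G] is the negative part times the density, written as a continuous function because the
   substitution formula asks for continuity. *)
pose G (x : R) : R := (Num.max (- x) 0 * normal_pdf 0 s x)%R.
have cG : continuous G.
  move=> x; apply: cvgM; last by apply: continuous_normal_pdf; rewrite gt_eqF.
  have := @continuous_max _ R (fun x : R => - x)%R (fun=> 0%R) x.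
  by apply; [exact: (@opp_continuous R^o) | exact: cst_continuous].
have G0 x : (0 <= G x)%R by rewrite mulr_ge0 ?normal_pdf_ge0// le_max lexx orbT.
have := @ge0_integration_by_substitutionNy R G 0%R.
rewrite oppr0 => /(_ (continuous_subspaceT cG) (fun x _ => G0 x)) H.
transitivity (\int[mu]_(x in `]-oo, 0%R]) (G x)%:E).
  rewrite [RHS]integral_mkcond; apply: eq_integral => x _.
  rewrite patchE /G; case: ifPn => [_|].
    by rewrite funenegE EFinM /= EFin_max.
  rewrite notin_setE /= in_itv /= => /negP; rewrite -ltNge => x0.
  by rewrite funenegE /= -EFin_max max_r ?mul0e// oppr_le0 ltW.
rewrite H [LHS]integral_mkcond; apply: eq_integral => x _.
rewrite patchE /G /=; case: ifPn => [_|].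
  by rewrite normal_pdfNx opprK funeposE EFinM /= EFin_max.
rewrite notin_setE /= in_itv /= andbT => /negP; rewrite -ltNge => x0.
by rewrite funeposE /= -EFin_max max_r ?mul0e// ltW.
Qed.

End normal_moments.

Lemma big_ord_block (V : nmodType) (N B : nat) (f : nat -> V) :
  \sum_(l < N * B) f l = \sum_(i < N) \sum_(b < B) f (i * B + b)%N.
Proof.
elim: N => [|N IH]; first by rewrite !big_ord0.
by rewrite mulSnr big_split_ord /= IH big_ord_recr.
Qed.

Section measurable_wrt_theory.
Context (R : realType) (d : measure_display) (T : measurableType d).

(** A bridge that makes the closure properties of [measurable_fun] available relative to each
    [F t]. *)
Lemma measurable_wrtP (G : set (set T)) (X : T -> R) : sigma_algebra setT G ->
  measurable_wrt G X <->
  measurable_fun (setT : set (g_sigma_algebraType G)) (X : g_sigma_algebraType G -> R).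
Proof.
move=> hG; have E : (@measurable _ (g_sigma_algebraType G)) = G.
  exact: measurable_g_measurableTypeE.
split => [mX _ Y mY|mX B mB].
  by rewrite setTI E; exact: mX.
by have := mX measurableT B mB; rewrite setTI E.
Qed.

End measurable_wrt_theory.

Section filtration_theory.
Context (R : realType) (d : measure_display) (T : measurableType d).
Context (P : probability T R) (F : R -> set (set T)) (hF : filtration F).

Lemma filtration_sigma t : 0 <= t -> sigma_algebra setT (F t).
Proof. by move=> t0; have [/(_ t t0)[]] := hF. Qed.

Lemma measurable_wrt_le s t (X : T -> R) : 0 <= s -> s <= t ->
  measurable_wrt (F s) X -> measurable_wrt (F t) X.
Proof.
move=> s0 st mX B mB; have [_ /(_ s t s0 st)] := hF; apply; exact: mX.
Qed.

Lemma measurable_wrt_fun t (X : T -> R) : 0 <= t ->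
  measurable_wrt (F t) X -> measurable_fun setT X.
Proof.
move=> t0 mX _ B mB; rewrite setTI; have [/(_ t t0)[_ +] _] := hF; apply.
exact: mX.
Qed.

End filtration_theory.

Section increments.
Context (R : realType) (d : measure_display) (T : measurableType d).
Context (P : probability T R) (F : R -> set (set T)) (hF : filtration F).
Context (K : nat) (beta : 'I_K -> R -> T -> R) (hbeta : brownian_motion P F beta).
Context (k : 'I_K).
Let B := beta k.

Lemma brownian_adapted : adapted F B.
Proof. by case: hbeta => + _ _ _; apply. Qed.

Section one_increment.
Context (s t : R) (s0 : 0 <= s) (st : s < t).
Context (xi : T -> R) (mxi : measurable_wrt (F s) xi).
Let Delta w := B t w - B s w.
Let N := normal_prob 0 (Num.sqrt (t - s)).
Let R' := measurableTypeR R.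

Let ts0 : 0 < Num.sqrt (t - s).
Proof. by rewrite sqrtr_gt0 subr_gt0. Qed.

Lemma measurable_increment : measurable_fun setT Delta.
Proof.
have t0 : 0 <= t := le_trans s0 (ltW st).
apply: measurable_funB.
  exact: (measurable_wrt_fun hF t0 (brownian_adapted t0)).
exact: (measurable_wrt_fun hF s0 (brownian_adapted s0)).
Qed.

Let mxiT : measurable_fun setT xi.
Proof. exact: (measurable_wrt_fun hF s0 mxi). Qed.

(** This is the product formula of [brownian_motion] with the whole line in every coordinate other
    than [k]. *)
Lemma increment_independent (A D : set R) : measurable A -> measurable D ->
  P (xi @^-1` A `&` Delta @^-1` D) = (P (xi @^-1` A) * N D)%E.
Proof.
move=> mA mD; case: hbeta => _ _ _.
pose D' j := if j == k then D else setT.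
have mD' j : measurable (D' j) by rewrite /D'; case: ifP.
move=> /(_ s t s0 st (xi @^-1` A) D' (mxi mA) mD').
rewrite (bigD1 k)//= big1 ?mulr1 => [|j jk]; last first.
  by rewrite /D' (negbTE jk) probability_setT.
rewrite mule1 {2}/D' eqxx => <-; congr (P _); apply/seteqP; split => w /=.
  by move=> [Aw Dw]; split => // j; rewrite /D'; case: eqP => [->|].
by move=> [Aw /(_ k)]; rewrite /D' eqxx.
Qed.

(** By independence the law of [(xi, Delta)] agrees with the product measure on rectangles, hence
    everywhere; Tonelli then gives the iterated integral. *)
Lemma expectation_increment (h : R * R' -> \bar R) :
  measurable_fun setT h -> (forall z, 0 <= h z)%E ->
  (\int[P]_w h (xi w, Delta w) = \int[P]_w \int[N]_y h (xi w, y))%E.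
Proof.
move=> mh h0.
pose X : {mfun T >-> R} := MeasurableFun.Pack (MeasurableFun.Class (isMeasurableFun.Build _ _ _ _ xi mxiT)).
pose mu := distribution P X.
have mphi : measurable_fun setT (fun w => (xi w, Delta w : R')).
  by apply: measurable_fun_pair => //; exact: measurable_increment.
pose phi : {mfun T >-> (R * R')%type} :=
  
  MeasurableFun.Pack (MeasurableFun.Class (isMeasurableFun.Build _ _ _ _ _ mphi)).
transitivity (\int[distribution P phi]_z h z)%E.
  by rewrite ge0_integral_distribution.
transitivity (\int[(mu \x N)%E]_z h z)%E.
  apply: eq_measure_integral => Z mZ _.
  apply/esym; apply: product_measure_unique => // A D mA mD.
  by rewrite -increment_independent.
rewrite fubini_tonelli1// ge0_integral_distribution//.
- exact: measurable_fun_fubini_tonelli_F.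
- by move=> x; apply: integral_ge0.
Qed.

Let mfst_snd (f g : R -> R) : measurable_fun setT f -> measurable_fun setT g ->
  measurable_fun setT (fun z : R * R' => (f z.1 * g z.2)%:E).
Proof.
move=> mf mg; apply/measurable_EFinP; apply: measurable_funM.
  by apply: measurableT_comp mf _; exact: measurable_fst.
have mg' : measurable_fun (setT : set R') (g : R' -> R) := mg.
exact: (measurableT_comp mg' measurable_snd).
Qed.

Lemma expectation_mul_sqr_increment : (forall w, 0 <= xi w) ->
  (\int[P]_w (xi w * Delta w ^+ 2)%:E <=
   (8 * (t - s))%:E * \int[P]_w (xi w)%:E)%E.
Proof.
move=> xi0.
(* The absolute value makes [h] nonnegative on the whole plane; along [(xi, Delta)] it changes
   nothing, since [xi >= 0]. *)
pose h (z : R * R') := (`|z.1| * (z.2 : R) ^+ 2)%:E.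
have mh : measurable_fun setT h.
  apply: (@mfst_snd (@Num.norm _ R) (fun x => x ^+ 2)); first exact: normr_measurable.
  exact: measurable_funX.
have h0 z : (0 <= h z)%E by rewrite lee_fin mulr_ge0// sqr_ge0.
rewrite (eq_integral (fun w => h (xi w, Delta w))); last first.
  by move=> w _; rewrite /h /= ger0_norm.
rewrite expectation_increment//.
rewrite (eq_integral (fun w => (\int[N]_y (y ^+ 2)%:E) * (xi w)%:E)%E); last first.
  move=> w _; rewrite muleC -ge0_integralZl//; last 3 first.
  - by apply/measurable_EFinP; exact: measurable_funX.
  - by move=> y _; rewrite lee_fin sqr_ge0.
  - by rewrite lee_fin.
  by apply: eq_integral => y _; rewrite /h /= ger0_norm.
have N2 := normal_second_moment ts0.
rewrite sqr_sqrtr ?subr_ge0 ?(ltW st)// in N2.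
have N0 : (0 <= \int[N]_y (y ^+ 2)%:E)%E.
  by apply: integral_ge0 => y _; rewrite lee_fin sqr_ge0.
have NE : (\int[N]_y (y ^+ 2)%:E = (fine (\int[N]_y (y ^+ 2)%:E))%:E)%E.
  by rewrite fineK// ge0_fin_numE// (le_lt_trans N2)// ltry.
rewrite NE ge0_integralZl//; last 3 first.
- exact/measurable_EFinP.
- by move=> w _; rewrite lee_fin.
- by rewrite lee_fin fine_ge0.
rewrite -NE lee_wpmul2r//; by apply: integral_ge0 => w _; rewrite lee_fin.
Qed.

(** [expectation_increment] covers nonnegative functions only, so the positive and negative parts of
    [xi * Delta] are treated separately; for frozen [xi w] their inner integrals agree because [N]
    has mean zero. *)
Lemma expectation_mul_increment : P.-integrable setT (EFin \o xi) ->
  P.-integrable setT (fun w => (xi w * Delta w)%:E) /\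
  (\int[P]_w (xi w * Delta w)%:E = 0)%E.
Proof.
move=> ixi.
have iN := integrable_normal_prob_id ts0.
have mxd : measurable_fun setT (fun w => (xi w * Delta w)%:E).
  apply/measurable_EFinP; apply: measurable_funM => //; exact: measurable_increment.
have ixd : P.-integrable setT (fun w => (xi w * Delta w)%:E).
  apply/integrableP; split => //.
  pose h (z : R * R') := (`|z.1| * `|z.2 : R|)%:E.
  have mh : measurable_fun setT h.
    by apply: (@mfst_snd (@Num.norm _ R) (@Num.norm _ R)); exact: normr_measurable.
  have h0 z : (0 <= h z)%E by rewrite lee_fin mulr_ge0.
  rewrite (eq_integral (fun w => h (xi w, Delta w))); last first.
    by move=> w _; rewrite /h /= normrM.
  rewrite expectation_increment//.
  rewrite (eq_integral (fun w => (\int[N]_y `|y%:E|) * `|(xi w)%:E|)%E); last first.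
    move=> w _; rewrite muleC -ge0_integralZl//.
    - by apply/measurable_EFinP; exact: normr_measurable.
  have [_ N1] := integrableP _ _ _ iN.
  have [_ X1] := integrableP _ _ _ ixi.
  have N0 : (0 <= \int[N]_y `|y%:E|)%E by exact: integral_ge0.
  have NE : ((\int[N]_y `|y%:E|) = (fine (\int[N]_y `|y%:E|))%:E)%E.
    by rewrite fineK// ge0_fin_numE.
  rewrite NE ge0_integralZl//; last 2 first.
  - by apply: measurableT_comp => //; exact/measurable_EFinP.
  - by rewrite lee_fin fine_ge0.
  rewrite -NE; apply: lte_mul_pinfty => //; last by rewrite ge0_fin_numE.
split=> //; rewrite integralE.
pose hp (z : R * R') := ((fun z : R * R' => (z.1 * (z.2 : R))%:E)^\+ z)%E.
pose hn (z : R * R') := ((fun z : R * R' => (z.1 * (z.2 : R))%:E)^\- z)%E.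
have mhpn : measurable_fun setT (fun z : R * R' => (z.1 * (z.2 : R))%:E).
  exact: (@mfst_snd id id).
have mhp : measurable_fun setT hp by exact: measurable_funepos.
have mhn : measurable_fun setT hn by exact: measurable_funeneg.
have -> : (\int[P]_x ((fun w => (xi w * Delta w)%:E)^\+ x) =
           \int[P]_x ((fun w => (xi w * Delta w)%:E)^\- x))%E; last first.
  by rewrite subee//; apply: integrable_neg_fin_num.
transitivity (\int[P]_w hp (xi w, Delta w))%E.
  by apply: eq_integral => w _; rewrite /hp !funeposE.
transitivity (\int[P]_w hn (xi w, Delta w))%E; last first.
  by apply: eq_integral => w _; rewrite /hn !funenegE.
rewrite !expectation_increment//; try by move=> z; rewrite ?funepos_ge0 ?funeneg_ge0.
apply: eq_integral => w _.
have iy : N.-integrable setT (fun y : R => ((xi w) * y)%:E).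
  by under eq_fun do rewrite EFinM; exact: integrableZl.
have : (\int[N]_y ((xi w) * y)%:E = 0)%E.
  under eq_integral do rewrite EFinM.
  by rewrite integralZl// normal_first_moment// mule0.
rewrite integralE => /eqP.
rewrite sube_eq ?integrable_pos_fin_num// ?add0e.
move=> /eqP H.
transitivity (\int[N]_x ((fun y : R => (xi w * y)%:E)^\+ x))%E.
  by apply: eq_integral => y _; rewrite /hp !funeposE.
by rewrite H; apply: eq_integral => y _; rewrite /hn !funenegE.
Qed.

End one_increment.
End increments.

(** * Discrete Ito sums *)

Section discrete_ito.
Context (R : realType) (d : measure_display) (T : measurableType d).
Context (P : probability T R) (F : R -> set (set T)) (hF : filtration F).
Context (K : nat) (beta : 'I_K -> R -> T -> R) (hbeta : brownian_motion P F beta).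
Context (k : 'I_K).
Let B := beta k.

Definition ito_sum (s : nat -> R) (c : nat -> T -> R) (a m : nat) (w : T) : R :=
  \sum_(l < m) c (a + l)%N w * (B (s (a + l).+1) w - B (s (a + l)%N) w).

Context (n : nat) (s : nat -> R).
Hypothesis s0 : forall l, (l <= n)%N -> 0 <= s l.
Hypothesis s_lt : forall l, (l < n)%N -> s l < s l.+1.
Context (c : nat -> T -> R).
Hypothesis mc : forall l, (l < n)%N -> measurable_wrt (F (s l)) (c l).

Let mcT l : (l < n)%N -> measurable_fun setT (c l).
Proof. by move=> ln; exact: (measurable_wrt_fun hF (s0 (ltnW ln)) (mc ln)). Qed.

Let mBT l : (l <= n)%N -> measurable_fun setT (B (s l)).
Proof.
move=> ln; have := brownian_adapted hbeta k (s0 ln).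
exact: (measurable_wrt_fun hF (s0 ln)).
Qed.

Lemma measurable_wrt_ito_sum a m : (a + m <= n)%N ->
  measurable_wrt (F (s (a + m)%N)) (ito_sum s c a m).
Proof.
move=> amn; have sg := filtration_sigma hF (s0 amn).
apply/(measurable_wrtP _ sg).
have sle l l' : (l <= l')%N -> (l' <= n)%N -> s l <= s l'.
  move=> /subnK <-; elim: (l' - l)%N => [//|j IH] jn.
  exact: le_trans (IH (ltnW jn)) (ltW (s_lt jn)).
apply: measurable_sum => l; have ln : (a + l < n)%N.
  by apply: leq_trans amn; rewrite ltn_add2l.
have lm : (a + l < a + m)%N by rewrite ltn_add2l.
apply: measurable_funM.
  apply/(measurable_wrtP _ sg); apply: (measurable_wrt_le hF _ _ (mc ln)).
    exact: s0 (ltnW ln).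
  exact: sle (ltnW lm) amn.
apply: measurable_funB; apply/(measurable_wrtP _ sg).
  apply: (measurable_wrt_le hF _ _ (brownian_adapted hbeta k (s0 ln))).
    exact: s0 ln.
  exact: sle lm amn.
apply: (measurable_wrt_le hF _ _ (brownian_adapted hbeta k (s0 (ltnW ln)))).
  exact: s0 (ltnW ln).
exact: sle (ltnW lm) amn.
Qed.

Lemma measurable_ito_sum a m : (a + m <= n)%N ->
  measurable_fun setT (ito_sum s c a m).
Proof.
move=> amn; exact: (measurable_wrt_fun hF (s0 amn) (measurable_wrt_ito_sum amn)).
Qed.

Hypothesis cb : forall l, (l < n)%N -> exists C : R, forall w, `|c l w| <= C.

(** A one-sided isometry, by induction on the number of terms: in the square of [M + e * D] the
    cross term has mean zero, as [2 * M * e] is known before the increment [D], and the last square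
    costs the factor 8. Boundedness of the coefficients makes all these terms integrable. *)
Lemma ito_sum_L2 a m : (a + m <= n)%N ->
  (\int[P]_w (ito_sum s c a m w ^+ 2)%:E <=
   8%:E * \int[P]_w (\sum_(l < m) c (a + l)%N w ^+ 2 *
                       (s (a + l).+1 - s (a + l)%N))%:E)%E.
Proof.
pose q m w := \sum_(l < m) c (a + l)%N w ^+ 2 * (s (a + l).+1 - s (a + l)%N).
rewrite -/(q m).
have ds l : (l < n)%N -> 0 <= s l.+1 - s l by move=> ln; rewrite subr_ge0 ltW// s_lt.
have mq j : (a + j <= n)%N -> measurable_fun setT (q j).
  move=> jn; apply: measurable_sum => l; apply: measurable_funM => //.
  by apply: measurable_funX; apply: mcT; apply: leq_trans jn; rewrite ltn_add2l.
have q0 j w : (a + j <= n)%N -> 0 <= q j w.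
  move=> jn; apply: sumr_ge0 => l _; rewrite mulr_ge0 ?sqr_ge0// ds//.
  by apply: leq_trans jn; rewrite ltn_add2l.
have ic l : (l < n)%N -> P.-integrable setT (fun w => (c l w ^+ 2)%:E).
  move=> ln; have [C HC] := cb ln.
  apply: (@le_integrable _ _ _ P _ measurableT _ (cst (C ^+ 2)%:E)).
  - by apply/measurable_EFinP; apply: measurable_funX; exact: mcT.
  - move=> w _ /=; rewrite lee_fin !ger0_norm ?sqr_ge0// -real_normK ?num_real//.
    by rewrite lerXn2r ?nnegrE// (le_trans _ (HC w)).
  - exact: finite_measure_integrable_cst.
elim: m => [|m IH] amn.
  rewrite (eq_integral (cst 0%E)); last by move=> w _; rewrite /ito_sum big_ord0 expr0n.
  rewrite integral0 mule_ge0//; apply: integral_ge0 => w _.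
  by rewrite lee_fin q0.
have lm : (a + m < n)%N by rewrite -addnS.
have {}IH := IH (ltnW lm).
set M := ito_sum s c a m in IH *.
pose D w := B (s (a + m).+1) w - B (s (a + m)%N) w.
pose e := c (a + m)%N.
have E w : (ito_sum s c a m.+1 w = M w + e w * D w)%R.
  by rewrite /ito_sum big_ord_recr.
have mM : measurable_fun setT M by apply: measurable_ito_sum; exact: ltnW.
have me : measurable_fun setT e by exact: mcT.
have mD : measurable_fun setT D by apply: measurable_funB; apply: mBT => //; exact: ltnW.
have tm0 := s0 (ltnW lm); have tlt := s_lt lm.
have iq j : (a + j <= n)%N -> P.-integrable setT (EFin \o q j).
  elim: j => [_|j IHj jn].
    apply: eq_integrable (integrable0 _ _) => // w _ /=.
    by rewrite /q big_ord0.
  have jn' : (a + j < n)%N by rewrite -addnS.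
  apply: (@eq_integrable _ _ _ _ _ _ (EFin \o q j \+
    (fun w => (s (a + j).+1 - s (a + j)%N)%:E * (c (a + j)%N w ^+ 2)%:E))%E) => //.
    by move=> w _; rewrite /q /= big_ord_recr /= EFinD (mulrC (c _ w ^+ 2)) EFinM.
  apply: integrableD => //; first exact: IHj (ltnW jn').
  by apply: integrableZl => //; exact: ic.
have iM2 : P.-integrable setT (fun w => (M w ^+ 2)%:E).
  apply/integrableP; split; first by apply/measurable_EFinP; exact: measurable_funX.
  rewrite (eq_integral (fun w => (M w ^+ 2)%:E)); last first.
    by move=> w _; rewrite gee0_abs// lee_fin sqr_ge0.
  apply: le_lt_trans IH _; apply: lte_mul_pinfty => //.
  have [_ ] := integrableP _ _ _ (iq _ (ltnW lm)).
  rewrite (eq_integral (fun w => (q m w)%:E)) => //.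
  by move=> w _; rewrite /= ger0_norm// q0// ltnW.
have iMe : P.-integrable setT (EFin \o (fun w => 2 * M w * e w)).
  apply: (@le_integrable _ _ _ P _ measurableT _ (fun w => (M w ^+ 2)%:E + (e w ^+ 2)%:E)%E).
  - by apply/measurable_EFinP; apply: measurable_funM => //; exact: measurable_funM.
  - move=> w _ /=; rewrite lee_fin (ger0_norm (addr_ge0 _ _)) ?sqr_ge0//.
    have := sqr_ge0 (M w - e w); have := sqr_ge0 (M w + e w).
    by rewrite ler_norml; nra.
  - by apply: integrableD => //; exact: ic.
have mMe : measurable_wrt (F (s (a + m)%N)) (fun w => 2 * M w * e w).
  have sg := filtration_sigma hF tm0.
  apply/(measurable_wrtP _ sg); apply: measurable_funM; last exact/(measurable_wrtP _ sg)/mc.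
  apply: measurable_funM => //; apply/(measurable_wrtP _ sg).
  by apply: measurable_wrt_ito_sum; exact: ltnW.
have me2 : measurable_wrt (F (s (a + m)%N)) (fun w => e w ^+ 2).
  have sg := filtration_sigma hF tm0.
  apply/(measurable_wrtP _ sg); apply: measurable_funX.
  exact/(measurable_wrtP _ sg)/mc.
have [i1 E1] := expectation_mul_increment hF hbeta k tm0 tlt mMe iMe.
have E2 := expectation_mul_sqr_increment hF hbeta k tm0 tlt me2 (fun w => sqr_ge0 (e w)).
have i2 : P.-integrable setT (fun w => (e w ^+ 2 * D w ^+ 2)%:E).
  apply/integrableP; split.
    by apply/measurable_EFinP; apply: measurable_funM; exact: measurable_funX.
  rewrite (eq_integral (fun w => (e w ^+ 2 * D w ^+ 2)%:E)); last first.
    by move=> w _; rewrite gee0_abs// lee_fin mulr_ge0// sqr_ge0.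
  apply: le_lt_trans E2 _; apply: lte_mul_pinfty => //.
    by rewrite lee_fin mulr_ge0// ds.
  have [_] := integrableP _ _ _ (ic _ lm).
  rewrite (eq_integral (fun w => (e w ^+ 2)%:E)) => //.
  by move=> w _; rewrite gee0_abs// lee_fin sqr_ge0.
rewrite (eq_integral (fun w => ((M w ^+ 2)%:E + (2 * M w * e w * D w)%:E) +
  (e w ^+ 2 * D w ^+ 2)%:E)%E); last first.
  by move=> w _; rewrite E -!EFinD; congr (_%:E); ring.
rewrite integralD//; last exact: integrableD.
rewrite integralD// [X in (_ + X + _)%E]E1 adde0.
rewrite [X in (_ <= _ * X)%E](eq_integral (fun w => (q m w)%:E +
  (s (a + m).+1 - s (a + m)%N)%:E * (e w ^+ 2)%:E)%E); last first.
  by move=> w _; rewrite /q big_ord_recr /= EFinD (mulrC (c _ w ^+ 2)) EFinM.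
rewrite integralD//; last 2 first.
- exact: iq _ (ltnW lm).
- by apply: integrableZl => //; exact: ic.
rewrite integralZl//; last exact: ic.
rewrite muleDr//; last first.
  by rewrite fin_num_adde_defr// integrable_fin_num//; exact: iq _ (ltnW lm).
by apply: leeD => //; rewrite muleA -EFinM.
Qed.

End discrete_ito.

(** * Cut-off of the integrand and sums of squares over blocks *)

Section ito_blocks.
Context (R : realType) (d : measure_display) (T : measurableType d).
Context (P : probability T R) (F : R -> set (set T)) (hF : filtration F).
Context (K : nat) (beta : 'I_K -> R -> T -> R) (hbeta : brownian_motion P F beta).
Context (k : 'I_K).

Definition energy (s : nat -> R) (c : nat -> T -> R) (m : nat) (w : T) : R :=
  \sum_(l < m) c l w ^+ 2 * (s l.+1 - s l).

Context (N m : nat) (s : nat -> R).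
Hypothesis s0 : forall l, (l <= N * m)%N -> 0 <= s l.
Hypothesis s_lt : forall l, (l < N * m)%N -> s l < s l.+1.
Context (c : nat -> T -> R).
Hypothesis mc : forall l, (l < N * m)%N -> measurable_wrt (F (s l)) (c l).
Context (delta : R) (delta0 : 0 < delta).

(** The test includes the [l]-th term itself: this is still known at time [s l], and it keeps the
    energy of [tc] below [delta] without overshoot. *)
Let tc l w := if energy s c l.+1 w <= delta then c l w else 0.

Let ds l : (l < N * m)%N -> 0 < s l.+1 - s l.
Proof. by move=> ln; rewrite subr_gt0 s_lt. Qed.

Let mtc l : (l < N * m)%N -> measurable_wrt (F (s l)) (tc l).
Proof.
move=> ln; have sg := filtration_sigma hF (s0 (ltnW ln)).
have sle j : (j <= l)%N -> s j <= s l.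
  move=> /subnK; move: (l - j)%N => i; elim: i j => [j <-//|i IH j jl].
  have jn : (j < N * m)%N by rewrite (leq_ltn_trans _ ln)// -jl leq_addl.
  by apply: le_trans (ltW (s_lt jn)) (IH j.+1 _); rewrite -jl addnS.
apply/(measurable_wrtP _ sg); apply: measurable_fun_ifT => //; last first.
  exact/(measurable_wrtP _ sg)/mc.
apply: measurable_fun_ler => //; apply: measurable_sum => j.
have jl : (j <= l)%N by rewrite -ltnS.
have jn := leq_ltn_trans jl ln.
apply: measurable_funM => //; apply: measurable_funX.
apply/(measurable_wrtP _ sg); apply: (measurable_wrt_le hF _ (sle _ jl) (mc jn)).
exact: s0 (ltnW jn).
Qed.

Let energy_tc j w : (j <= N * m)%N ->
  energy s tc j w <= energy s c j w /\ energy s tc j w <= delta.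
Proof.
elim: j => [_|j IH jn]; first by rewrite /energy !big_ord0 (ltW delta0).
have [h1 h2] := IH (ltnW jn).
have E : energy s c j.+1 w = energy s c j w + c j w ^+ 2 * (s j.+1 - s j).
  by rewrite /energy big_ord_recr.
have q0 : 0 <= c j w ^+ 2 * (s j.+1 - s j) by rewrite mulr_ge0 ?sqr_ge0 ?ltW ?ds.
have -> : energy s tc j.+1 w = energy s tc j w + tc j w ^+ 2 * (s j.+1 - s j).
  by rewrite /energy big_ord_recr.
have [H|H] := leP (energy s c j.+1 w) delta.
  have -> : tc j w = c j w by rewrite /tc H.
  by split; lra.
have -> : tc j w = 0 by rewrite /tc leNgt H.
by rewrite expr0n mul0r addr0; split => //; lra.
Qed.

(** A single term of the energy is at most [delta], which bounds [tc l w ^+ 2], and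
    [|x| <= 1 + x ^+ 2]. *)
Let tcb l : (l < N * m)%N -> exists C : R, forall w, `|tc l w| <= C.
Proof.
move=> ln; exists (1 + delta / (s l.+1 - s l)) => w.
have d0 := ds ln.
have H : tc l w ^+ 2 * (s l.+1 - s l) <= delta.
  have [_] := energy_tc w ln; apply: le_trans.
  rewrite /energy big_ord_recr /= lerDr; apply: sumr_ge0 => j _.
  by rewrite mulr_ge0 ?sqr_ge0 ?ltW ?ds ?(ltn_trans _ ln).
rewrite -ler_pdivlMr// in H.
apply: le_trans (lerD (lexx 1) H).
by rewrite ler_norml; nra.
Qed.

(* The integrand is cut off as soon as its energy exceeds [delta]; the square
   integrals of the cut-off integrand are bounded, and nothing has changed
   outside the exceptional event. *)
Lemma whp_ito_blocks (p eps : R) : 0 < eps ->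
  whp P p (fun w => energy s c (N * m) w <= delta) ->
  whp P (p + 8 * delta / eps)
    (fun w => \sum_(i < N) ito_sum beta k s c (i * m) m w ^+ 2 < eps).
Proof.
move=> eps0 Hp.
have bl i : (i < N)%N -> (i * m + m <= N * m)%N.
  by move=> iN; rewrite -mulSnr leq_mul2r iN orbT.
pose f w := \sum_(i < N) ito_sum beta k s tc (i * m) m w ^+ 2.
have f0 w : 0 <= f w by apply: sumr_ge0 => i _; exact: sqr_ge0.
have mI i : (i < N)%N -> measurable_fun setT (ito_sum beta k s tc (i * m) m).
  by move=> iN; apply: (measurable_ito_sum hF hbeta k s0 s_lt mtc); exact: bl.
have mf : measurable_fun setT f.
  by apply: measurable_sum => i; apply: measurable_funX; exact: mI.
have H : whp P (8 * delta / eps) (fun w => f w < eps).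
  apply: whp_markov => //.
  under eq_integral do rewrite /f -sumEFin.
  rewrite ge0_integral_sum//; last 2 first.
  - by move=> i; apply/measurable_EFinP; apply: measurable_funX; exact: mI.
  - by move=> i w _; rewrite lee_fin sqr_ge0.
  pose q i w := \sum_(b < m) tc (i * m + b)%N w ^+ 2 *
    (s (i * m + b).+1 - s (i * m + b)%N).
  have lb i (b : 'I_m) : (i < N)%N -> (i * m + b < N * m)%N.
    by move=> iN; apply: leq_trans (bl i iN); rewrite ltn_add2l.
  have mq i : (i < N)%N -> measurable_fun setT (q i).
    move=> iN; apply: measurable_sum => b; apply: measurable_funM => //.
    apply: measurable_funX.
    exact: (measurable_wrt_fun hF (s0 (ltnW (lb i b iN))) (mtc (lb i b iN))).
  have q0 i w : (i < N)%N -> 0 <= q i w.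
    move=> iN; apply: sumr_ge0 => b _.
    by rewrite mulr_ge0 ?sqr_ge0 ?ltW ?ds ?lb.
  apply: (@le_trans _ _ (\sum_(i < N) 8%:E * \int[P]_w (q i w)%:E)%E).
    by apply: lee_sum => i _; apply: (ito_sum_L2 hF hbeta k s0 s_lt mtc tcb); exact: bl.
  rewrite -ge0_sume_distrr; last first.
    by move=> i _; apply: integral_ge0 => w _; rewrite lee_fin q0.
  rewrite EFinM; apply: lee_wpmul2l => //.
  rewrite -ge0_integral_sum//; last 2 first.
  - by move=> i; apply/measurable_EFinP; exact: mq.
  - by move=> i w _; rewrite lee_fin q0.
  apply: (@le_trans _ _ (\int[P]_w (cst delta%:E w))%E).
    apply: ge0_le_integral => //.
    - by move=> w _; rewrite sumEFin lee_fin sumr_ge0// => i _; exact: q0.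
    - under eq_fun do rewrite sumEFin.
      by apply/measurable_EFinP; apply: measurable_sum => i; exact: mq.
    - move=> w _; rewrite sumEFin lee_fin.
      have [_] := energy_tc w (leqnn (N * m)%N).
      by rewrite /energy (big_ord_block _ _ (fun l => tc l w ^+ 2 * (s l.+1 - s l))).
  by rewrite integral_cst//= probability_setT mule1.
apply: whpS (whpI Hp H) => // w [h1 h2].
(* Partial energies increase with the index, so a total energy of at most [delta] means that nothing
   was cut off. *)
have -> // : \sum_(i < N) ito_sum beta k s c (i * m) m w ^+ 2 = f w.
apply: eq_bigr => i _; congr (_ ^+ 2); apply: eq_bigr => b _; congr (_ * _).
rewrite /tc ifT//; apply: le_trans h1.
have ln : (i * m + b < N * m)%N.
  by apply: leq_trans (bl i (ltn_ord i)); rewrite ltn_add2l.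
have emono a b' : (a <= b')%N -> (b' <= N * m)%N -> energy s c a w <= energy s c b' w.
  move=> /subnK <-; elim: (b' - a)%N => [//|j IH] jn.
  apply: le_trans (IH (ltnW jn)) _; rewrite /energy [leRHS]big_ord_recr /= lerDl.
  by rewrite mulr_ge0 ?sqr_ge0 ?ltW ?ds.
exact: emono.
Qed.

End ito_blocks.

(** * Modulus of continuity of the paths *)

Section paths.
Context (R : realType).

Lemma within_continuous_cvg (f : R -> R) : {within `[0, +oo[, continuous f} ->
  forall s, 0 <= s -> forall e, 0 < e -> exists2 del, 0 < del &
    forall s', 0 <= s' -> `|s' - s| < del -> `|f s' - f s| < e.
Proof.
move=> /subspace_continuousP cf s s0 e e0.
have sI : (`[0, +oo[%classic : set R) s by rewrite /= in_itv /= s0.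
have := cf s sI (ball (f s) e) (nbhsx_ballx _ _ e0).
rewrite /fmap /within /= => /nbhs_ballP[del /= del0 H].
exists del => // s' s'0 ss'.
have H' := H s'; rewrite /ball /= in H'.
rewrite distrC; apply: H'; first by rewrite distrC.
by rewrite in_itv /= s'0.
Qed.

(** Compactness: a threshold that works near each point can be chosen uniformly. Uniform continuity
    and boundedness of a path are both instances. *)
Lemma near_covering_segment (t : R) (Q : nat -> R -> Prop) :
  (forall x, 0 <= x <= t -> exists2 del, 0 < del & exists n0,
     forall x', 0 <= x' <= t -> `|x' - x| < del ->
     forall n, (n0 <= n)%N -> Q n x') ->
  exists n, forall x, 0 <= x <= t -> Q n x.
Proof.
move=> HQ; have /compact_near_coveringP/near_covering_withinP := @segment_compact R 0 t.
move=> /(_ nat \oo Q _)[|n0 _ /(_ n0 (leqnn n0)) H].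
  move=> x /=; rewrite in_itv /= => /HQ [del del0 [n0 H]].
  exists (ball x del, [set n | (n0 <= n)%N]) => /=.
    split; first exact: nbhsx_ballx.
    by exists n0.
  move=> [x' n] /= [bx nn0]; rewrite in_itv /= => x'0.
  by apply: H => //; rewrite distrC.
by exists n0 => x x0; apply: H; rewrite /= in_itv.
Qed.

Lemma path_uniform_continuity (f : R -> R) (t e : R) :
  {within `[0, +oo[, continuous f} -> 0 < e ->
  exists n, forall s s', 0 <= s <= t -> 0 <= s' <= t ->
    `|s' - s| < n.+1%:R^-1 -> `|f s' - f s| <= e.
Proof.
move=> cf e0.
have e2 : 0 < e / 2 by rewrite divr_gt0.
have [] := @near_covering_segment t (fun n s => forall s', 0 <= s' <= t ->
    `|s' - s| < n.+1%:R^-1 -> `|f s' - f s| <= e); last first.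
  by move=> n Hn; exists n => s s' s0 s'0; exact: Hn.
move=> s /andP[s0 st]; have [del del0 H] := within_continuous_cvg cf s0 e2.
exists (del / 2); first by rewrite divr_gt0.
exists (Num.truncn (2 / del)) => x /andP[x0 xt] xs n nn y /andP[y0 yt] yx.
have n1 : n.+1%:R^-1 < del / 2.
  rewrite -[ltRHS]invrK ltf_pV2 ?posrE ?invr_gt0 ?divr_gt0// invf_div.
  by apply: lt_le_trans (truncnS_gt _) _; rewrite ler_nat.
have {}yx := lt_trans yx n1.
have h1 : `|f x - f s| < e / 2 by apply: H => //; lra.
have h2 : `|f y - f s| < e / 2.
  apply: H => //; have := ler_normD (y - x) (x - s).
  by rewrite (_ : y - x + (x - s) = y - s); [lra | ring].
have := ler_normB (f y - f s) (f x - f s).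
by rewrite (_ : f y - f s - (f x - f s) = f y - f x); [lra | ring].
Qed.

Lemma path_bounded (f : R -> R) (t : R) :
  {within `[0, +oo[, continuous f} ->
  exists n, forall s, 0 <= s <= t -> `|f s| <= n%:R.
Proof.
move=> cf; apply: near_covering_segment => s /andP[s0 st].
have [del del0 H] := within_continuous_cvg cf s0 ltr01.
exists del => //; exists (Num.truncn (`|f s| + 1)).+1 => x /andP[x0 xt] xs n nn.
have := H x x0 xs => h.
have := ler_normD (f x - f s) (f s); rewrite subrK => h'.
have : (Num.truncn (`|f s| + 1)).+1%:R <= n%:R :> R by rewrite ler_nat.
by have := truncnS_gt (`|f s| + 1); lra.
Qed.

(** Clamping lets suprema over [[0, t]] be taken over all rationals; being 1-Lipschitz and the
    identity on [[0, t]], it loses no information. *)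
Let clamp (t s : R) := Num.max 0 (Num.min s t).

Let clampP t s : 0 <= t -> 0 <= clamp t s <= t.
Proof.
by move=> t0; rewrite /clamp le_max lexx/= ge_max t0 ge_min lexx orbT.
Qed.

Let clamp_id t s : 0 <= s <= t -> clamp t s = s.
Proof.
by move=> /andP[s0 st]; rewrite /clamp min_l// max_r.
Qed.

Let clamp_lip t s s' : `|clamp t s' - clamp t s| <= `|s' - s|.
Proof.
wlog ss' : s s' / s <= s'.
  move=> W; have [/W//|/ltW/W] := leP s s'.
  by rewrite (distrC s) (distrC (clamp t s)).
rewrite (ger0_norm (_ : 0 <= s' - s)) ?subr_ge0//.
rewrite /clamp; set a := Num.min s t; set a' := Num.min s' t.
have [h1 h2] : a <= a' /\ a' - a <= s' - s.
  by rewrite /a /a'; case: (leP s t) => ?; case: (leP s' t) => ?; split; lra.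
by rewrite ler_norml; case: (leP 0 a) => ?; case: (leP 0 a') => ?;
  apply/andP; split; lra.
Qed.

Context (d : measure_display) (T : measurableType d) (P : probability T R).
Context (X : R -> T -> R) (mX : forall t, 0 <= t -> measurable_fun setT (X t)).
Hypothesis cX : as_continuous P X.

(** Violations by rational pairs form a measurable event, decreasing in [n] and eventually left by
    every continuous path. On a continuous path a violation by a real pair forces one by a nearby
    rational pair. *)
Lemma whp_modulus (t e p : R) : 0 <= t -> 0 < e -> 0 < p ->
  exists n, whp P p (fun w => forall s s', 0 <= s <= t -> 0 <= s' <= t ->
    `|s' - s| < n.+1%:R^-1 -> `|X s' w - X s w| <= e).
Proof.
move=> t0 e0 p0; have p2 : 0 < p / 2 by rewrite divr_gt0.
pose Y (q : rat) w := X (clamp t (ratr q)) w.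
have mY q : measurable_fun setT (Y q).
  by apply: mX; have /andP[] := clampP (ratr q) t0.
pose A n := \bigcup_(q : rat) \bigcup_(q' : rat)
  [set w | (`|ratr q' - ratr q| < n.+1%:R^-1 :> R) && (e < `|Y q' w - Y q w|)].
have mA n : measurable (A n).
  apply: bigcupT_measurable_rat => q; apply: bigcupT_measurable_rat => q'.
  case: (`|_| < _) => /=; last by rewrite (_ : [set _ | _] = set0)// predeqE.
  rewrite -[X in measurable X]setTI.
  have mYY : measurable_fun setT (fun w => `|Y q' w - Y q w|).
    by apply: measurableT_comp => //; exact: measurable_funB.
  have := measurable_fun_ltr (measurable_cst e) mYY.
  by move=> /(_ measurableT [set true] I).
have [n Hn] : exists n, (P (A n) <= (p / 2)%:E)%E.
  apply: probability_decreasing_small => //.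
  - move=> n w [q _ [q' _ /= /andP[h1 h2]]]; exists q => //; exists q' => //=.
    by rewrite h2 andbT (lt_trans h1)// ltf_pV2 ?posrE// ltr_nat.
  - apply: filterS cX => w cw.
    have [n Hn] := path_uniform_continuity t cw e0; exists n.
    move=> [q _ [q' _ /= /andP[h1]]]; rewrite ltNge => /negP; apply.
    apply: Hn; try exact: clampP.
    exact: le_lt_trans (clamp_lip _ _ _) h1.
exists n; have HA : whp P (p / 2) (fun w => ~ A n w) by exists (A n).
apply: whpS (whpI HA (whp_ae (ltW p2) cX)); first by rewrite -splitr.
move=> w [nA cw] s s' st s't ss'; rewrite leNgt; apply/negP => lte.
apply: nA.
(* Half of the excess over [e]; [g] below is half of the slack in the distance. Rational points this
   close to [s] and [s'] still violate the bound. *)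
pose eta := (`|X s' w - X s w| - e) / 2.
have eta0 : 0 < eta by rewrite divr_gt0// subr_gt0.
have [/andP[s0 st'] /andP[s'0 s't']] := (st, s't).
have [d1 d10 H1] := within_continuous_cvg cw s0 eta0.
have [d2 d20 H2] := within_continuous_cvg cw s'0 eta0.
pose g := (n.+1%:R^-1 - `|s' - s|) / 2.
have g0 : 0 < g by rewrite divr_gt0// subr_gt0.
have near (x r : R) : 0 < r -> exists q, `|ratr q - x| < r.
  move=> r0; have /rat_in_itvoo[q] : x - r < x + r by lra.
  rewrite in_itv /= => /andP[h1 h2]; exists q.
  by rewrite ltr_norml; apply/andP; split; lra.
have [|q] := near s (Num.min d1 g); first by rewrite lt_min d10.
rewrite lt_min => /andP[q1 qg].
have [|q'] := near s' (Num.min d2 g); first by rewrite lt_min d20.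
rewrite lt_min => /andP[q'1 q'g].
exists q => //; exists q' => //=; apply/andP; split.
  have := ler_normD (ratr q' - s') (s' - ratr q).
  have := ler_normD (s' - s) (s - ratr q).
  have -> : ratr q' - s' + (s' - ratr q) = ratr q' - ratr q by ring.
  have -> : s' - s + (s - ratr q) = s' - ratr q by ring.
  have gE : g * 2 = n.+1%:R^-1 - `|s' - s| by rewrite /g divfK.
  rewrite (distrC s (ratr q)); move: gE ss' qg q'g.
  by move: (n.+1%:R^-1) (g) => r g'; lra.
have y1 : `|Y q w - X s w| < eta.
  apply: H1; first by have /andP[] := clampP (ratr q) t0.
  by rewrite -{1}(clamp_id st); exact: le_lt_trans (clamp_lip _ _ _) q1.
have y2 : `|Y q' w - X s' w| < eta.
  apply: H2; first by have /andP[] := clampP (ratr q') t0.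
  by rewrite -{1}(clamp_id s't); exact: le_lt_trans (clamp_lip _ _ _) q'1.
have := ler_normD (X s' w - Y q' w) (Y q' w - Y q w).
have := ler_normD (X s' w - Y q w) (Y q w - X s w).
rewrite !addrA !subrK (distrC (X s' w) (Y q' w)).
have : eta * 2 = `|X s' w - X s w| - e by rewrite /eta divfK.
by move: y1 y2; move: (eta) => e1; lra.
Qed.

Lemma whp_bounded (t p : R) : 0 <= t -> 0 < p ->
  exists n, whp P p (fun w => forall s, 0 <= s <= t -> `|X s w| <= n%:R).
Proof.
move=> t0 p0; have p2 : 0 < p / 2 by rewrite divr_gt0.
pose Y (q : rat) w := X (clamp t (ratr q)) w.
have mY q : measurable_fun setT (Y q).
  by apply: mX; have /andP[] := clampP (ratr q) t0.
pose A n := \bigcup_(q : rat) [set w | n%:R < `|Y q w|].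
have mA n : measurable (A n).
  apply: bigcupT_measurable_rat => q; rewrite -[X in measurable X]setTI.
  have mYY : measurable_fun setT (fun w => `|Y q w|) by exact: measurableT_comp.
  have := measurable_fun_ltr (measurable_cst (n%:R : R)) mYY.
  by move=> /(_ measurableT [set true] I).
have [n Hn] : exists n, (P (A n) <= (p / 2)%:E)%E.
  apply: probability_decreasing_small => //.
  - move=> n w [q _ /= h]; exists q => //=; apply: le_lt_trans h.
    by rewrite ler_nat.
  - apply: filterS cX => w cw.
    have [n Hn] := path_bounded t cw; exists n.
    move=> [q _ /=]; rewrite ltNge => /negP; apply; apply: Hn; exact: clampP.
exists n; have HA : whp P (p / 2) (fun w => ~ A n w) by exists (A n).
apply: whpS (whpI HA (whp_ae (ltW p2) cX)); first by rewrite -splitr.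
move=> w [nA cw] s st; rewrite leNgt; apply/negP => lte; apply: nA.
have e0 : 0 < `|X s w| - n%:R by rewrite subr_gt0.
have /andP[s0 st'] := st.
have [d1 d10 H1] := within_continuous_cvg cw s0 e0.
have /rat_in_itvoo[q] : s - d1 < s + d1 by lra.
rewrite in_itv /= => /andP[h1 h2]; exists q => //=.
have y1 : `|Y q w - X s w| < `|X s w| - n%:R.
  apply: H1; first by have /andP[] := clampP (ratr q) t0.
  rewrite -{1}(clamp_id st); apply: le_lt_trans (clamp_lip _ _ _) _.
  by rewrite ltr_norml; apply/andP; split; lra.
have := ler_normD (X s w - Y q w) (Y q w); rewrite subrK (distrC (X s w)); lra.
Qed.

End paths.

(** * Quadratic variation *)

Section uniform_grid.
Context (R : realType).

Definition grid (t : R) (n l : nat) : R := t * l%:R / n%:R.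

Definition grid_seq (t : R) (n : nat) : seq R := [seq grid t n l.+1 | l <- iota 0 n].

Lemma grid0 t n : grid t n 0 = 0.
Proof. by rewrite /grid mulr0 mul0r. Qed.

Lemma gridn t n : (0 < n)%N -> grid t n n = t.
Proof. by move=> n0; rewrite /grid mulfK// pnatr_eq0 -lt0n. Qed.

Lemma grid_ge0 t n l : 0 <= t -> 0 <= grid t n l.
Proof. by move=> t0; rewrite divr_ge0// mulr_ge0. Qed.

Lemma gridSB t n l : (0 < n)%N -> grid t n l.+1 - grid t n l = t / n%:R.
Proof.
move=> n0; rewrite /grid -mulrBl -mulrBr -natr1 addrAC subrr add0r mulr1.
by [].
Qed.

Lemma grid_lt t n l : 0 < t -> (0 < n)%N -> grid t n l < grid t n l.+1.
Proof. by move=> t0 n0; rewrite -subr_gt0 gridSB// divr_gt0// ltr0n. Qed.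

Lemma grid_le t n l l' : 0 <= t -> (l <= l')%N -> grid t n l <= grid t n l'.
Proof.
move=> t0 ll'; rewrite /grid ler_wpM2r ?invr_ge0//.
by rewrite ler_wpM2l// ler_nat.
Qed.

Lemma grid_itv t n l : 0 <= t -> (l <= n)%N -> 0 <= grid t n l <= t.
Proof.
move=> t0 ln; rewrite grid_ge0//=.
have [n0|n0] := posnP n; first by rewrite /grid n0 invr0 mulr0.
by rewrite -[leRHS](gridn t n0) grid_le.
Qed.

Lemma grid_refine t n m l : (0 < m)%N -> grid t (n * m) (l * m) = grid t n l.
Proof.
move=> m0; have m0' : m%:R != 0 :> R by rewrite pnatr_eq0 -lt0n.
have [->|n0] := posnP n; first by rewrite /grid mul0n invr0 !mulr0.
have n0' : n%:R != 0 :> R by rewrite pnatr_eq0 -lt0n.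
by rewrite /grid !natrM; field; apply/andP.
Qed.

(** Convergence along uniform grids of [[0, grid t n i]] can thus be read on the fine grid of
    [[0, t]], whose beginning is such a grid. *)
Lemma grid_prefix t n m i l : (0 < n)%N -> (0 < m)%N -> (0 < i)%N ->
  grid (grid t n i) (i * m) l = grid t (n * m) l.
Proof.
move=> n0 m0 i0.
have m0' : m%:R != 0 :> R by rewrite pnatr_eq0 -lt0n.
have n0' : n%:R != 0 :> R by rewrite pnatr_eq0 -lt0n.
have i0' : i%:R != 0 :> R by rewrite pnatr_eq0 -lt0n.
by rewrite /grid !natrM; field; apply/and3P.
Qed.

Lemma size_grid_seq t n : size (grid_seq t n) = n.
Proof. by rewrite size_map size_iota. Qed.

Lemma nth_grid_seq t n i : (i <= n)%N -> nth t (0 :: grid_seq t n) i = grid t n i.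
Proof.
case: i => [_|i ilt] /=; first by rewrite grid0.
by rewrite (nth_map 0%N) ?size_iota// nth_iota.
Qed.

Lemma grid_seq_partition t n : 0 < t -> (0 < n)%N -> itv_partition 0 t (grid_seq t n).
Proof.
move=> t0 n0; split.
  apply/(pathP t) => i; rewrite size_grid_seq => iln.
  by rewrite -[nth t (grid_seq t n) i]/(nth t (0 :: grid_seq t n) i.+1)
    !nth_grid_seq// ?grid_lt// ltnW.
have -> : last 0 (grid_seq t n) = nth t (0 :: grid_seq t n) n.
  by have := nth_last t (0 :: grid_seq t n); rewrite [size _]/= size_grid_seq => ->.
by rewrite nth_grid_seq// gridn.
Qed.

End uniform_grid.

Section quadratic_variation.
Context (R : realType) (d : measure_display) (T : measurableType d).
Context (P : probability T R) (F : R -> set (set T)) (hF : filtration F).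

Definition qv (X : R -> T -> R) (t : R) (n : nat) (w : T) : R :=
  \sum_(l < n) (X (grid t n l.+1) w - X (grid t n l) w) ^+ 2.

(** The bound [C] is uniform in the number of intervals, whereas the exceptional event may depend on
    it. *)
Definition qv_tight (X : R -> T -> R) (t : R) : Prop :=
  forall p, 0 < p -> exists C, forall n, (0 < n)%N -> whp P p (fun w => qv X t n w <= C).

Lemma measurable_qv (X : R -> T -> R) t n : 0 <= t ->
  (forall s, 0 <= s -> measurable_fun setT (X s)) -> measurable_fun setT (qv X t n).
Proof.
move=> t0 mX; apply: measurable_sum => l; apply: measurable_funX.
by apply: measurable_funB; apply: mX; rewrite grid_ge0.
Qed.

(** The sum of squared increments is at most the square of the total variation, uniformly over the
    grids. *)
Lemma qv_tight_bounded_variation (V : R -> T -> R) t : 0 < t ->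
  (forall s, 0 <= s -> measurable_fun setT (V s)) ->
  {ae P, forall w, forall s, 0 <= s -> bounded_variation 0 s (V ^~ w)} ->
  qv_tight V t.
Proof.
move=> t0 mV bV p p0.
pose A C := \bigcup_n [set w | C%:R < qv V t n.+1 w].
have mA C : measurable (A C).
  apply: bigcupT_measurable => n; rewrite -[X in measurable X]setTI.
  have := measurable_fun_ltr (measurable_cst (C%:R : R)) (measurable_qv n.+1 (ltW t0) mV).
  by move=> /(_ measurableT [set true] I).
have [C HC] : exists C, (P (A C) <= p%:E)%E.
  apply: probability_decreasing_small => //.
    move=> C w [n _ /= h]; exists n => //=; apply: le_lt_trans h.
    by rewrite ler_nat.
  apply: filterS bV => w /(_ t (ltW t0)) [B HB].
  exists (Num.truncn (B ^+ 2)).+1 => -[n _ /=]; apply/negP; rewrite -leNgt.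
  apply: le_trans (ltW (truncnS_gt _)).
  have vB : \sum_(l < n.+1) `|V (grid t n.+1 l.+1) w - V (grid t n.+1 l) w| <= B.
    apply: HB; exists (grid_seq t n.+1); first exact: grid_seq_partition.
    rewrite /variation size_grid_seq big_mkord; apply: eq_bigr => l _.
    by rewrite [LHS]/= -[nth t _ l]/(nth t (0 :: grid_seq t n.+1) l.+1)
      !nth_grid_seq// ltnW.
  apply: (@le_trans _ _ ((\sum_(l < n.+1) `|V (grid t n.+1 l.+1) w - V (grid t n.+1 l) w|) ^+ 2)).
    rewrite /qv expr2 mulr_suml; apply: ler_sum => l _.
    rewrite -real_normK ?num_real// expr2 ler_wpM2l//.
    by rewrite (bigD1 l)//= lerDl sumr_ge0.
  by rewrite lerXn2r ?nnegrE ?sumr_ge0// (le_trans _ vB)// sumr_ge0.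
exists C%:R => n n0; exists (A C); first by split.
move=> w nA; rewrite leNgt; apply/negP => h; apply: nA; exists n.-1 => //=.
by rewrite prednK.
Qed.

Section martingale_increment.
Context (L : R -> T -> R) (ML : martingale P F L) (s t : R) (s0 : 0 <= s) (st : s <= t).
Let D w := L t w - L s w.
Let t0 : 0 <= t := le_trans s0 st.

Let iD : P.-integrable setT (EFin \o D).
Proof. by have [_ iL _] := ML; exact: (integrableB measurableT (iL t t0) (iL s s0)). Qed.

Let mD : measurable_fun setT D.
Proof. exact/measurable_EFinP/(measurable_int P iD). Qed.

Lemma martingale_increment_indic A : F s A ->
  (\int[P]_w (\1_A w * D w)%:E = 0)%E.
Proof.
move=> FA; have [_ iL mart] := ML.
have mA : measurable A by have [/(_ s s0)[_ +] _] := hF; apply.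
have iL' u : 0 <= u -> P.-integrable A (fun w => (L u w)%:E).
  by move=> u0; apply: integrableS (iL u u0).
transitivity (\int[P]_(w in A) (D w)%:E)%E.
  rewrite [RHS]integral_mkcond; apply: eq_integral => w _.
  by rewrite patchE indicE; case: (w \in A); rewrite ?mul1r ?mul0r.
rewrite (eq_integral (fun w => (L t w)%:E - (L s w)%:E)%E)//.
rewrite integralB//; try exact: iL'.
by rewrite (mart s t s0 st A FA) subee// integrable_fin_num//; exact: iL'.
Qed.

Let step01 (n : nat) (x : R) : 0 <= x <= n%:R ->
  `|x - \sum_(k < n) (k.+1%:R <= x)%R%:R| <= 1.
Proof.
elim: n x => [|n IH] x /andP[x0 xn].
  by rewrite big_ord0 subr0 ger0_norm//; lra.
rewrite big_ord_recr /=; have [xn'|xn'] := leP x n%:R.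
  rewrite (_ : (_ <= x)%R = false) ?addr0; first by apply: IH; rewrite x0.
  by apply/negbTE; rewrite -ltNge (le_lt_trans xn')// ltr_nat.
rewrite (eq_bigr (fun=> 1)) => [|k _]; last first.
  by rewrite (le_trans _ (ltW xn'))// ler_nat.
rewrite sumr_const card_ord; rewrite -natr1 in xn *.
by case: (leP (n%:R + 1) x) => ? ; rewrite ler_norml; apply/andP; split => /=; lra.
Qed.

Let integral_step01 (c : T -> R) (n : nat) : measurable_wrt (F s) c ->
  let f w := \sum_(k < n) (k.+1%:R <= c w)%R%:R * D w in
  P.-integrable setT (EFin \o f) /\ (\int[P]_w (f w)%:E = 0)%E.
Proof.
move=> mc f; rewrite {}/f; elim: n => [|n [IH1 IH2]].
  split.
    apply: eq_integrable (integrable0 _ _) => // w _ /=; by rewrite big_ord0.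
  by rewrite integral0_eq// => w _; rewrite big_ord0.
have E w : \sum_(k < n.+1) (k.+1%:R <= c w)%R%:R * D w =
    \sum_(k < n) (k.+1%:R <= c w)%R%:R * D w + \1_[set w | n.+1%:R <= c w] w * D w.
  rewrite big_ord_recr /= indicE; congr (_ + _ * _).
  by rewrite mem_setE.
have FA : F s [set w | n.+1%:R <= c w].
  have := mc `[n.+1%:R, +oo[%classic (measurable_itv _).
  by congr (F s _); apply/seteqP; split => w /=; rewrite in_itv /= andbT.
have mA : measurable [set w | n.+1%:R <= c w].
  by have [/(_ s s0)[_ +] _] := hF; apply.
have i1 : P.-integrable setT (fun w => (\1_[set w | n.+1%:R <= c w] w * D w)%:E).
  apply: (le_integrable _ _ _ iD) => //.
    by apply/measurable_EFinP; apply: measurable_funM.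
  move=> w _ /=; rewrite lee_fin normrM ler_piMl// indicE.
  by case: (_ \in _); rewrite /= ?normr1 ?normr0.
split.
  have := integrableD measurableT IH1 i1.
  by apply: eq_integrable => // w _; rewrite /= E.
under eq_integral do rewrite E EFinD.
by rewrite integralD// IH2 add0e martingale_increment_indic.
Qed.

Lemma expectation_mul_martingale_increment (c : T -> R) (C : R) :
  0 < C ->
  measurable_wrt (F s) c -> (forall w, `|c w| <= C) ->
  P.-integrable setT (fun w => (c w * D w)%:E) /\
  (\int[P]_w (c w * D w)%:E = 0)%E.
Proof.
move=> C0 mc cC.
have mcT := measurable_wrt_fun hF s0 mc.
have icD : P.-integrable setT (fun w => (c w * D w)%:E).
  apply: (@le_integrable _ _ _ P _ measurableT _ (fun w => C%:E * (D w)%:E)%E).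
  - by apply/measurable_EFinP; exact: measurable_funM.
  - move=> w _; rewrite -EFinM !abse_EFin lee_fin !normrM ler_wpM2r//.
    by rewrite (gtr0_norm C0).
  - exact: integrableZl.
split => //.
have ID0 : (\int[P]_w (D w)%:E = 0)%E.
  have sg := filtration_sigma hF s0.
  have FT : F s setT by have [sF0 sFC _] := sg; rewrite -(setD0 [set: T]); exact: sFC.
  rewrite -(martingale_increment_indic FT); apply: eq_integral => w _.
  by rewrite indicE in_setT mul1r.
(* The number of thresholds below [x = n (c + C) / (2 C)] is within 1 of [x],
   and each threshold event contributes a zero integral. *)
have key n : (0 < n)%N ->
    (`|\int[P]_w (c w * D w)%:E| <= (2 * C / n%:R)%:E * \int[P]_w `|(D w)%:E|)%E.
  move=> n0; have n0' : (0 < n%:R :> R) by rewrite ltr0n.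
  pose x w := n%:R * (c w + C) / (2 * C).
  have mx : measurable_wrt (F s) x.
    have sg := filtration_sigma hF s0.
    apply/(measurable_wrtP _ sg); do 2 apply: measurable_funM => //.
    by apply: measurable_funD => //; exact/(measurable_wrtP _ sg).
  have [if0 If0] := integral_step01 n mx.
  set f := fun w => _ in if0 If0.
  (* The subtracted term is [D] times the staircase approximation of [c] with steps [2 * C / n]. Its
     mean is zero, so [g] has the same integral as [c * D]. *)
  pose g w := c w * D w - (2 * C / n%:R * f w - C * D w).
  have ih : P.-integrable setT (fun w => (2 * C / n%:R * f w - C * D w)%:E).
    have := integrableB measurableT (integrableZl measurableT (2 * C / n%:R) if0)
      (integrableZl measurableT C iD).
    by apply: eq_integrable => // w _; rewrite /= EFinB !EFinM.
  have Ih : (\int[P]_w (2 * C / n%:R * f w - C * D w)%:E = 0)%E.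
    under eq_integral do rewrite EFinB !(EFinM _ (f _)) (EFinM C).
    rewrite integralB//; last 2 first.
    - exact: integrableZl.
    - exact: integrableZl.
    by rewrite !integralZl// If0 ID0 !mule0 subee.
  have ig : P.-integrable setT (EFin \o g).
    have := integrableB measurableT icD ih.
    by apply: eq_integrable => // w _; rewrite /= EFinB.
  have -> : (\int[P]_w (c w * D w)%:E = \int[P]_w (g w)%:E)%E.
    under [RHS]eq_integral do rewrite /g EFinB.
    by rewrite integralB// Ih sube0.
  apply: le_trans (le_abse_integral _ _ _) _ => //.
    exact: measurable_int ig.
  rewrite -ge0_integralZl//; last 2 first.
  - by apply: measurableT_comp => //; exact/measurable_EFinP.
  - by rewrite lee_fin divr_ge0// mulr_ge0// ltW.
  apply: ge0_le_integral => //.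
  - by apply: measurableT_comp => //; exact: measurable_int ig.
  - apply: emeasurable_funM => //; apply: measurableT_comp => //.
    exact/measurable_EFinP.
  move=> w _; rewrite !abse_EFin -EFinM lee_fin.
  have -> : g w = 2 * C / n%:R * ((x w - \sum_(k < n) (k.+1%:R <= x w)%R%:R) * D w).
    rewrite /g /f /x -mulr_suml; field.
    by rewrite gt_eqF// gt_eqF.
  rewrite normrM ger0_norm ?divr_ge0// ?mulr_ge0// ?(ltW C0)//.
  rewrite ler_wpM2l// ?divr_ge0// ?mulr_ge0// ?(ltW C0)//.
  rewrite normrM ler_piMl//; apply: step01.
  have := cC w; rewrite ler_norml => /andP[c1 c2].
  rewrite /x; apply/andP; split.
    by apply: divr_ge0; [apply: mulr_ge0 => // |]; lra.
  by rewrite ler_pdivrMr ?mulr_gt0// ler_wpM2l//; lra.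
have Ifin : (\int[P]_w (c w * D w)%:E)%E \is a fin_num by exact: integrable_fin_num.
have [_ iD'] := integrableP _ _ _ iD.
have Dfin : (\int[P]_w `|(D w)%:E|)%E \is a fin_num.
  by rewrite ge0_fin_numE ?integral_ge0.
move: key; rewrite -(fineK Ifin) -(fineK Dfin).
set a := fine _; set b := fine _ => key.
apply/eqP; rewrite eqe -normr_le0 leNgt; apply/negP => a0.
have := key (Num.truncn (2 * C * b / `|a|)).+1 isT.
rewrite -EFinM abse_EFin lee_fin mulrAC ler_pdivlMr ?ltr0n// -ler_pdivlMl//.
by rewrite mulrC leNgt truncnS_gt.
Qed.

End martingale_increment.
End quadratic_variation.

(** * The Huber function as a substitute for the square *)

Section huber.
Context (R : realType) (lam : R) (lam0 : 0 < lam).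

Definition clip (x : R) : R := Num.max (- lam) (Num.min x lam).

(* The primitive of [2 * clip]: equal to [x ^+ 2] on [[-lam, lam]], convex, and
   of linear growth at infinity. *)
Definition huber (x : R) : R := clip x * (2 * x - clip x).

Lemma clip_le x : `|clip x| <= lam.
Proof.
rewrite ler_norml /clip le_max lexx/= ge_max ge_min lexx orbT andbT.
by move: lam0; lra.
Qed.

Lemma clip_id x : `|x| <= lam -> clip x = x.
Proof. by rewrite ler_norml => /andP[h1 h2]; rewrite /clip min_l// max_r. Qed.

Lemma clip_cases x :
  [\/ clip x = x /\ - lam <= x <= lam, clip x = - lam /\ x < - lam |
      clip x = lam /\ lam < x].
Proof.
rewrite /clip; have [h1|h1] := leP x lam; last first.
  by apply: Or33; rewrite max_r//; move: lam0; lra.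
have [h2|h2] := leP (- lam) x; first by apply: Or31; split=> //; apply/andP.
by apply: Or32.
Qed.

(** The gap above the tangent factors through [clip y - clip x], which leaves nine sign checks. When
    both points lie in [[- lam, lam]] the gap is exactly [(y - x) ^+ 2], and this is how quadratic
    variation appears. *)
Lemma huber_convex x y :
  0 <= huber y - huber x - 2 * clip x * (y - x).
Proof.
have -> : huber y - huber x - 2 * clip x * (y - x) =
  (clip y - clip x) * (2 * y - clip y - clip x) by rewrite /huber; ring.
move: lam0; case: (clip_cases x) => [] [-> hx]; case: (clip_cases y) => [] [-> hy] l0.
- by rewrite [leRHS](_ : _ = (y - x) ^+ 2) ?sqr_ge0//; ring.
- by rewrite [leRHS](_ : _ = (x + lam) * (x + lam - 2 * (y + lam))); [nra | ring].
- by rewrite [leRHS](_ : _ = (lam - x) * (2 * (y - lam) + (lam - x))); [nra | ring].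
- by rewrite [leRHS](_ : _ = (y + lam) ^+ 2) ?sqr_ge0//; ring.
- by rewrite addrN mul0r.
- by rewrite [leRHS](_ : _ = 2 * lam * (2 * y)); [nra | ring].
- by rewrite [leRHS](_ : _ = (lam - y) ^+ 2) ?sqr_ge0//; ring.
- by rewrite [leRHS](_ : _ = 2 * lam * (2 * - y)); [nra | ring].
- by rewrite addrN mul0r.
Qed.

Lemma huber_ge0 x : 0 <= huber x.
Proof.
have c0 : clip 0 = 0 by apply: clip_id; rewrite normr0 ltW.
have := huber_convex 0 x.
by rewrite [huber 0]/huber c0 mul0r mulr0 mul0r !subr0.
Qed.

(** A martingale is only assumed integrable, so its square may have no finite mean; linear growth
    makes [huber] of it integrable. *)
Lemma huber_le x : huber x <= 2 * lam * `|x|.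
Proof.
rewrite /huber; have := ler_norm x; have := ler_norm (- x); rewrite normrN.
by move: lam0; case: (clip_cases x) => [] [-> hx] l0; nra.
Qed.

Lemma measurable_clip : measurable_fun setT clip.
Proof. by apply: measurable_maxr => //; exact: measurable_minr. Qed.

Lemma measurable_huber : measurable_fun setT huber.
Proof.
apply: measurable_funM; first exact: measurable_clip.
by apply: measurable_funB; [exact: measurable_funM | exact: measurable_clip].
Qed.

End huber.

Section quadratic_variation_semimartingale.
Context (R : realType) (d : measure_display) (T : measurableType d).
Context (P : probability T R) (F : R -> set (set T)) (hF : filtration F).

(** The tangent gaps [S] of [huber] along the grid have mean at most that of [huber lam (L t)],
    whatever the grid. Markov's inequality bounds [S], and on paths that stay within [lam] it
    coincides with [qv]. *)
Lemma whp_martingale_qv (L : R -> T -> R) (t lam : R) :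
  martingale P F L -> 0 < t -> 0 < lam ->
  exists A, forall n C, (0 < n)%N -> 0 < C ->
  whp P (A / C) (fun w => (forall s, 0 <= s <= t -> `|L s w| <= lam) -> qv L t n w < C).
Proof.
move=> ML t0 lam0; have [aL iL mL] := ML.
have mLs s : 0 <= s -> measurable_fun setT (L s).
  by move=> s0; exact: (measurable_wrt_fun hF s0 (aL s s0)).
exists (2 * lam * fine (\int[P]_w `|(L t w)%:E|)%E) => n C n0 C0.
pose f l := L (grid t n l).
have g0 l : 0 <= grid t n l by rewrite grid_ge0// ltW.
have mf l : measurable_fun setT (f l) by exact: mLs.
have iH l : P.-integrable setT (fun w => (huber lam (f l w))%:E).
  apply: (@le_integrable _ _ _ P _ measurableT _
    (fun w => (2 * lam)%:E * (L (grid t n l) w)%:E)%E).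
  - apply/measurable_EFinP; apply: measurableT_comp => //; exact: measurable_huber.
  - move=> w _; rewrite -EFinM !abse_EFin lee_fin.
    rewrite (ger0_norm (huber_ge0 lam0 _)) normrM.
    by rewrite (ger0_norm (_ : 0 <= 2 * lam)) ?huber_le// mulr_ge0// ltW.
  - apply: integrableZl => //; exact: iL.
(* A discrete stochastic integral with a bounded adapted integrand: its mean is zero, so only the
   end values of [huber] contribute. *)
pose Z m w := \sum_(l < m) 2 * clip lam (f l w) * (f l.+1 w - f l w).
have HZ m : P.-integrable setT (EFin \o Z m) /\ (\int[P]_w (Z m w)%:E = 0)%E.
  elim: m => [|m [IH1 IH2]].
    split; last by rewrite integral0_eq// => w _; rewrite /Z big_ord0.
    apply: eq_integrable (integrable0 _ _) => // w _ /=; by rewrite /Z big_ord0.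
  have gle : grid t n m <= grid t n m.+1 by rewrite grid_le// ltW.
  have mc : measurable_wrt (F (grid t n m)) (fun w => 2 * clip lam (f m w)).
    have sg := filtration_sigma hF (g0 m).
    apply/(measurable_wrtP _ sg); apply: measurable_funM => //.
    apply: (measurableT_comp (measurable_clip lam)).
    by apply/(measurable_wrtP _ sg); exact: aL.
  have cb w : `|2 * clip lam (f m w)| <= 2 * lam.
    by rewrite normrM ger0_norm// ler_wpM2l// clip_le.
  have l20 : 0 < 2 * lam by rewrite mulr_gt0.
  have [i1 I1] := expectation_mul_martingale_increment hF ML (g0 m) gle l20 mc cb.
  have E w : Z m.+1 w = Z m w + 2 * clip lam (f m w) * (f m.+1 w - f m w).
    by rewrite /Z big_ord_recr.
  split.
    have := integrableD measurableT IH1 i1.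
    by apply: eq_integrable => // w _; rewrite /= E.
  by under eq_integral do rewrite E EFinD; rewrite integralD// IH2 add0e.
pose S w := \sum_(l < n) (huber lam (f l.+1 w) - huber lam (f l w) -
    2 * clip lam (f l w) * (f l.+1 w - f l w)).
have S0 w : 0 <= S w by apply: sumr_ge0 => l _; exact: huber_convex.
have SE w : S w = huber lam (f n w) - huber lam (f 0%N w) - Z n w.
  rewrite /S sumrB; congr (_ - _).
  by rewrite -(big_mkord xpredT (fun l => _ (f l.+1 w) - _ (f l w))) telescope_sumr.
have [iZ IZ] := HZ n.
have mS : measurable_fun setT S.
  apply: (eq_measurable_fun (fun w => huber lam (f n w) - huber lam (f 0%N w) - Z n w)).
    by move=> w _; rewrite SE.
  apply: measurable_funB; last exact/measurable_EFinP/(measurable_int P iZ).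
  by apply: measurable_funB; apply: measurableT_comp => //; exact: measurable_huber.
have IS : (\int[P]_w (S w)%:E <=
    (2 * lam * fine (\int[P]_w `|(L t w)%:E|))%:E)%E.
  under eq_integral do rewrite SE EFinB EFinB.
  rewrite integralB//; last by have := integrableB measurableT (iH n) (iH 0%N).
  rewrite integralB// IZ sube0.
  have h0 : (0 <= \int[P]_w (huber lam (f 0%N w))%:E)%E.
    by apply: integral_ge0 => w _; rewrite lee_fin huber_ge0.
  apply: (@le_trans _ _ (\int[P]_w (huber lam (f n w))%:E)%E).
    by rewrite leeBlDr ?integrable_fin_num// leeDl.
  have [_ iLt] := integrableP _ _ _ (iL t (ltW t0)).
  rewrite EFinM fineK ?ge0_fin_numE ?integral_ge0//.
  rewrite -ge0_integralZl//; last 2 first.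
  - by apply: measurableT_comp => //; apply/measurable_EFinP; exact: mLs (ltW t0).
  - by rewrite lee_fin mulr_ge0// ltW.
  apply: ge0_le_integral => //.
  - by move=> w _; rewrite lee_fin huber_ge0.
  - exact: measurable_int (iH n).
  - apply: emeasurable_funM => //; apply: measurableT_comp => //.
    by apply/measurable_EFinP; exact: mLs (ltW t0).
  by move=> w _; rewrite abse_EFin -EFinM lee_fin /f gridn// huber_le.
apply: whpS (whp_markov mS S0 C0 IS) => // w SC Lb.
rewrite (_ : qv L t n w = S w)//; apply: eq_bigr => l _.
have b l' : (l' <= n)%N -> `|f l' w| <= lam.
  by move=> ln; apply: Lb; apply: grid_itv => //; exact: ltW.
rewrite /huber !clip_id ?b ?(ltnW (ltn_ord l))// /f; ring.
Qed.

(** With high probability [tau n] exceeds [t] and the path is bounded on [[0, t]]; there [L]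
    coincides with a stopped martingale to which the previous bound applies. *)
Lemma qv_tight_local_martingale (L : R -> T -> R) (t : R) : 0 < t ->
  local_martingale P F L -> as_continuous P L -> qv_tight P L t.
Proof.
move=> t0 [aL [tau [stau atau mtau]]] cL p p0.
have mL s : 0 <= s -> measurable_fun setT (L s).
  by move=> s0; exact: (measurable_wrt_fun hF s0 (aL s s0)).
have p3 : 0 < p / 3 by rewrite divr_gt0.
have [lam Hlam] := whp_bounded mL cL (ltW t0) p3.
(* The times [tau] are monotone only almost surely; the intersection makes the events decreasing at
   every [w]. *)
pose A n := \bigcap_(j in [set j | (j <= n)%N]) [set w | (tau j w <= t%:E)%E].
have mtau' j : measurable [set w | (tau j w <= t%:E)%E].
  have [_ /(_ t (ltW t0)) FA] := stau j.
  by have [/(_ t (ltW t0))[_ +] _] := hF; apply.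
have mA n : measurable (A n) by apply: bigcap_measurable => //; exists 0%N.
have [n Hn] : exists n, (P (A n) <= (p / 3)%:E)%E.
  apply: probability_decreasing_small => //.
    by move=> n w Aw j /= jn; apply: Aw => /=; exact: leqW.
  apply: filterS atau => w [ndt cvt].
  have : \forall n \near \oo, (t%:E < tau n w)%E.
    apply: (cvt [set x | (t%:E < x)%E]).
    by apply: open_nbhs_nbhs; split; [exact: open_ereal_gt_ereal | rewrite /= ltry].
  move=> [n _ /(_ n (leqnn n)) /= h]; exists n => Aw.
  by have := Aw n (leqnn n); rewrite /= leNgt h.
have Ht : whp P (p / 3) (fun w => (t%:E < tau n w)%E).
  rewrite -(addr0 (p / 3)).
  have HA : whp P (p / 3) (fun w => ~ A n w) by exists (A n).
  apply: whpS (whpI HA (whp_ae (lexx 0) atau)) => // w [nA [ndt _]].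
  rewrite ltNge; apply/negP => h; apply: nA => j /= jn.
  by apply: le_trans h; exact: ndt.
have lam1 : 0 < lam%:R + 1 :> R by rewrite ltr_wpDl.
have [B HB] := whp_martingale_qv (mtau n) t0 lam1.
pose C := `|B| / (p / 3) + 1.
have C0 : 0 < C by rewrite ltr_wpDl// divr_ge0// ltW.
have BC : B / C <= p / 3.
  rewrite ler_pdivrMr// /C mulrDr mulr1 [X in _ <= X + _]mulrC divfK ?gt_eqF//.
  by have := ler_norm B; lra.
exists C => m m0.
apply: whpS (whpI (whpI Hlam Ht) (HB m C m0 C0)).
  by move: BC; lra.
move=> w [[Lb tw] H].
have E s : 0 <= s <= t -> stopped L (tau n) s w = L s w.
  move=> /andP[_ st]; rewrite /stopped min_l// ltW// (le_lt_trans _ tw)// lee_fin.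
have := H _; rewrite (_ : qv _ t m w = qv L t m w); last first.
  apply: eq_bigr => l _; rewrite !E//.
  - by apply: grid_itv; [exact: ltW | exact: ltnW].
  - by apply: grid_itv; [exact: ltW |].
move=> H'; apply: ltW; apply: H' => s st; rewrite E//.
by apply: le_trans (Lb s st) _; rewrite lerDl.
Qed.

Lemma qv_tight_semimartingale (X : R -> T -> R) (t : R) : 0 < t ->
  continuous_semimartingale P F X -> qv_tight P X t.
Proof.
move=> t0 [aX cX [L [V [[lL cL] [aV cV] _ bV dec]]]] p p0.
have p3 : 0 < p / 2 by rewrite divr_gt0.
have mV s : 0 <= s -> measurable_fun setT (V s).
  by move=> s0; exact: (measurable_wrt_fun hF s0 (aV s s0)).
have [C1 H1] := qv_tight_local_martingale t0 lL cL p3.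
have [C2 H2] := qv_tight_bounded_variation t0 mV bV p3.
exists (2 * C1 + 2 * C2) => n n0.
rewrite [p]splitr -[p / 2 + p / 2]addr0.
apply: whpS (whpI (whpI (H1 n n0) (H2 n n0)) (whp_ae (lexx 0) dec)) => // w [[h1 h2] D].
apply: (@le_trans _ _ (2 * qv L t n w + 2 * qv V t n w)).
  rewrite /qv !mulr_sumr -big_split; apply: ler_sum => l _ /=.
  have g0 j : 0 <= grid t n j by rewrite grid_ge0// ltW.
  rewrite (D _ (g0 l)) (D _ (g0 l.+1)).
  set a := L _ w - L _ w; set b := V _ w - V _ w.
  rewrite [leLHS](_ : _ = (a + b) ^+ 2); last by rewrite /a /b; ring.
  by have := sqr_ge0 (a - b); nra.
by rewrite lerD// ler_wpM2l.
Qed.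

End quadratic_variation_semimartingale.

(** * Ito integrals as limits of Riemann sums *)

Section riemann_sums.
Context (R : realType).

(** Used to merge the uniform grid with the times of a simple process. Duplicates are removed
    because the Ito estimates need strictly increasing times. *)
Lemma sorted_enumeration (t : R) (l : seq R) :
  0 \in l -> t \in l -> {in l, forall x, 0 <= x <= t} ->
  exists m (s : nat -> R), [/\ s 0%N = 0, s m = t,
    forall j, (j < m)%N -> s j < s j.+1 &
    {in l, forall x, exists2 j, (j <= m)%N & x = s j}].
Proof.
move=> l0 lt lb; pose L := sort <=%R (undup l).
have LE x : (x \in L) = (x \in l) by rewrite mem_sort mem_undup.
have sL : sorted <%R L by rewrite sort_lt_sorted undup_uniq.
have L0 : (0 < size L)%N.
  by case: (L) (LE 0) => //; rewrite l0.
exists (size L).-1, (nth t L).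
have inL j : (j < size L)%N -> nth t L j \in l by move=> jL; rewrite -LE mem_nth.
have mono i j : (i <= j)%N -> (j < size L)%N -> nth t L i <= nth t L j.
  move=> ij jL; apply: (sorted_leq_nth le_trans lexx t (sort_le_sorted _)) => //.
  exact: leq_ltn_trans jL.
have LS : (size L).-1.+1 = size L by rewrite prednK.
have ix x : x \in l -> exists2 j, (j <= (size L).-1)%N & x = nth t L j.
  rewrite -LE => xL; exists (index x L); last by rewrite nth_index.
  by rewrite -ltnS LS index_mem.
split.
- have [j jL E] := ix 0 l0.
  apply/eqP; rewrite eq_le; have /andP[-> _] := lb _ (inL 0%N L0).
  by rewrite [leRHS]E mono// -LS ltnS.
- have [j jL E] := ix t lt.
  apply/eqP; rewrite eq_le.
  have jS : ((size L).-1 < size L)%N by rewrite LS.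
  have /andP[_ ->] := lb _ (inL _ jS).
  by rewrite [leLHS]E mono.
- move=> j jL; apply: (sorted_ltn_nth lt_trans t sL) => //.
  + by rewrite inE -LS ltnS ltnW.
  + by rewrite inE -LS ltnS.
- exact: ix.
Qed.

Section subordinate.
Context (m : nat) (s : nat -> R) (s_lt : forall j, (j < m)%N -> s j < s j.+1).

Lemma enumeration_lt i j : (i < j)%N -> (j <= m)%N -> s i < s j.
Proof.
move=> /subnK <-; elim: (j - i.+1)%N => [|a IH] am; first exact: s_lt.
exact: lt_trans (IH (ltnW am)) (s_lt am).
Qed.

Lemma enumeration_ltE i j : (i <= m)%N -> (j <= m)%N -> (s i < s j) = (i < j)%N.
Proof.
move=> im jm; case: (ltngtP i j) => ij.
- exact: enumeration_lt.
- by apply/negbTE; rewrite -leNgt ltW// enumeration_lt.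
- by rewrite ij ltxx.
Qed.

Lemma enumeration_telescope (f : R -> R) b : (b <= m)%N ->
  \sum_(j < m) (s j < s b)%R%:R * (f (s j.+1) - f (s j)) = f (s b) - f (s 0%N).
Proof.
move=> bm; rewrite (eq_bigr (fun j : 'I_m => if (j < b)%N then f (s j.+1) - f (s j) else 0)).
  rewrite -big_mkcond /= -(big_ord_widen _ (fun j => f (s j.+1) - f (s j)))//.
  by rewrite -(big_mkord xpredT (fun j => f (s j.+1) - f (s j))) telescope_sumr.
move=> j _; rewrite (enumeration_ltE (ltnW (ltn_ord j)) bm).
by case: (j < b)%N; rewrite ?mul1r ?mul0r.
Qed.

(* The step function with value [xi i] between [sg i] and [sg i.+1] takes the
   value [step_coef sg xi N x] immediately to the right of [x]. *)
Definition step_coef (sg xi : nat -> R) (N : nat) (x : R) : R :=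
  \sum_(i < N) xi i * ((x < sg i.+1)%R%:R - (x < sg i)%R%:R).

(** After exchanging the sums, each [i] leaves two telescoping sums, up to [sg i.+1] and [sg i],
    whose lower ends cancel. *)
Lemma step_coef_sum (f : R -> R) (sg xi : nat -> R) N :
  (forall i, (i <= N)%N -> exists2 j, (j <= m)%N & sg i = s j) ->
  \sum_(j < m) step_coef sg xi N (s j) * (f (s j.+1) - f (s j)) =
  \sum_(i < N) xi i * (f (sg i.+1) - f (sg i)).
Proof.
move=> sgs; under eq_bigr do rewrite mulr_suml.
rewrite exchange_big; apply: eq_bigr => i _ /=.
under eq_bigr do rewrite -mulrA mulrBl.
rewrite -mulr_sumr sumrB; congr (_ * _).
have [a am ->] := sgs i.+1 (ltn_ord i).
have [b bm ->] := sgs i (ltnW (ltn_ord i)).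
rewrite !enumeration_telescope//; ring.
Qed.

End subordinate.

(** The indicators of the grid cells add up to 1 at [x], so the difference is an average of
    [X (grid t n l) - X u] over the cell that contains [x]. *)
Lemma step_coef_grid (X : R -> R) (t rho x u : R) (n : nat) : 0 < t -> (0 < n)%N ->
  0 <= x < t ->
  (forall l, (l < n)%N -> grid t n l <= x -> x < grid t n l.+1 ->
     `|X (grid t n l) - X u| <= rho) ->
  `|step_coef (grid t n) (fun l => X (grid t n l)) n x - X u| <= rho.
Proof.
move=> t0 n0 /andP[x0 xt] H.
pose a l : R := (x < grid t n l.+1)%R%:R - (x < grid t n l)%R%:R.
have a1 : \sum_(l < n) a l = 1.
  rewrite -(big_mkord xpredT a) telescope_sumr// gridn// grid0 xt ltNge x0 /=.
  by rewrite subr0.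
have aH l : (l < n)%N -> 0 <= a l /\ `|(X (grid t n l) - X u) * a l| <= rho * a l.
  move=> ln; rewrite /a; have [h1|h1] := ltP x (grid t n l).
    by rewrite (lt_trans h1) ?grid_lt// subrr !mulr0 normr0.
  have [h2|h2] := ltP x (grid t n l.+1); rewrite subr0.
    by rewrite mulr1 mulr1; split => //; exact: H.
  by rewrite !mulr0 normr0.
rewrite -[X u]mulr1 -a1 mulr_sumr -sumrB.
apply: (@le_trans _ _ (\sum_(l < n) rho * a l)).
  apply: le_trans (ler_norm_sum _ _ _) _; apply: ler_sum => l _.
  by rewrite -mulrBl; have [_] := aH l (ltn_ord l).
by rewrite -mulr_sumr a1 mulr1.
Qed.

End riemann_sums.

Section ito_riemann.
Context (R : realType) (d : measure_display) (T : measurableType d).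
Context (P : probability T R) (F : R -> set (set T)) (hF : filtration F).
Context (K : nat) (beta : 'I_K -> R -> T -> R) (hbeta : brownian_motion P F beta).
Context (k : 'I_K).
Let B := beta k.

Lemma energy_le_integral (m : nat) (s : nat -> R) (c : nat -> R) (f : R -> R) :
  (forall j, (j < m)%N -> s j < s j.+1) ->
  measurable_fun `[s 0%N, s m] f -> (forall u, 0 <= f u) ->
  (forall j u, (j < m)%N -> s j < u <= s j.+1 -> c j ^+ 2 <= f u) ->
  ((\sum_(j < m) c j ^+ 2 * (s j.+1 - s j))%:E <=
   \int[lebesgue_measure]_(u in `[s 0%N, s m]) (f u)%:E)%E.
Proof.
move=> s_lt mf f0 cf.
have s_le j : (j <= m)%N -> s 0%N <= s j.
  case: j => [//|j] jm; exact: ltW (enumeration_lt s_lt (ltn0Sn j) jm).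
have s_le' j : (j <= m)%N -> s j <= s m.
  rewrite leq_eqVlt => /predU1P[->//|jm].
  exact: ltW (enumeration_lt s_lt jm (leqnn m)).
apply: (@le_trans _ _ (\int[lebesgue_measure]_(u in `]s 0%N, s m]) (f u)%:E)%E); last first.
  apply: ge0_subset_integral => //; first exact/measurable_EFinP.
    by move=> u _; rewrite lee_fin.
  by apply: subset_itvr; rewrite bnd_simp.
have : forall j, (j <= m)%N -> ((\sum_(i < j) c i ^+ 2 * (s i.+1 - s i))%:E <=
   \int[lebesgue_measure]_(u in `]s 0%N, s j]) (f u)%:E)%E; last by apply.
elim=> [_|j IH jm].
  rewrite big_ord0; apply: integral_ge0 => u _; by rewrite lee_fin.
have mfS a b : s 0%N <= a -> b <= s m -> measurable_fun `]a, b] (EFin \o f).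
  move=> ha hb; apply/measurable_EFinP; apply: measurable_funS mf => // u /=.
  rewrite !in_itv /= => /andP[h1 h2].
  by rewrite (ltW (le_lt_trans ha h1)) (le_trans h2).
have E : `]s 0%N, s j.+1]%classic = `]s 0%N, s j] `|` `]s j, s j.+1].
  rewrite -itv_bndbnd_setU// bnd_simp; first exact: s_le (ltnW jm).
  exact: ltW (s_lt j jm).
rewrite E ge0_integral_setU//; last 3 first.
- by rewrite -E; apply: mfS => //; exact: s_le'.
- by move=> u _; rewrite lee_fin.
- apply/disj_setPS => u [] /=; rewrite !in_itv /= => /andP[_ h1] /andP[h2 _].
  by move: (lt_le_trans h2 h1); rewrite ltxx.
rewrite big_ord_recr /= EFinD; apply: leeD; first exact: IH (ltnW jm).
apply: (@le_trans _ _ (\int[lebesgue_measure]_(u in `]s j, s j.+1]) (c j ^+ 2)%:E)%E).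
  rewrite integral_cst//= lebesgue_measure_itv/= lte_fin s_lt// -EFinB -EFinM.
apply: ge0_le_integral => //.
- by move=> u _; rewrite lee_fin sqr_ge0.
- by apply: mfS; [exact: s_le (ltnW jm) | exact: s_le'].
by move=> u /=; rewrite in_itv /= => us; rewrite lee_fin; exact: cf.
Qed.

(** On a common refinement, the Riemann sum minus the integral of an approximating simple process is
    a single Ito sum. Its energy is at most twice the squared distance of the simple process to [X]
    plus twice that of the step function, the latter being controlled by the modulus of
    continuity. *)
Lemma ito_integral_riemann (X : R -> T -> R) (t : R) (J : T -> R) :
  adapted F X -> as_continuous P X -> 0 < t -> is_ito_integral P F X B t J ->
  forall e p : R, 0 < e -> 0 < p -> exists n0, forall n, (n0 <= n)%N -> (0 < n)%N ->
  whp P p (fun w => `|\sum_(l < n) X (grid t n l) w *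
    (B (grid t n l.+1) w - B (grid t n l) w) - J w| < e).
Proof.
move=> aX cX t0 [S [HS HJ]] e p e0 p0.
have p4 : 0 < p / 4 by rewrite divr_gt0.
have e2 : 0 < e / 2 by rewrite divr_gt0.
pose eps := (e / 2) ^+ 2.
have eps0 : 0 < eps by rewrite exprn_gt0.
(* Chosen so that the loss [8 * del / eps] of [whp_ito_blocks] is [p / 4]. *)
pose del := p / 4 * eps / 8.
have del0 : 0 < del by rewrite divr_gt0// mulr_gt0.
have del4 : 0 < del / 4 by rewrite divr_gt0.
(* Gives [2 * rho ^+ 2 * t = del / 2]; the simple process accounts for the other half of [del]. *)
pose rho := Num.sqrt (del / 4 / t).
have rho0 : 0 < rho by rewrite sqrtr_gt0 divr_gt0.
have rho2 : rho ^+ 2 = del / 4 / t by rewrite sqr_sqrtr// ltW// divr_gt0.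
have mX s : 0 <= s -> measurable_fun setT (X s).
  by move=> s0; exact: (measurable_wrt_fun hF s0 (aX s s0)).
have [n1 Hmod] := whp_modulus mX cX (ltW t0) rho0 p4.
exists (Num.truncn (t * n1.+1%:R)).+1 => n nn n0.
have n0' : 0 < n%:R :> R by rewrite ltr0n.
have tn : t / n%:R < n1.+1%:R^-1.
  rewrite ltr_pdivrMr// mulrC ltr_pdivlMr ?ltr0n//.
  by apply: lt_le_trans (truncnS_gt _) _; rewrite ler_nat.
have [N0 _ HN] : \forall N \near \oo,
    (exists2 A : set T, measurable A /\ (P A <= (p / 4)%:E)%E &
      forall w, ~ A w -> (\int[lebesgue_measure]_(s in `[0%R, t])
        ((sp_val (S N) s w - X s w) ^+ 2)%:E < (del / 4)%:E)%E) /\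
    (exists2 A : set T, measurable A /\ (P A <= (p / 4)%:E)%E &
      forall w, ~ A w -> ((`|sp_integral (S N) B t w - J w|)%:E < (e / 2)%:E)%E).
  by have := HS _ _ del4 p4; have := HJ _ _ e2 p4; apply: filterS2.
have [HS1 HJ1] := HN N0 (leqnn N0).
set Q := S N0 in HS1 HJ1.
have tau_ge0 i : 0 <= sp_time Q i.
  elim: i => [|i IH]; first exact: sp_time0.
  exact: le_trans IH (sp_time_nd Q i).
pose sg i := Num.min (sp_time Q i) t.
have sgP i : 0 <= sg i <= t by rewrite /sg le_min tau_ge0 (ltW t0)/= ge_min lexx orbT.
have [m [s [s0 sm s_lt sl]]] : exists m (s : nat -> R), [/\ s 0%N = 0, s m = t,
    forall j, (j < m)%N -> s j < s j.+1 &
    {in [seq grid t n l | l <- iota 0 n.+1] ++ [seq sg i | i <- iota 0 (sp_size Q).+1],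
       forall x, exists2 j, (j <= m)%N & x = s j}].
  apply: sorted_enumeration.
  - rewrite mem_cat; apply/orP; left; apply/mapP; exists 0%N; last by rewrite grid0.
    by rewrite mem_iota add0n ltnS ?leqnn.
  - rewrite mem_cat; apply/orP; left; apply/mapP; exists n; last by rewrite gridn.
    by rewrite mem_iota add0n ltnS ?leqnn.
  - move=> x; rewrite mem_cat; case/orP => /mapP[i + ->]; rewrite mem_iota add0n => hi //.
    by apply: grid_itv; [exact: ltW | rewrite -ltnS].
have gs i : (i <= n)%N -> exists2 j, (j <= m)%N & grid t n i = s j.
  move=> iN; apply: sl; rewrite mem_cat; apply/orP; left; apply/mapP.
  by exists i => //; rewrite mem_iota add0n ltnS.
have sgs i : (i <= sp_size Q)%N -> exists2 j, (j <= m)%N & sg i = s j.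
  move=> iN; apply: sl; rewrite mem_cat; apply/orP; right; apply/mapP.
  by exists i => //; rewrite mem_iota add0n ltnS.
have s_ge0 j : (j <= m)%N -> 0 <= s j.
  case: j => [_|j jm]; first by rewrite s0.
  by rewrite -s0 ltW// (enumeration_lt s_lt).
have s_ltt j : (j < m)%N -> s j < t by move=> jm; rewrite -sm (enumeration_lt s_lt).
pose cS j w := step_coef sg (fun i => sp_coef Q i w) (sp_size Q) (s j).
pose cX' j w := step_coef (grid t n) (fun l => X (grid t n l) w) n (s j).
pose c j w := cX' j w - cS j w.
have mc j : (j < 1 * m)%N -> measurable_wrt (F (s j)) (c j).
  rewrite mul1n => jm; have sj0 := s_ge0 _ (ltnW jm).
  have sF := filtration_sigma hF sj0.
  apply/(measurable_wrtP _ sF); apply: measurable_funB.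
  - apply: measurable_sum => l.
    have [h|h] := ltP (s j) (grid t n l).
      under eq_fun do rewrite (lt_trans h) ?grid_lt// subrr mulr0.
      exact: measurable_cst.
    apply: measurable_funM => //; apply/(measurable_wrtP _ sF).
    have g0 := grid_ge0 n l (ltW t0).
    exact: (measurable_wrt_le hF g0 h (aX _ g0)).
  - apply: measurable_sum => l.
    have [h|h] := ltP (s j) (sg l).
      have h' : s j < sg l.+1.
        apply: lt_le_trans h _; rewrite /sg le_min ge_min sp_time_nd/=.
        by rewrite ge_min lexx orbT.
      under eq_fun do rewrite h' subrr mulr0.
      exact: measurable_cst.
    apply: measurable_funM => //; apply/(measurable_wrtP _ sF).
    apply: (measurable_wrt_le hF (tau_ge0 l) _ (sp_coef_meas Q l)).
    move: h; rewrite /sg ge_min => /orP[//|ts].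
    by have := le_lt_trans ts (s_ltt _ jm); rewrite ltxx.
have sumE w : \sum_(j < m) c j w * (B (s j.+1) w - B (s j) w) =
    \sum_(l < n) X (grid t n l) w * (B (grid t n l.+1) w - B (grid t n l) w) -
    sp_integral Q B t w.
  under eq_bigr do rewrite mulrBl.
  rewrite sumrB; congr (_ - _).
    exact: (step_coef_sum s_lt (B ^~ w) (fun l => X (grid t n l) w) gs).
  exact: (step_coef_sum s_lt (B ^~ w) (fun l => sp_coef Q l w) sgs).
have s_ge0' j : (j <= 1 * m)%N -> 0 <= s j by rewrite mul1n; exact: s_ge0.
have s_lt' j : (j < 1 * m)%N -> s j < s j.+1 by rewrite mul1n; exact: s_lt.
have HE : whp P (p / 4 + p / 4) (fun w => energy s c (1 * m) w <= del).
  rewrite -[p / 4 + p / 4]addr0.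
  apply: whpS (whpI (whpI HS1 Hmod) (whp_ae (lexx 0) cX)) => // w [[h1 h2] h3].
  rewrite mul1n /energy -lee_fin.
  have mv : measurable_fun `[0, t] (fun u => sp_val Q u w - X u w).
    apply: measurable_funB.
      apply: measurable_funTS; apply: measurable_sum => i.
      by apply: measurable_funM => //; exact: measurable_indic.
    have mI : measurable (`[0, +oo[%classic : set R) by [].
    apply: measurable_funS mI _ (subspace_continuous_measurable_fun mI h3).
    by apply: subset_itvl; rewrite bnd_simp.
  pose f u := 2 * (sp_val Q u w - X u w) ^+ 2 + 2 * rho ^+ 2.
  have mf : measurable_fun `[s 0%N, s m] f.
    rewrite s0 sm; apply: measurable_funD => //; apply: measurable_funM => //.
    exact: measurable_funX.
  have f0 u : 0 <= f u by rewrite /f addr_ge0// mulr_ge0// sqr_ge0.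
  have EL := @energy_le_integral m s (c ^~ w) f s_lt mf f0.
  apply: le_trans (EL _) _ => {EL}.
    move=> j u jm /andP[ju uj].
    have sjt : 0 <= s j < t by rewrite s_ge0 ?s_ltt// ltnW.
    have ut : 0 <= u <= t.
      rewrite (le_trans (s_ge0 _ (ltnW jm)) (ltW ju)) (le_trans uj)//.
      by rewrite -sm; case: (ltngtP j.+1 m) jm => [jm _|//|-> _//]; rewrite ltW ?(enumeration_lt s_lt).
    (* No point of the refinement lies strictly between [s j] and [s j.+1], so comparisons of [u]
       with these points can be made at [s j]. *)
    have side x j' : (j' <= m)%N -> x = s j' -> (s j < x) = (u <= x).
      move=> j'm ->; rewrite (enumeration_ltE s_lt (ltnW jm) j'm).
      apply/idP/idP => [jj'|us].
        apply: le_trans uj _; move: jj'; rewrite leq_eqVlt => /predU1P[->//|jj'].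
        by rewrite ltW ?(enumeration_lt s_lt).
      rewrite -(enumeration_ltE s_lt (ltnW jm) j'm).
      exact: lt_le_trans ju us.
    have -> : c j w = (cX' j w - X u w) + (X u w - cS j w) by rewrite /c; ring.
    have -> : cS j w = sp_val Q u w.
      apply: eq_bigr => i _; congr (_ * _); rewrite indicE.
      have [a am aE] := sgs i.+1 (ltn_ord i).
      have [b bm bE] := sgs i (ltnW (ltn_ord i)).
      rewrite (side _ a)// (side _ b)// /sg !le_min; have /andP[_ ->] := ut.
      rewrite !andbT; case: (leP u (sp_time Q i)) => h.
        rewrite (le_trans h (sp_time_nd Q i)) subrr.
        rewrite memNset//= in_itv /= => /andP[h' _].
        by move: (lt_le_trans h' h); rewrite ltxx.
      rewrite subr0; case: (leP u (sp_time Q i.+1)) => h'.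
        by rewrite mem_set//= in_itv /= h.
      by rewrite memNset//= in_itv /= h leNgt h'.
    have hX : `|cX' j w - X u w| <= rho.
      apply: (@step_coef_grid R (X ^~ w) t rho (s j) u n t0 n0 sjt) => l ln gl1 gl2.
      apply: h2 => //.
        by apply: grid_itv; [exact: ltW | exact: ltnW].
      have [a am aE] := gs l.+1 ln.
      have ug : u <= grid t n l.+1 by rewrite -(side _ a).
      rewrite distrC ger0_norm; last by rewrite subr_ge0 (le_trans gl1 (ltW ju)).
      by apply: le_lt_trans tn; rewrite -(gridSB t l n0) lerD2r.
    have : (cX' j w - X u w) ^+ 2 <= rho ^+ 2.
      by rewrite -real_normK ?num_real// lerXn2r ?nnegrE// ltW.
    rewrite /f; set a := cX' j w - X u w; set b := sp_val Q u w - X u w.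
    rewrite (_ : X u w - sp_val Q u w = - b); last by rewrite /b; ring.
    by have := sqr_ge0 (a + b); nra.
  rewrite s0 sm /f.
  under eq_integral do rewrite EFinD EFinM.
  rewrite ge0_integralD//; last 3 first.
  - by move=> u _; rewrite -EFinM lee_fin mulr_ge0// sqr_ge0.
  - apply: emeasurable_funM => //; apply/measurable_EFinP.
    exact: measurable_funX.
  - by move=> u _; rewrite lee_fin mulr_ge0// sqr_ge0.
  rewrite ge0_integralZl//; last 2 first.
  - by apply/measurable_EFinP; exact: measurable_funX.
  - by move=> u _; rewrite lee_fin sqr_ge0.
  rewrite integral_cst//= lebesgue_measure_itv/= lte_fin t0 sube0 -EFinM.
  rewrite rho2 (_ : 2 * (del / 4 / t) * t = del / 2); last by field; rewrite gt_eqF.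
  apply: (@le_trans _ _ (2%:E * (del / 4)%:E + (del / 2)%:E)%E).
    by rewrite leeD2r// lee_wpmul2l// ltW.
  by rewrite -EFinM -EFinD lee_fin; lra.
have HL := whp_ito_blocks hF hbeta k s_ge0' s_lt' mc del0 eps0 HE.
have HL' : whp P (p / 4 + p / 4 + p / 4) (fun w =>
    (\sum_(j < m) c j w * (B (s j.+1) w - B (s j) w)) ^+ 2 < eps).
  apply: whpS HL => [|w].
    rewrite lerD2l (_ : 8 * del / eps = p / 4)// /del.
    by field; rewrite gt_eqF.
  by rewrite big_ord1.
apply: whpS (whpI HL' HJ1) => [|w [h1 h2]]; first by lra.
rewrite sumE in h1; rewrite lte_fin in h2.
set a := \sum_(l < n) _ in h1 *; set b := sp_integral _ _ _ _ in h1 h2.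
have h1' : `|a - b| < e / 2.
  rewrite ltNge; apply/negP => h; move: h1; rewrite ltNge => /negP; apply.
  by rewrite /eps -(real_normK (num_real (a - b))) lerXn2r ?nnegrE// ltW.
have := ler_normD (a - b) (b - J w); rewrite addrA subrK; lra.
Qed.

End ito_riemann.

(** * Stratonovich integrals and midpoint sums *)

Section stratonovich.
Context (R : realType) (d : measure_display) (T : measurableType d).
Context (P : probability T R) (F : R -> set (set T)) (hF : filtration F).

Lemma whp_eventually_forall (n : nat) (Q : nat -> nat -> T -> Prop) :
  (forall i, (i < n)%N -> forall p, 0 < p ->
    exists m0, forall m, (m0 <= m)%N -> whp P p (Q i m)) ->
  forall p, 0 < p -> exists m0, forall m, (m0 <= m)%N ->
    whp P p (fun w => forall i, (i < n)%N -> Q i m w).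
Proof.
elim: n => [_ p p0|n IH H p p0].
  by exists 0%N => m _; apply: whp_ae; [exact: ltW | apply: aeW].
have p2 : 0 < p / 2 by rewrite divr_gt0.
have [m1 H1] := IH (fun i ilt => H i (ltnW ilt)) _ p2.
have [m2 H2] := H n (ltnSn n) _ p2.
exists (maxn m1 m2) => m; rewrite geq_max => /andP[mm1 mm2].
apply: whpS (whpI (H1 m mm1) (H2 m mm2)); first by rewrite -splitr.
move=> w [h1 h2] i; rewrite ltnS leq_eqVlt => /predU1P[->//|]; exact: h1.
Qed.

Definition incr (X : R -> T -> R) (t : R) (n l : nat) (w : T) : R :=
  X (grid t n l.+1) w - X (grid t n l) w.

Definition midp (X : R -> T -> R) (t : R) (n l : nat) (w : T) : R :=
  (X (grid t n l.+1) w + X (grid t n l) w) / 2.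

Lemma covariation_sum_grid (X Y : R -> T -> R) t n w :
  covariation_sum X Y t (grid_seq t n) w = \sum_(l < n) incr X t n l w * incr Y t n l w.
Proof.
rewrite /covariation_sum size_grid_seq; apply: eq_bigr => l _.
by rewrite !nth_grid_seq// ltnW.
Qed.

Lemma covariation_grid (X Y : R -> T -> R) (t : R) (C : T -> R) : 0 < t ->
  is_covariation P X Y t C ->
  forall e p : R, 0 < e -> 0 < p -> exists n0, forall n, (n0 <= n)%N -> (0 < n)%N ->
  whp P p (fun w => `|\sum_(l < n) incr X t n l w * incr Y t n l w - C w| < e).
Proof.
move=> t0 HC e p e0 p0.
have mesh : mesh_to0 t (fun n => grid_seq t n.+1).
  move=> e' e'0; exists (Num.truncn (t / e')) => // n nn i.
  rewrite size_grid_seq => iN; rewrite !nth_grid_seq//; last exact: ltnW.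
  rewrite gridSB// ltr_pdivrMr ?ltr0n// mulrC -ltr_pdivrMr//.
  by apply: lt_le_trans (truncnS_gt _) _; rewrite ler_nat ltnS.
have [n0 _ Hn0] := HC _ (fun n => grid_seq_partition t0 (ltn0Sn n)) mesh e p e0 p0.
exists n0.+1 => -[//|n] nn _; have [A mA HA] := Hn0 n nn.
by exists A => // w /HA; rewrite lte_fin covariation_sum_grid.
Qed.

Context (K : nat) (beta : 'I_K -> R -> T -> R) (hbeta : brownian_motion P F beta).
Context (k : 'I_K).
Let B := beta k.

(** The midpoint value is the left value plus half the increment, so the midpoint sum is an Ito
    Riemann sum plus half a discrete covariation. *)
Lemma stratonovich_grid (X : R -> T -> R) (t : R) (I : T -> R) : 0 < t ->
  is_stratonovich_integral P F X B t I ->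
  forall e p : R, 0 < e -> 0 < p -> exists n0, forall n, (n0 <= n)%N -> (0 < n)%N ->
  whp P p (fun w => `|\sum_(l < n) midp X t n l w * incr B t n l w - I w| < e).
Proof.
move=> t0 [[aX cX _] [J [C [HJ HC HI]]]] e p e0 p0.
have e2 : 0 < e / 2 by rewrite divr_gt0.
have p2 : 0 < p / 2 by rewrite divr_gt0.
have [n1 H1] := ito_integral_riemann hF hbeta aX cX t0 HJ e2 p2.
have [n2 H2] := covariation_grid t0 HC e2 p2.
exists (maxn n1 n2) => n; rewrite geq_max => /andP[nn1 nn2] n0.
have := whpI (whpI (H1 n nn1 n0) (H2 n nn2 n0)) (whp_ae (lexx 0) HI).
apply: whpS => [|w [[h1 h2] ->]]; first by rewrite addr0 -splitr.
have -> : \sum_(l < n) midp X t n l w * incr B t n l w =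
  \sum_(l < n) X (grid t n l) w * (B (grid t n l.+1) w - B (grid t n l) w) +
  2^-1 * \sum_(l < n) incr X t n l w * incr B t n l w.
  rewrite mulr_sumr -big_split; apply: eq_bigr => l _ /=.
  by rewrite /midp /incr; field.
move: h1 h2; set u := \sum_(l < n) _; set v := \sum_(l < n) _ => h1 h2.
rewrite (_ : _ - _ = (u - J w) + 2^-1 * (v - C w)); last by ring.
have := ler_normD (u - J w) (2^-1 * (v - C w)).
by rewrite normrM (ger0_norm (_ : 0 <= 2^-1))//; lra.
Qed.

(** The block estimate with integrand 1 and blocks of length one: the energy is exactly [t], and the
    level [8 * t / p] makes the loss equal to [p]. *)
Lemma qv_tight_brownian (t : R) : 0 < t -> qv_tight P B t.
Proof.
move=> t0 p p0; exists (8 * t / p) => n n0.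
have eps0 : 0 < 8 * t / p by rewrite divr_gt0// mulr_gt0.
have g0 l : (l <= n * 1)%N -> 0 <= grid t n l by rewrite grid_ge0// ltW.
have gl l : (l < n * 1)%N -> grid t n l < grid t n l.+1 by rewrite grid_lt.
have mc l : (l < n * 1)%N -> measurable_wrt (F (grid t n l)) (fun=> 1 : R).
  move=> ln; have sg := filtration_sigma hF (g0 _ (ltnW ln)).
  by apply/(measurable_wrtP _ sg); exact: measurable_cst.
have := whp_ito_blocks hF hbeta k g0 gl mc t0 eps0.
move=> /(_ 0) H; have {}H := H _.
apply: whpS (H _) => [|w|].
- by rewrite add0r invf_div mulrCA mulfV ?mulr1// gt_eqF// mulr_gt0.
- move=> /ltW; rewrite (_ : \sum_(i < n) _ = qv B t n w)//.
  apply: eq_bigr => i _; rewrite /ito_sum big_ord1 /= muln1 addn0.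
  by rewrite mul1r.
- apply: whp_ae => //; apply: aeW => w.
  rewrite /energy muln1 (eq_bigr (fun=> t / n%:R)) => [|l _]; last first.
    by rewrite expr1n mul1r gridSB.
  by rewrite sumr_const card_ord -[_ *+ n]mulr_natr divfK// pnatr_eq0 -lt0n.
Qed.

(* [nsum x t N m i] is the integral of [x - x (t_i)] against [B] over the i-th
   coarse interval, computed on the grid refined by a factor [m]; [wsum] is the
   difference of the fine and coarse covariation over that interval. *)
Definition nsum (x : R -> T -> R) (t : R) (N m i : nat) (w : T) : R :=
  \sum_(b < m) (x (grid t (N * m) (i * m + b)) w - x (grid t N i) w) *
    incr B t (N * m) (i * m + b) w.

Definition wsum (x : R -> T -> R) (t : R) (N m i : nat) (w : T) : R :=
  \sum_(b < m) incr x t (N * m) (i * m + b) w * incr B t (N * m) (i * m + b) w -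
  incr x t N i w * incr B t N i w.

Lemma sum_incr_refine (X : R -> T -> R) t N m i w : (0 < m)%N ->
  \sum_(b < m) incr X t (N * m) (i * m + b) w = incr X t N i w.
Proof.
move=> m0; rewrite -(big_mkord xpredT (fun b => incr X t (N * m) (i * m + b) w)).
pose f b := X (grid t (N * m) (i * m + b)) w.
rewrite (eq_bigr (fun b => f b.+1 - f b)); last by move=> b _; rewrite /f addnS.
by rewrite telescope_sumr// /f /incr addn0 -mulSnr !grid_refine.
Qed.

(** The error of the midpoint rule on one coarse interval, split into an Ito part and a covariation
    part by writing midpoints as left values plus half increments on both grids. *)
Lemma midp_refine (x : R -> T -> R) t N m i w : (0 < m)%N ->
  \sum_(b < m) midp x t (N * m) (i * m + b) w * incr B t (N * m) (i * m + b) w -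
  midp x t N i w * incr B t N i w = nsum x t N m i w + 2^-1 * wsum x t N m i w.
Proof.
move=> m0; rewrite /nsum /wsum (mulrBr 2^-1) mulr_sumr addrA -big_split /=.
have -> : midp x t N i w * incr B t N i w = x (grid t N i) w * incr B t N i w +
    2^-1 * (incr x t N i w * incr B t N i w) by rewrite /midp [incr x _ _ _ _]/incr; field.
rewrite opprD addrA; congr (_ - _).
rewrite -(sum_incr_refine B t N i w m0) mulr_sumr -sumrB.
by apply: eq_bigr => b _; rewrite /midp [incr x _ _ _ _]/incr; field.
Qed.

Section key_estimates.
Context (t : R) (t0 : 0 < t).
Context (a x : R -> T -> R).
Hypotheses (aa : adapted F a) (ca : as_continuous P a).
Hypotheses (ax : adapted F x) (cx : as_continuous P x).

Let ma s : 0 <= s -> measurable_fun setT (a s).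
Proof. by move=> s0; exact: (measurable_wrt_fun hF s0 (aa s0)). Qed.

Let mx s : 0 <= s -> measurable_fun setT (x s).
Proof. by move=> s0; exact: (measurable_wrt_fun hF s0 (ax s0)). Qed.

(** [l %/ m] is the coarse interval of the fine index [l]; the Ito sum of this integrand over the
    block [i] is [a (t_i)] times [nsum]. *)
Let c N m l w := a (grid t N (l %/ m)) w *
  (x (grid t (N * m) l) w - x (grid t N (l %/ m)) w).

Let coarse N m l : (0 < m)%N -> grid t N (l %/ m) <= grid t (N * m) l.
Proof.
by move=> m0; rewrite -(grid_refine t N (l %/ m) m0) grid_le ?ltW// leq_trunc_div.
Qed.

Lemma whp_energy_modulus (del q : R) : 0 < del -> 0 < q ->
  exists N0, forall N m, (N0 <= N)%N -> (0 < N)%N -> (0 < m)%N ->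
  whp P q (fun w => energy (grid t (N * m)) (c N m) (N * m) w <= del).
Proof.
move=> del0 q0; have q2 : 0 < q / 2 by rewrite divr_gt0.
have [lam Hlam] := whp_bounded ma ca (ltW t0) q2.
have lam1 : 0 < lam%:R + 1 :> R by rewrite ltr_wpDl.
(* Bounds each integrand by [sqrt (del / t)], hence the energy by [del]. Only the coarse mesh must
   be small, so the threshold does not depend on [m]. *)
pose rho := Num.sqrt (del / t) / (lam%:R + 1).
have rho0 : 0 < rho by rewrite divr_gt0// sqrtr_gt0 divr_gt0.
have [n1 Hmod] := whp_modulus mx cx (ltW t0) rho0 q2.
exists (Num.truncn (t * n1.+1%:R)).+1 => N m NN N0 m0.
have N0' : 0 < N%:R :> R by rewrite ltr0n.
have tN : t / N%:R < n1.+1%:R^-1.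
  rewrite ltr_pdivrMr// mulrC ltr_pdivlMr ?ltr0n//.
  by apply: lt_le_trans (truncnS_gt _) _; rewrite ler_nat.
apply: whpS (whpI Hlam Hmod) => [|w [h1 h2]]; first by rewrite -splitr.
have NM0 : (0 < N * m)%N by rewrite muln_gt0 N0.
apply: (@le_trans _ _ (\sum_(l < N * m) del / t * (t / (N * m)%:R))); last first.
  rewrite sumr_const card_ord -[_ *+ _]mulr_natr.
  rewrite [leLHS](_ : _ = del)//; field.
  by rewrite !pnatr_eq0 -!lt0n m0 N0 gt_eqF.
apply: ler_sum => l _; rewrite gridSB// ler_wpM2r ?divr_ge0 ?(ltW t0)//.
have lN : (l %/ m < N)%N by rewrite ltn_divLR.
have g1 : 0 <= grid t N (l %/ m) <= t by apply: grid_itv; [exact: ltW | exact: ltnW].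
have g2 : 0 <= grid t (N * m) l <= t by apply: grid_itv; [exact: ltW | exact: ltnW].
have b1 := h1 _ g1.
have b2 : `|x (grid t (N * m) l) w - x (grid t N (l %/ m)) w| <= rho.
  apply: h2 => //; rewrite ger0_norm ?subr_ge0 ?coarse//.
  apply: le_lt_trans tN; rewrite -(gridSB t (l %/ m) N0) lerD2r.
  by rewrite -(grid_refine t N (l %/ m).+1 m0) grid_le ?ltW// ltnW// -ltn_divLR.
have -> : del / t = ((lam%:R + 1) * rho) ^+ 2.
  by rewrite /rho mulrCA mulfV ?gt_eqF// mulr1 sqr_sqrtr// ltW// divr_gt0.
rewrite -real_normK ?num_real// lerXn2r ?nnegrE ?mulr_ge0 ?(ltW lam1) ?(ltW rho0)//.
rewrite normrM ler_pM//; apply: le_trans b1 _; rewrite lerDl.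
by [].
Qed.

Let mc N m l : (0 < m)%N -> (l < N * m)%N ->
  measurable_wrt (F (grid t (N * m) l)) (c N m l).
Proof.
move=> m0 lN; have g0 := grid_ge0 (N * m) l (ltW t0).
have g1 := grid_ge0 N (l %/ m) (ltW t0).
have sg := filtration_sigma hF g0.
apply/(measurable_wrtP _ sg); apply: measurable_funM.
  apply/(measurable_wrtP _ sg).
  exact: (measurable_wrt_le hF g1 (coarse N l m0) (aa g1)).
apply: measurable_funB; apply/(measurable_wrtP _ sg); first exact: ax.
exact: (measurable_wrt_le hF g1 (coarse N l m0) (ax g1)).
Qed.

Let ito_nsum N m i w : (0 < m)%N ->
  ito_sum beta k (grid t (N * m)) (c N m) (i * m) m w =
  a (grid t N i) w * nsum x t N m i w.
Proof.
move=> m0; rewrite /nsum mulr_sumr; apply: eq_bigr => b _.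
by rewrite /c divnMDl// divn_small// addn0 mulrA.
Qed.

Lemma whp_nsum_squares (eps q : R) : 0 < eps -> 0 < q ->
  exists N0, forall N m, (N0 <= N)%N -> (0 < N)%N -> (0 < m)%N ->
  whp P q (fun w => \sum_(i < N) (a (grid t N i) w * nsum x t N m i w) ^+ 2 < eps).
Proof.
move=> eps0 q0; have q2 : 0 < q / 2 by rewrite divr_gt0.
pose del := q / 2 * eps / 8.
have del0 : 0 < del by rewrite divr_gt0// mulr_gt0.
have [N0 HN0] := whp_energy_modulus del0 q2.
exists N0 => N m NN N0' m0.
have g0 l : (l <= N * m)%N -> 0 <= grid t (N * m) l by rewrite grid_ge0// ltW.
have gl l : (l < N * m)%N -> grid t (N * m) l < grid t (N * m) l.+1.
  by rewrite grid_lt// muln_gt0 N0'.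
have := whp_ito_blocks hF hbeta k g0 gl (fun l => mc m0) del0 eps0 (HN0 N m NN N0' m0).
apply: whpS => [|w].
  by rewrite (_ : 8 * del / eps = q / 2) -?splitr// /del; field; rewrite gt_eqF.
by under eq_bigr do rewrite ito_nsum//.
Qed.

(** The integrand of [whp_nsum_squares], now taken as one block of length [N * m], so that the
    square of the whole sum is controlled. *)
Lemma whp_nsum_sum (e q : R) : 0 < e -> 0 < q ->
  exists N0, forall N m, (N0 <= N)%N -> (0 < N)%N -> (0 < m)%N ->
  whp P q (fun w => `|\sum_(i < N) a (grid t N i) w * nsum x t N m i w| < e).
Proof.
move=> e0 q0; have q2 : 0 < q / 2 by rewrite divr_gt0.
have eps0 : 0 < e ^+ 2 by rewrite exprn_gt0.
pose del := q / 2 * e ^+ 2 / 8.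
have del0 : 0 < del by rewrite divr_gt0// mulr_gt0.
have [N0 HN0] := whp_energy_modulus del0 q2.
exists N0 => N m NN N0' m0.
have g0 l : (l <= 1 * (N * m))%N -> 0 <= grid t (N * m) l by rewrite grid_ge0// ltW.
have gl l : (l < 1 * (N * m))%N -> grid t (N * m) l < grid t (N * m) l.+1.
  by rewrite grid_lt// muln_gt0 N0'.
have mc' l : (l < 1 * (N * m))%N -> measurable_wrt (F (grid t (N * m) l)) (c N m l).
  by rewrite mul1n; exact: mc.
have HE : whp P (q / 2) (fun w => energy (grid t (N * m)) (c N m) (1 * (N * m)) w <= del).
  by rewrite mul1n; exact: HN0.
have := whp_ito_blocks hF hbeta k g0 gl mc' del0 eps0 HE.
apply: whpS => [|w].
  by rewrite (_ : 8 * del / e ^+ 2 = q / 2) -?splitr// /del; field; rewrite gt_eqF.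
rewrite big_ord1 /ito_sum mul0n.
under eq_bigr do rewrite add0n.
rewrite (big_ord_block _ _ (fun l => c N m l w * (beta k (grid t (N * m) l.+1) w -
  beta k (grid t (N * m) l) w))).
rewrite (eq_bigr (fun i : 'I_N => a (grid t N i) w * nsum x t N m i w)); last first.
  by move=> i _; rewrite -ito_nsum.
move=> h; rewrite ltNge; apply/negP => h'; move: h; rewrite ltNge => /negP; apply.
by rewrite -[leRHS]real_normK ?num_real// lerXn2r ?nnegrE// ltW.
Qed.

End key_estimates.

End stratonovich.

(** * Stratonovich increments against the midpoint rule on a coarse grid *)

Section key_lemma.
Context (R : realType) (d : measure_display) (T : measurableType d).
Context (P : probability T R) (F : R -> set (set T)) (hF : filtration F).
Context (K : nat) (beta : 'I_K -> R -> T -> R) (hbeta : brownian_motion P F beta).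
Context (k : 'I_K).
Let B := beta k.
Context (t : R) (t0 : 0 < t).
Context (a x S : R -> T -> R).
Hypotheses (aa : adapted F a) (ca : as_continuous P a) (qa : qv_tight P a t).
Hypotheses (ax : adapted F x) (cx : as_continuous P x) (qx : qv_tight P x t).
Hypothesis hS : forall s, 0 < s -> is_stratonovich_integral P F x B s (S s).
Hypothesis S0 : forall w, S 0 w = 0.

Let ma s : 0 <= s -> measurable_fun setT (a s).
Proof. by move=> s0; exact: (measurable_wrt_fun hF s0 (aa s0)). Qed.

Let midp_le (C : R) N i w : (i < N)%N -> (forall s, 0 <= s <= t -> `|a s w| <= C) ->
  `|midp a t N i w| <= C.
Proof.
move=> iN H; rewrite /midp normrM (ger0_norm (_ : 0 <= 2^-1))//.
have g j : (j <= N)%N -> `|a (grid t N j) w| <= C.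
  by move=> jN; apply: H; apply: grid_itv => //; exact: ltW.
have := ler_normD (a (grid t N i.+1) w) (a (grid t N i) w).
by have := g _ iN; have := g _ (ltnW iN); lra.
Qed.

(** With [N] fixed, [S] at each of the finitely many coarse points is approximated by midpoint sums
    on the initial segment up to that point; subtracting neighbours gives the increments. *)
Let whp_fine_sum (N : nat) (e p : R) : (0 < N)%N -> 0 < e -> 0 < p ->
  exists m0, forall m, (m0 <= m)%N -> (0 < m)%N ->
  whp P p (fun w => `|\sum_(i < N) midp a t N i w *
    (S (grid t N i.+1) w - S (grid t N i) w -
     \sum_(b < m) midp x t (N * m) (i * m + b) w * incr B t (N * m) (i * m + b) w)| <= e).
Proof.
move=> N0 e0 p0; have p2 : 0 < p / 2 by rewrite divr_gt0.
have [lam Hlam] := whp_bounded ma ca (ltW t0) p2.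
have N0' : 0 < N%:R :> R by rewrite ltr0n.
have lam1 : 0 < lam%:R + 1 :> R by rewrite ltr_wpDl.
pose eta := e / (N%:R * ((lam%:R + 1) * 2)).
have eta0 : 0 < eta by rewrite divr_gt0// !mulr_gt0.
pose f m l w := midp x t (N * m) l w * incr B t (N * m) l w.
pose Q i m w := (0 < i)%N -> (0 < m)%N ->
  `|\sum_(l < i * m) f m l w - S (grid t N i) w| < eta.
have [m0 Hm0] : exists m0, forall m, (m0 <= m)%N ->
    whp P (p / 2) (fun w => forall i, (i < N.+1)%N -> Q i m w).
  apply: whp_eventually_forall p2 => i iN q q0.
  have [->|i0] := posnP i.
    by exists 0%N => m _; apply: whp_ae (ltW q0) _; apply: aeW.
  have gi0 : 0 < grid t N i by rewrite /grid divr_gt0// mulr_gt0// ltr0n.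
  have [n0 Hn0] := stratonovich_grid hF hbeta gi0 (hS gi0) eta0 q0.
  exists n0 => -[|m] nm; first by apply: whp_ae (ltW q0) _; apply: aeW => w _.
  have im : (0 < i * m.+1)%N by rewrite muln_gt0 i0.
  apply: whpS (Hn0 (i * m.+1)%N _ im) => // [w H _ _|]; last first.
    by apply: leq_trans nm _; rewrite leq_pmull.
  move: H; rewrite /f /midp /incr.
  by under eq_bigr do rewrite !grid_prefix//.
exists m0 => m mm m1; apply: whpS (whpI Hlam (Hm0 m mm)) => [|w [h1 h2]].
  by rewrite -splitr.
have E i : (i <= N)%N -> `|\sum_(l < i * m) f m l w - S (grid t N i) w| <= eta.
  case: i => [_|i iN]; first by rewrite mul0n big_ord0 grid0 S0 subrr normr0 ltW.
  exact: ltW (h2 i.+1 iN (ltn0Sn i) m1).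
apply: le_trans (ler_norm_sum _ _ _) _.
apply: (@le_trans _ _ (\sum_(i < N) (lam%:R + 1) * (2 * eta))).
  apply: ler_sum => i _; rewrite normrM ler_pM//.
    apply: le_trans (midp_le (ltn_ord i) h1) _; by rewrite lerDl.
  have := E _ (ltn_ord i); have := E _ (ltnW (ltn_ord i)).
  rewrite mulSnr big_split_ord /=.
  set u := \sum_(l < i * m) _; set v := \sum_(b < m) _ => h3 h4.
  rewrite [X in `|X|](_ : _ = (u - S (grid t N i) w) - (u + v - S (grid t N i.+1) w)).
    by apply: le_trans (ler_normB _ _) _; lra.
  by rewrite /v; ring.
rewrite sumr_const card_ord -[_ *+ _]mulr_natr /eta.
rewrite [leLHS](_ : _ = e)//; field.
by rewrite !gt_eqF.
Qed.

Let whp_incr_nsum (e p : R) : 0 < e -> 0 < p ->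
  exists N0, forall N m, (N0 <= N)%N -> (0 < N)%N -> (0 < m)%N ->
  whp P p (fun w => `|\sum_(i < N) incr a t N i w * nsum beta k x t N m i w| <= e).
Proof.
move=> e0 p0; have p2 : 0 < p / 2 by rewrite divr_gt0.
have [C HC] := qa p2.
(* The weight that balances the two squares: the quadratic variation of [a] and the squares of
   [nsum], kept below [e * kap], contribute at most [e / 2] each. *)
pose kap := e / (`|C| + 1).
have C1 : 0 < `|C| + 1 by rewrite ltr_wpDl.
have kap0 : 0 < kap by rewrite divr_gt0.
have eps0 : 0 < e * kap by rewrite mulr_gt0.
have a1 : adapted F (fun _ _ => 1 : R).
  move=> s s0; apply/(measurable_wrtP _ (filtration_sigma hF s0)).
  exact: measurable_cst.
have c1 : as_continuous P (fun _ _ => 1 : R).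
  by apply: aeW => w; apply: continuous_subspaceT => s; exact: cst_continuous.
have [N0 HN0] := whp_nsum_squares hF hbeta k t0 a1 c1 ax cx eps0 p2.
exists N0 => N m NN N0' m0.
apply: whpS (whpI (HC N N0') (HN0 N m NN N0' m0)) => [|w [h1 h2]].
  by rewrite -splitr.
apply: le_trans (ler_norm_sum _ _ _) _.
(* [2 |u v| <= kap u ^+ 2 + v ^+ 2 / kap] *)
apply: (@le_trans _ _ (\sum_(i < N) (2^-1 * kap * incr a t N i w ^+ 2 +
  (2 * kap)^-1 * (1 * nsum beta k x t N m i w) ^+ 2))).
  apply: ler_sum => i _; rewrite normrM mul1r.
  rewrite -[X in _ * X + _]real_normK ?num_real// -[X in _ + _ * X]real_normK ?num_real//.
  set u := `|_|; set v := `|_|.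
  rewrite -subr_ge0 (_ : _ - _ = (2 * kap)^-1 * (kap * u - v) ^+ 2).
    by rewrite mulr_ge0 ?sqr_ge0// invr_ge0 mulr_ge0// ltW.
  by field; rewrite gt_eqF.
rewrite big_split /= -!mulr_sumr.
have k1 : kap * `|C| <= e.
  by rewrite /kap mulrAC ler_pdivrMr//; apply: (ler_wpM2l (ltW e0)); rewrite lerDl.
have k2 : kap * qv a t N w <= e.
  by apply: le_trans k1; rewrite ler_wpM2l ?(ltW kap0)// (le_trans h1)// ler_norm.
set v := \sum_(i < N) (_ * nsum _ _ _ _ _ _ _ _) ^+ 2 in h2 *.
have k3 : (2 * kap)^-1 * v <= e / 2.
  rewrite ler_pdivrMl ?mulr_gt0//; apply: le_trans (ltW h2) _.
  by rewrite [leRHS](_ : _ = e * kap)//; field.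
by rewrite -mulrA; move: k2; rewrite /qv; lra.
Qed.

Let covariation_fun : exists C : R -> T -> R,
  forall s : R, 0 < s -> is_covariation P x B s (C s).
Proof.
have H (s : R) : exists C : T -> R, 0 < s -> is_covariation P x B s C.
  have [s0|s0] := ltP 0 s.
    by have [_ [_ [C [_ HC _]]]] := hS s0; exists C.
  by exists (fun=> 0).
by have [C HC] := choice H; exists C.
Qed.

Let covs n g w := \sum_(l < g) incr x t n l w * incr B t n l w.

(** Three nested grids: [N0] blocks of [M] intervals, each refined by [m]. Over a block, [wsum] adds
    up to the difference of two discrete covariations with the same limit. *)
Let wsum_blocks N0 M m g w : (0 < m)%N ->
  \sum_(r < M) wsum beta k x t (N0 * M) m (g * M + r) w =
  covs (N0 * M * m) (g.+1 * (M * m)) w - covs (N0 * M * m) (g * (M * m)) w -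
  (covs (N0 * M) (g.+1 * M) w - covs (N0 * M) (g * M) w).
Proof.
move=> m0; rewrite /wsum sumrB /covs; congr (_ - _).
  rewrite mulSnr [X in _ = X - _]big_split_ord /= addrAC subrr add0r.
  rewrite (big_ord_block M m (fun l => incr x t (N0 * M * m) (g * (M * m) + l) w *
    incr B t (N0 * M * m) (g * (M * m) + l) w)).
  by apply: eq_bigr => r _; apply: eq_bigr => b _; rewrite mulnDl addnA mulnA.
by rewrite mulSnr [X in _ = X - _]big_split_ord /= addrAC subrr add0r.
Qed.

Let whp_wsum (e p : R) : 0 < e -> 0 < p ->
  exists2 N1, (0 < N1)%N & forall N m, (N1 %| N)%N -> (0 < N)%N -> (0 < m)%N ->
  whp P p (fun w => `|\sum_(i < N) midp a t N i w * wsum beta k x t N m i w| <= e).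
Proof.
move=> e0 p0; have p8 : 0 < p / 8 by rewrite divr_gt0.
have e2 : 0 < e / 2 by rewrite divr_gt0.
have [lam Hlam] := whp_bounded ma ca (ltW t0) p8.
have lam1 : 0 < lam%:R + 1 :> R by rewrite ltr_wpDl.
have [Cx HCx] := qx p8.
have [Cb HCb] := qv_tight_brownian hF hbeta k t0 p8.
(* Bounds the sum of the absolute values of [wsum]: half the quadratic variations of [x] and [B],
   once on the fine and once on the coarse grid. *)
pose C := `|Cx| + `|Cb| + 1.
have C0 : 0 < C by rewrite ltr_wpDl// addr_ge0.
pose rho := e / 2 / C.
have rho0 : 0 < rho by rewrite divr_gt0.
have [n1 Hmod] := whp_modulus ma ca (ltW t0) rho0 p8.
pose N0 := (Num.truncn (t * n1.+1%:R)).+1.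
have N0' : 0 < N0%:R :> R by rewrite ltr0n.
have tN : t / N0%:R < n1.+1%:R^-1.
  by rewrite ltr_pdivrMr// mulrC ltr_pdivlMr ?ltr0n// truncnS_gt.
pose eta := e / 2 / (N0%:R * ((lam%:R + 1) * 4)).
have eta0 : 0 < eta by rewrite divr_gt0// !mulr_gt0.
have [D HD] := covariation_fun.
pose Q g M w := (0 < g)%N -> (0 < M)%N ->
  `|covs (N0 * M) (g * M) w - D (grid t N0 g) w| < eta.
have [M0 HM0] : exists M0, forall M, (M0 <= M)%N ->
    whp P (p / 8) (fun w => forall g, (g < N0.+1)%N -> Q g M w).
  apply: whp_eventually_forall p8 => g gN q q0.
  have [->|g0] := posnP g.
    by exists 0%N => m _; apply: whp_ae (ltW q0) _; apply: aeW.
  have gi0 : 0 < grid t N0 g by rewrite /grid divr_gt0// mulr_gt0// ltr0n.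
  have [n0 Hn0] := covariation_grid gi0 (HD _ gi0) eta0 q0.
  exists n0 => -[|M] nM; first by apply: whp_ae (ltW q0) _; apply: aeW => w _.
  have gM : (0 < g * M.+1)%N by rewrite muln_gt0 g0.
  apply: whpS (Hn0 (g * M.+1)%N _ gM) => // [w H _ _|]; last first.
    by apply: leq_trans nM _; rewrite leq_pmull.
  move: H; rewrite /covs /incr.
  by under eq_bigr do rewrite !grid_prefix//.
exists (N0 * M0.+1)%N => // N m /dvdnP[j ->] jN m0.
have j0 : (0 < j)%N by move: jN; rewrite muln_gt0 => /andP[].
rewrite mulnC -mulnA in jN *; set M := (M0.+1 * j)%N in jN *.
have M1 : (0 < M)%N by rewrite muln_gt0.
have MM : (M0 <= M)%N by rewrite (leq_trans (leqnSn _))// leq_pmulr.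
have MMm : (M0 <= M * m)%N by rewrite (leq_trans MM)// leq_pmulr.
have Mm1 : (0 < M * m)%N by rewrite muln_gt0 M1.
have NMm : (0 < N0 * M * m)%N by rewrite muln_gt0 jN.
have := whpI (whpI (whpI Hlam Hmod) (whpI (HM0 M MM) (HM0 _ MMm)))
  (whpI (whpI (HCx _ jN) (HCx _ NMm)) (whpI (HCb _ jN) (HCb _ NMm))).
apply: whpS => [|w [[[hl hm] [hc hf]] [[x1 x2] [b1 b2]]]]; first by lra.
(* [D] is a covariation at positive times only; at [g = 0] the empty sum dictates the value 0. *)
pose D0 g : R := if g is 0%N then 0 else D (grid t N0 g) w.
have covE M' : (0 < M')%N -> (forall g, (g < N0.+1)%N -> Q g M' w) ->
    forall g, (g < N0)%N ->
    `|covs (N0 * M') (g.+1 * M') w - covs (N0 * M') (g * M') w -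
      (D0 g.+1 - D0 g)| <= 2 * eta.
  move=> M'0 HQ g gN.
  have h1 : `|covs (N0 * M') (g.+1 * M') w - D0 g.+1| < eta := HQ g.+1 gN (ltn0Sn g) M'0.
  have h2 : `|covs (N0 * M') (g * M') w - D0 g| <= eta.
    case: (g) gN => [_|g' gN']; first by rewrite /covs mul0n big_ord0 subrr normr0 ltW.
    exact: ltW (HQ g'.+1 (ltnW gN') (ltn0Sn g') M'0).
  move: h1 h2; set u := covs _ _ _; set v := covs _ _ _; set y := D0 g.+1; set z := D0 g.
  move=> h1 h2; rewrite (_ : _ - _ = (u - y) - (v - z)); last by ring.
  by apply: le_trans (ler_normB _ _) _; lra.
pose W i := wsum beta k x t (N0 * M) m i w.
rewrite (big_ord_block N0 M (fun i => midp a t (N0 * M) i w * W i)).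
have sumW g : (g < N0)%N -> `|\sum_(r < M) W (g * M + r)%N| <= 4 * eta.
  move=> gN; rewrite /W wsum_blocks//.
  have h1 := covE M M1 hc g gN; have := covE _ Mm1 hf g gN; rewrite !mulnA => h2.
  move: h1 h2; rewrite -!mulnA; set u := covs _ _ _ - _; set v := covs _ _ _ - _.
  set y := D0 _ - _ => h1 h2.
  rewrite (_ : v - u = (v - y) - (u - y)); last by ring.
  by apply: le_trans (ler_normB _ _) _; lra.
have absW : \sum_(i < N0 * M) `|W i| <= C.
  apply: (@le_trans _ _ (\sum_(i < N0 * M) (\sum_(b < m)
    (2^-1 * incr x t (N0 * M * m) (i * m + b) w ^+ 2 +
     2^-1 * incr B t (N0 * M * m) (i * m + b) w ^+ 2) +
    (2^-1 * incr x t (N0 * M) i w ^+ 2 + 2^-1 * incr B t (N0 * M) i w ^+ 2)))).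
    have amgm (u v : R) : `|u * v| <= 2^-1 * u ^+ 2 + 2^-1 * v ^+ 2.
      have := sqr_ge0 (u - v); have := sqr_ge0 (u + v).
      by rewrite ler_norml => ? ?; apply/andP; split; nra.
    apply: ler_sum => i _; apply: le_trans (ler_normB _ _) _; apply: lerD => //.
    by apply: le_trans (ler_norm_sum _ _ _) _; apply: ler_sum.
  rewrite big_split /= -(big_ord_block (N0 * M) m (fun l =>
    2^-1 * incr x t (N0 * M * m) l w ^+ 2 + 2^-1 * incr B t (N0 * M * m) l w ^+ 2)).
  rewrite !big_split /= -!mulr_sumr.
  move: x1 x2 b1 b2; rewrite /qv -/(incr _ _ _ _) /C.
  have := ler_norm Cx; have := ler_norm Cb.
  set s1 := \sum_(i < _) _; set s2 := \sum_(i < _) _.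
  by move: (\sum_(i < _) _ ) => s3; lra.
rewrite (_ : \sum_(i < N0) _ =
  \sum_(g < N0) a (grid t N0 g) w * (\sum_(r < M) W (g * M + r)%N) +
  \sum_(g < N0) \sum_(r < M) (midp a t (N0 * M) (g * M + r) w - a (grid t N0 g) w) *
     W (g * M + r)%N); last first.
  rewrite -big_split; apply: eq_bigr => g _ /=.
  by rewrite mulr_sumr -big_split; apply: eq_bigr => r _ /=; ring.
have gN g : (g <= N0)%N -> 0 <= grid t N0 g <= t.
  by move=> gN; apply: grid_itv => //; exact: ltW.
have t1 : `|\sum_(g < N0) a (grid t N0 g) w * (\sum_(r < M) W (g * M + r)%N)| <= e / 2.
  apply: le_trans (ler_norm_sum _ _ _) _.
  apply: (@le_trans _ _ (\sum_(g < N0) (lam%:R + 1) * (4 * eta))).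
    apply: ler_sum => g _; rewrite normrM ler_pM// ?sumW//.
    by apply: le_trans (hl _ (gN _ (ltnW (ltn_ord g)))) _; rewrite lerDl.
  rewrite sumr_const card_ord -[_ *+ _]mulr_natr /eta.
  by rewrite [leLHS](_ : _ = e / 2)//; field; rewrite !gt_eqF.
have t2 : `|\sum_(g < N0) \sum_(r < M)
    (midp a t (N0 * M) (g * M + r) w - a (grid t N0 g) w) * W (g * M + r)%N| <= e / 2.
  apply: (@le_trans _ _ (\sum_(g < N0) \sum_(r < M) rho * `|W (g * M + r)%N|)).
    apply: le_trans (ler_norm_sum _ _ _) _; apply: ler_sum => g _.
    apply: le_trans (ler_norm_sum _ _ _) _; apply: ler_sum => r _.
    rewrite normrM ler_wpM2r//.
    have near i : (g * M <= i)%N -> (i <= g.+1 * M)%N ->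
        `|a (grid t (N0 * M) i) w - a (grid t N0 g) w| <= rho.
      move=> gj jg; have gj' : grid t N0 g <= grid t (N0 * M) i.
        by rewrite -(grid_refine t N0 g M1) grid_le ?(ltW t0).
      have jg' : grid t (N0 * M) i <= grid t N0 g.+1.
        by rewrite -(grid_refine t N0 g.+1 M1) grid_le ?(ltW t0).
      apply: hm; first exact: gN (ltnW (ltn_ord g)).
        have /andP[h1 _] := gN g (ltnW (ltn_ord g)).
        have /andP[_ h2] := gN g.+1 (ltn_ord g).
        by rewrite (le_trans h1 gj') (le_trans jg' h2).
      rewrite ger0_norm ?subr_ge0//; apply: le_lt_trans tN.
      by rewrite -(gridSB t g (ltn0Sn _)) lerD2r.
    have n1' : (g * M <= g * M + r)%N by rewrite leq_addr.
    have n2' : ((g * M + r).+1 <= g.+1 * M)%N by rewrite mulSnr ltn_add2l.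
    have := near _ n1' (ltnW n2'); have := near _ (leqW n1') n2'.
    rewrite /midp; set u := a _ w; set v := a _ w; set z := a _ w => h1 h2.
    rewrite (_ : _ - v = ((u - v) + (z - v)) / 2); last by field.
    rewrite normrM (ger0_norm (_ : 0 <= 2^-1))//.
    by have := ler_normD (u - v) (z - v); lra.
  rewrite -(big_ord_block N0 M (fun i => rho * `|W i|)) -mulr_sumr.
  apply: le_trans (ler_wpM2l (ltW rho0) absW) _.
  by rewrite /rho divfK// gt_eqF.
by apply: le_trans (ler_normD _ _) _; lra.
Qed.

(** The weight [midp a] looks ahead, so its product with [nsum] is split as the left value of [a],
    which is adapted, plus half an increment of [a]. The refinement [m] is chosen after [N] and
    disappears from the conclusion. *)
Lemma whp_stratonovich_midpoint (e p : R) : 0 < e -> 0 < p ->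
  exists2 N1, (0 < N1)%N & forall N, (N1 %| N)%N -> (0 < N)%N ->
  whp P p (fun w => `|\sum_(i < N) midp a t N i w *
    (S (grid t N i.+1) w - S (grid t N i) w - midp x t N i w * incr B t N i w)| <= e).
Proof.
move=> e0 p0; have p4 : 0 < p / 4 by rewrite divr_gt0.
have e4 : 0 < e / 4 by rewrite divr_gt0.
have [N1 H1] := whp_nsum_sum hF hbeta k t0 aa ca ax cx e4 p4.
have [N2 H2] := whp_incr_nsum e4 p4.
have [N3 N30 H3] := whp_wsum e4 p4.
(* A positive multiple of this number is at least [N1] and [N2] and is divisible by [N3]. *)
exists (N1.+1 * N2.+1 * N3)%N => [|N dN N0]; first by rewrite muln_gt0.
have d1 : (N1 <= N)%N.
  apply: leq_trans (leqnSn N1) (dvdn_leq N0 (dvdn_trans _ dN)).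
  by rewrite -mulnA dvdn_mulr.
have d2 : (N2 <= N)%N.
  apply: leq_trans (leqnSn N2) (dvdn_leq N0 (dvdn_trans _ dN)).
  by rewrite -mulnA dvdn_mull// dvdn_mulr.
have d3 : (N3 %| N)%N by apply: dvdn_trans dN; rewrite dvdn_mull.
have [m0 H0] := whp_fine_sum N0 e4 p4.
have := whpI (whpI (H0 m0.+1 (leqnSn _) isT) (H1 N m0.+1 d1 N0 isT))
  (whpI (H2 N m0.+1 d2 N0 isT) (H3 N m0.+1 d3 N0 isT)).
apply: whpS => [|w]; first by lra.
move: (m0.+1) (ltn0Sn m0) => m mpos [[h0 h1] [h2 h3]].
rewrite (eq_bigr (fun i : 'I_N => midp a t N i w *
    (S (grid t N i.+1) w - S (grid t N i) w -
     \sum_(b < m) midp x t (N * m) (i * m + b) w * incr B t (N * m) (i * m + b) w) +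
  (a (grid t N i) w * nsum beta k x t N m i w +
   2^-1 * (incr a t N i w * nsum beta k x t N m i w) +
   2^-1 * (midp a t N i w * wsum beta k x t N m i w)))); last first.
  move=> i _; have := midp_refine beta k x t N i w mpos.
  set u := \sum_(b < m) _; set v := midp x _ _ _ _ * _.
  move=> E; rewrite (_ : midp a t N i w * _ = midp a t N i w *
    (S (grid t N i.+1) w - S (grid t N i) w - u) + midp a t N i w * (u - v)); last by ring.
  rewrite E; congr (_ + _).
  have -> : midp a t N i w = a (grid t N i) w + 2^-1 * incr a t N i w.
    by rewrite /midp /incr; field.
  ring.
rewrite !big_split /= -!mulr_sumr.
move: h0 h1 h2 h3; set u0 := \sum_(i < N) _; set u1 := \sum_(i < N) _.
set u2 := \sum_(i < N) _; set u3 := \sum_(i < N) _ => h0 h1 h2 h3.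
apply: le_trans (ler_normD _ _) _.
have := ler_normD (u1 + 2^-1 * u2) (2^-1 * u3).
have := ler_normD u1 (2^-1 * u2).
rewrite !normrM (ger0_norm (_ : 0 <= 2^-1))//; lra.
Qed.

End key_lemma.

(** * The drift *)

Section drift.
Context (R : realType) (J : finType) (u f : J -> R -> R).
Local Notation mu := (@lebesgue_measure R).
Hypothesis cf : forall j, {within `[0, +oo[, continuous (f j)}.
Hypothesis uf0 : forall r, 0 <= r -> \sum_j u j r * f j r = 0.

Lemma integrable_within_continuous (g : R -> R) (a b : R) :
  {within `[0, +oo[, continuous g} -> 0 <= a -> mu.-integrable `[a, b] (EFin \o g).
Proof.
move=> cg a0; apply: continuous_compact_integrable; first exact: segment_compact.
apply: continuous_subspaceW cg => r /=; rewrite !in_itv /= andbT => /andP[ar _].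
exact: le_trans ar.
Qed.

Let If a b j : 0 <= a -> mu.-integrable `]a, b] (EFin \o f j).
Proof.
move=> a0; apply: (integrableS _ _ _ (@integrable_within_continuous _ a b (@cf j) a0)) => //.
by apply: subset_itvr; rewrite bnd_simp.
Qed.

Let Rintegral_lin (a b : R) (m : J -> R) (s : seq J) : 0 <= a ->
  mu.-integrable `]a, b] (EFin \o (fun r => \sum_(j <- s) m j * f j r)) /\
  \sum_(j <- s) m j * \int[mu]_(r in `]a, b]) f j r =
  \int[mu]_(r in `]a, b]) \sum_(j <- s) m j * f j r.
Proof.
move=> a0; elim: s => [|j s [IH1 IH2]].
  split.
    by apply: eq_integrable (integrable0 _ _) => // r _ /=; rewrite big_nil.
  rewrite big_nil; under eq_Rintegral do rewrite big_nil.
  by rewrite Rintegral_cst// mul0r.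
have i1 : mu.-integrable `]a, b] (EFin \o (fun r => m j * f j r)).
  rewrite (_ : EFin \o _ = (fun r => (m j)%:E * (f j r)%:E)%E)//.
  by apply: integrableZl => //; exact: If.
split.
  rewrite (_ : EFin \o _ = (fun r => (m j * f j r)%:E + (\sum_(j <- s) m j * f j r)%:E)%E).
    exact: integrableD.
  by apply/funext => r; rewrite /= big_cons EFinD.
rewrite big_cons IH2.
under [RHS]eq_Rintegral do rewrite big_cons.
by rewrite RintegralD// RintegralZl//; exact: If.
Qed.

Lemma drift_midpoint_le (t rho lam : R) (N : nat) : 0 < t -> (0 < N)%N ->
  0 <= lam -> 0 <= rho ->
  (forall j r, 0 <= r <= t -> `|f j r| <= lam) ->
  (forall j r r', 0 <= r <= t -> 0 <= r' <= t -> `|r' - r| <= t / N%:R ->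
     `|u j r' - u j r| <= rho) ->
  `|\sum_(i < N) \sum_j (u j (grid t N i.+1) + u j (grid t N i)) / 2 *
     (\int[mu]_(r in `[0, grid t N i.+1]) f j r -
      \int[mu]_(r in `[0, grid t N i]) f j r)| <= #|J|%:R * (rho * lam) * t.
Proof.
move=> t0 N0 lam0 rho0 flam umod.
pose C := #|J|%:R * (rho * lam).
have C0 : 0 <= C by rewrite !mulr_ge0.
apply: (@le_trans _ _ (\sum_(i < N) C * (t / N%:R))); last first.
  rewrite sumr_const card_ord -[_ *+ _]mulr_natr -mulrA divfK// pnatr_eq0 -lt0n.
  by [].
apply: le_trans (ler_norm_sum _ _ _) _; apply: ler_sum => i _.
set a := grid t N i; set b := grid t N i.+1.
have ab : a <= b by rewrite /a /b grid_le// ltW.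
have a0 : 0 <= a by rewrite grid_ge0// ltW.
have bt : b <= t by have /andP[] := grid_itv (ltW t0) (ltn_ord i).
have bt1 : 0 <= b <= t by rewrite bt (le_trans a0).
have at1 : 0 <= a <= t by rewrite a0 (le_trans ab).
have ba : b - a = t / N%:R by rewrite gridSB.
pose m j := (u j b + u j a) / 2.
rewrite (eq_bigr (fun j => m j * \int[mu]_(r in `]a, b]) f j r)); last first.
  move=> j _; congr (_ * _); apply: Rintegral_itvB.
  - exact: integrable_within_continuous.
  - by rewrite bnd_simp.
  - by rewrite bnd_simp.
have [ig ->] := Rintegral_lin b m (index_enum J) a0.
apply: le_trans (le_normr_Rintegral _ ig) _ => //.
rewrite -ba.
have -> : C * (b - a) = \int[mu]_(r in `]a, b]) (cst C r).
  rewrite Rintegral_cst//= lebesgue_measure_itv/= lte_fin.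
  by move: ab; rewrite le_eqVlt => /predU1P[->|->]; rewrite ?ltxx ?subrr.
apply: le_Rintegral => //.
- by have := integrable_norm ig; exact: eq_integrable.
- have cC : {within `[0, +oo[, continuous (cst C : R -> R)}.
    by apply: continuous_subspaceT => r; exact: cst_continuous.
  apply: (integrableS _ _ _ (@integrable_within_continuous _ a b cC a0)) => //.
  by apply: subset_itvr; rewrite bnd_simp.
move=> r /=; rewrite in_itv /= => /andP[ar rb].
have r0 : 0 <= r := le_trans a0 (ltW ar).
have rt : 0 <= r <= t by rewrite r0 (le_trans rb).
(* Orthogonality at the same instant [r] replaces the endpoint mean by its deviation from [u j r],
   which is at most [rho]. *)
have -> : \sum_j m j * f j r = \sum_j (m j - u j r) * f j r.
  by under [RHS]eq_bigr do rewrite mulrBl; rewrite sumrB uf0// subr0.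
apply: le_trans (ler_norm_sum _ _ _) _.
apply: (@le_trans _ _ (\sum_(j : J) rho * lam)); last first.
  by rewrite sumr_const -[_ *+ _]mulr_natl.
apply: ler_sum => j _; rewrite normrM ler_pM// ?flam//.
have h1 : `|u j b - u j r| <= rho by apply: umod => //; rewrite ger0_norm; lra.
have h2 : `|u j a - u j r| <= rho.
  by apply: umod => //; rewrite distrC ger0_norm; lra.
rewrite (_ : m j - u j r = ((u j b - u j r) + (u j a - u j r)) / 2); last first.
  by rewrite /m; field.
rewrite normrM (ger0_norm (_ : 0 <= 2^-1))//.
by have := ler_normD (u j b - u j r) (u j a - u j r); lra.
Qed.

End drift.

(** * The discretized Schrodinger equation *)

Section complex_parts.
Context (R : realType).
Local Open Scope complex_scope.

(** The boolean turns the real coordinates of [U] into one family indexed by [bool * 'I_M];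
    multiplication by ['i] flips it, up to a sign. *)
Definition part (b : bool) (z : R[i]) : R := if b then complex.Im z else complex.Re z.

Lemma partD b (x y : R[i]) : part b (x + y) = part b x + part b y.
Proof. by case: b; case: x; case: y. Qed.

Lemma part_sum b (I : Type) (r : seq I) (f : I -> R[i]) :
  part b (\sum_(i <- r) f i) = \sum_(i <- r) part b (f i).
Proof.
by elim: r => [|i r IH]; [rewrite !big_nil; case: b | rewrite !big_cons partD IH].
Qed.

Lemma part_realM b (a : R) (x : R[i]) : part b (a%:C * x) = a * part b x.
Proof. by case: b; case: x => u v /=; ring. Qed.

Lemma part_imM b (x : R[i]) : part b ('i * x) = if b then complex.Re x else - complex.Im x.
Proof.
by rewrite mulrC; case: b; rewrite /part ?ImiRe ?ReiNIm.
Qed.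

End complex_parts.

Section nls.
Context (R : realType) (M K : nat) (lambda : R) (eta : nat -> R).
Local Open Scope complex_scope.
Implicit Type U : 'cV[R[i]]_M.

(* The drift is [i H U] with [H] real symmetric, so its real and imaginary
   parts are [- H Im U] and [H Re U]. *)
Definition hamiltonian (U : 'cV[R[i]]_M) (b : bool) (j : 'I_M) : R :=
  (step R M ^+ 2)^-1 * (\sum_m A_mx R M j m * part b (U m 0)) +
  lambda * ((complex.Re (U j 0) ^+ 2 + complex.Im (U j 0) ^+ 2) * part b (U j 0)).

Lemma part_drift U b j : part b (nls_drift lambda U j 0) =
  if b then hamiltonian U false j else - hamiltonian U true j.
Proof.
rewrite /nls_drift !mxE part_imM.
have H b' : part b' (((step R M) ^+ 2)^-1%:C * (\sum_j0 mxC (A_mx R M) j j0 * U j0 0) +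
   lambda%:C * (\sum_j0 F_mx U j j0 * U j0 0)) = hamiltonian U b' j.
  rewrite partD !part_realM /hamiltonian part_sum; congr (_ * _ + _ * _).
    by apply: eq_bigr => m _; rewrite mxE part_realM.
  rewrite (bigD1 j)//= big1 ?addr0 => [|m mj]; last first.
    by rewrite !mxE eq_sym (negbTE mj) mul0r.
  by rewrite !mxE eqxx mulr1n -add_Re2_Im2 part_realM.
by case: b; [exact: (H false) | rewrite -(H true)].
Qed.

(** The cubic terms cancel node by node between real and imaginary parts; the linear terms cancel
    after exchanging the two sums, by symmetry of [A_mx]. *)
Lemma sum_part_drift U : \sum_(c : bool * 'I_M) part c.1 (U c.2 0) *
  part c.1 (nls_drift lambda U c.2 0) = 0.
Proof.
rewrite -(pair_bigA _ (fun b j => part b (U j 0) * part b (nls_drift lambda U j 0))) /=.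
rewrite big_bool -big_split.
pose h := (step R M ^+ 2)^-1.
rewrite (eq_bigr (fun j => h * (\sum_m A_mx R M j m * (complex.Im (U j 0) * complex.Re (U m 0))) -
   h * (\sum_m A_mx R M j m * (complex.Re (U j 0) * complex.Im (U m 0))))); last first.
  move=> j _; cbv beta; rewrite !part_drift /hamiltonian /= -/h.
  have E (x : R) (f : 'I_M -> R) : \sum_m A_mx R M j m * (x * f m) =
      x * \sum_m A_mx R M j m * f m.
    by rewrite mulr_sumr; apply: eq_bigr => m _; ring.
  by rewrite !E; ring.
rewrite sumrB -!mulr_sumr [X in _ - _ * X]exchange_big /=.
apply/eqP; rewrite subr_eq0; apply/eqP; congr (_ * _).
apply: eq_bigr => j _; apply: eq_bigr => m _; rewrite !mxE [RHS]mulrC [complex.Re _ * _]mulrC [RHS]mulrC.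
by rewrite eq_sym orbC.
Qed.

Definition noise_coef (j : 'I_M) (k : 'I_K) : R := (E_mx R M K *m Lambda_mx K eta) j k.

Lemma part_noise U b j k : part b (nls_noise K eta U j k) =
  noise_coef j k * (if b then complex.Re (U j 0) else - complex.Im (U j 0)).
Proof.
rewrite /nls_noise /Z_mx mxE part_imM.
have -> : (diag_mx U^T *m mxC (E_mx R M K *m Lambda_mx K eta)) j k =
    (noise_coef j k)%:C * U j 0.
  by rewrite mul_diag_mx mxE mulrC; congr (_ * _); rewrite mxE.
have H b' := part_realM b' (noise_coef j k) (U j 0).
by case: b; [exact: (H false) | rewrite mulrN -(H true)].
Qed.

(** The index 0 stands for the first mode, and [sin (pi x)] is positive at the nodes, which lie
    strictly between 0 and 1. *)
Lemma noise_coef_neq0 (j : 'I_M) (k : 'I_K) :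
  (forall i, (1 <= i)%N -> 0 < eta i) -> k = 0%N :> nat -> noise_coef j k != 0.
Proof.
move=> eta0 k0; rewrite /noise_coef mul_mx_diag !mxE k0 gt_eqF//.
apply: mulr_gt0; last by rewrite sqrtr_gt0 eta0.
rewrite /e_ mulr_gt0 ?sqrtr_gt0// sin_gt0_pi// mul1r /node /step.
have M0 : 0 < M.+1%:R :> R by rewrite ltr0n.
rewrite !mulr_gt0 ?pi_gt0 ?invr_gt0 ?ltr0n//=.
rewrite -[ltRHS]mulr1 ltr_pM2l ?pi_gt0// ltr_pdivrMr// mul1r ltr_nat ltnS.
exact: ltn_ord.
Qed.

Lemma charge_normE U : charge_norm U ^+ 2 = \sum_(c : bool * 'I_M) part c.1 (U c.2 0) ^+ 2.
Proof.
rewrite /charge_norm sqr_sqrtr; last first.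
  by apply: sumr_ge0 => m _; rewrite addr_ge0// sqr_ge0.
rewrite -(pair_bigA _ (fun b j => part b (U j 0) ^+ 2)) big_bool -big_split /=.
by apply: eq_bigr => m _; rewrite addrC !real_normK ?num_real.
Qed.

End nls.

Lemma whp_eventually_fin (R : realType) d (T : measurableType d) (P : probability T R)
    (J : finType) (Q : J -> nat -> T -> Prop) :
  (forall c (p : R), 0 < p -> exists m0, forall m, (m0 <= m)%N -> whp P p (Q c m)) ->
  forall p : R, 0 < p -> exists m0, forall m, (m0 <= m)%N ->
    whp P p (fun w => forall c, Q c m w).
Proof.
move=> H p p0.
have H' i : (i < #|J|)%N -> forall q : R, 0 < q -> exists m0, forall m, (m0 <= m)%N ->
    whp P q (fun w => forall c, enum_rank c = i :> nat -> Q c m w).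
  move=> iJ q q0; have [m0 Hm0] := H (enum_val (Ordinal iJ)) q q0.
  exists m0 => m mm; apply: whpS (Hm0 m mm) => // w h c ci.
  rewrite (_ : c = enum_val (Ordinal iJ))//.
  by apply: enum_rank_inj; rewrite enum_valK; apply: val_inj.
have [m0 Hm0] := whp_eventually_forall H' p0.
exists m0 => m mm; apply: whpS (Hm0 m mm) => // w h c.
exact: (h (enum_rank c) (ltn_ord _) c).
Qed.

(** * Conservation of the charge along a solution *)

Section charge.
Context (R : realType) (d : measure_display) (T : measurableType d).
Context (P : probability T R) (F : R -> set (set T)) (hF : filtration F).
Context (M K : nat) (hMK : (M <= K)%N).
Context (beta : 'I_K -> R -> T -> R) (hbeta : brownian_motion P F beta).
Context (eta : nat -> R) (heta_pos : forall k, (1 <= k)%N -> 0 < eta k).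
Context (lambda : R) (U0 : 'cV[R[i]]_M) (U : R -> T -> 'cV[R[i]]_M).
Hypothesis hU : stratonovich_solution P F (nls_drift lambda) (nls_noise K eta) beta U0 U.

Let C := (bool * 'I_M)%type.
Let v (c : C) (t : R) (w : T) : R := part c.1 (U t w c.2 0).
Let f (c : C) (t : R) (w : T) : R := part c.1 (nls_drift lambda (U t w) c.2 0).
Let X (c : C) (k : 'I_K) (t : R) (w : T) : R := part c.1 (nls_noise K eta (U t w) c.2 k).

Let av c : adapted F (v c).
Proof. by case: hU => + _ _ _ => /(_ c.2)[h1 h2]; case: c h1 h2 => [[] j]. Qed.

Let cv c : as_continuous P (v c).
Proof. by case: hU => _ + _ _ => /(_ c.2)[h1 h2]; case: c h1 h2 => [[] j]. Qed.

Let mv c t : 0 <= t -> measurable_fun setT (v c t).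
Proof. by move=> t0; exact: (measurable_wrt_fun hF t0 (av c t0)). Qed.

Let fE c t w : f c t w = (if c.1 then 1 else -1) *
  ((step R M ^+ 2)^-1 * (\sum_m A_mx R M c.2 m * v (~~ c.1, m) t w) +
   lambda * ((v (false, c.2) t w ^+ 2 + v (true, c.2) t w ^+ 2) * v (~~ c.1, c.2) t w)).
Proof.
rewrite /f part_drift /hamiltonian; case: c => [[] j] /=.
  by rewrite mul1r.
by rewrite mulN1r.
Qed.

Let mf c t : 0 <= t -> measurable_fun setT (f c t).
Proof.
move=> t0; rewrite (funext (fE c t)).
apply: measurable_funM => //; apply: measurable_funD.
  apply: measurable_funM => //; apply: measurable_sum => m.
  by apply: measurable_funM => //; exact: mv.
apply: measurable_funM => //; apply: measurable_funM; last exact: mv.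
by apply: measurable_funD; apply: measurable_funX; exact: mv.
Qed.

Let cf c : as_continuous P (f c).
Proof.
have : \forall w \ae P, forall c, {within `[0, +oo[, continuous (v c ^~ w)}.
  by apply: filter_forall => c'; exact: cv.
apply: filterS => w cw.
rewrite (funext (fun t => fE c t w)).
move=> r; apply: cvgM; first exact: cvg_cst.
apply: cvgD.
  apply: cvgM; first exact: cvg_cst.
  apply: cvg_big => [|m _]; first exact: add_continuous.
  by apply: cvgM; [exact: cvg_cst | exact: cw].
apply: cvgM; first exact: cvg_cst.
apply: cvgM; last exact: cw.
by apply: cvgD; apply: cvgM; exact: cw.
Qed.

(** The guard [0 < s] makes the existence hold for every real [s], so that one choice selects a
    version at all times. *)
Let exists_noise (s : R) : exists J : 'I_M -> 'I_K -> T -> R[i], 0 < s ->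
  (forall j k, is_stratonovich_integral_C P F
     (fun u w => nls_noise K eta (U u w) j k) (beta k) s (J j k)) /\
  {ae P, forall w, U s w = U 0 w +
     time_integral (fun r => nls_drift lambda (U r w)) s +
     \col_j \sum_(k < K) J j k w}.
Proof.
have [s0|s0] := ltP 0 s; last by exists (fun _ _ _ => 0).
case: hU => _ _ _ /(_ s (ltW s0)) [I [[J [HJ IJ]] HI]].
exists J => _; split => //; apply: filterS HI => w ->.
by rewrite IJ.
Qed.

Let charge_whp (t e p : R) : 0 < t -> 0 < e -> 0 < p ->
  whp P p (fun w => `|\sum_c v c t w ^+ 2 - \sum_c v c 0 w ^+ 2| <= e).
Proof.
move=> t0 e0 p0.
have [J HJ] := choice exists_noise.
pose S (c : C) (k : 'I_K) (s : R) (w : T) : R := if 0 < s then part c.1 (J s c.2 k w) else 0.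
have hS c k s : 0 < s -> is_stratonovich_integral P F (X c k) (beta k) s (S c k s).
  move=> s0; have [/(_ c.2 k)[h1 h2] _] := HJ s s0.
  have -> : S c k s = fun w => part c.1 (J s c.2 k w).
    by apply/funext => w; rewrite /S s0.
  by case: c h1 h2 => [[] j].
have eqn s : 0 <= s -> {ae P, forall w, forall c : C, v c s w = v c 0 w +
    \int[lebesgue_measure]_(r in `[0, s]) f c r w + \sum_k S c k s w}.
  rewrite le_eqVlt => /predU1P[<-|s0].
    apply: aeW => w c; rewrite set_itv1 Rintegral_set1 addr0.
    by rewrite big1 ?addr0// => k _; rewrite /S ltxx.
  have [_ H] := HJ s s0; apply: filterS H => w E [b j].
  rewrite {1}/v /= E !mxE !partD part_sum.
  congr (_ + _ + _); first by case: b.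
  by apply: eq_bigr => k _; rewrite /S s0.
have cX c k : continuous_semimartingale P F (X c k) by have [] := hS c k t t0.
have XE c k s w : X c k s w = noise_coef eta c.2 k *
    (if c.1 then v (false, c.2) s w else - v (true, c.2) s w).
  by rewrite /X part_noise.
have qX c k : qv_tight P (X c k) t := qv_tight_semimartingale hF t0 (cX c k).
have aX c k : adapted F (X c k) by have [] := cX c k.
have ccX c k : as_continuous P (X c k) by have [] := cX c k.
(* The integrand of the first mode, in the flipped part, is [s] times [v c] up to sign, and it is a
   semimartingale; the bound transfers after division by [s ^+ 2]. The index [c] itself witnesses
   [0 < M], hence [0 < K]. *)
have qv c : qv_tight P (v c) t.
  have K0 : (0 < K)%N by apply: leq_trans hMK; case: c => _ j; apply: leq_ltn_trans (ltn_ord j).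
  pose k0 := Ordinal K0; pose s := noise_coef eta c.2 k0.
  have s0 : s != 0 by exact: noise_coef_neq0.
  move=> q q0; have [B HB] := qX (~~ c.1, c.2) k0 q q0.
  exists ((s ^+ 2)^-1 * B) => n n0; apply: whpS (HB n n0) => // w.
  rewrite (_ : qv (X _ _) t n w = s ^+ 2 * qv (v c) t n w).
    by rewrite ler_pdivlMl// exprn_even_gt0.
  rewrite /qv mulr_sumr; apply: eq_bigr => l _; rewrite !XE -/s /=.
  by case: (c) => [[] j] /=; ring.
pose nC : R := #|{: C}|%:R.
have p4 : 0 < p / 4 by rewrite divr_gt0.
have [L0 HL0] : exists L0, forall L, (L0 <= L)%N ->
    whp P (p / 4) (fun w => forall c s, 0 <= s <= t -> `|f c s w| <= L%:R).
  apply: whp_eventually_fin p4 => c q q0.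
  have [n Hn] := whp_bounded (@mf c) (@cf c) (ltW t0) q0.
  exists n => m nm; apply: whpS (Hn) => // w h s st.
  by apply: le_trans (h s st) _; rewrite ler_nat.
have {HL0} HL := HL0 L0 (leqnn L0); set L : R := L0%:R in HL.
have L1 : 0 < L + 1 by rewrite ltr_wpDl.
have nC0 : 0 <= nC by [].
(* Makes the bound [nC * (rho * L) * t] of the drift sum at most [e / 4]; [eps] below does the same
   for the [nC * K] noise sums, and the telescoping doubles both. *)
pose rho := e / 4 / ((nC + 1) * (L + 1) * t).
have rho0 : 0 < rho by rewrite !divr_gt0// !mulr_gt0// ltr_wpDl.
have [n1 Hmod] : exists n1, forall n, (n1 <= n)%N ->
    whp P (p / 4) (fun w => forall c s s', 0 <= s <= t -> 0 <= s' <= t ->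
      `|s' - s| < n.+1%:R^-1 -> `|v c s' w - v c s w| <= rho).
  apply: whp_eventually_fin p4 => c q q0.
  have [n Hn] := whp_modulus (@mv c) (@cv c) (ltW t0) rho0 q0.
  exists n => m nm; apply: whpS (Hn) => // w h s s' st s't ss'.
  apply: h => //; apply: lt_le_trans ss' _.
  by rewrite lef_pV2 ?posrE// ler_nat ltnS.
have {Hmod} Hmod := Hmod n1 (leqnn n1).
pose eps := e / 4 / (nC * K%:R + 1).
have eps0 : 0 < eps by rewrite !divr_gt0// ltr_wpDl// mulr_ge0.
have [n2 Hkey] : exists n2, forall n, (n2 <= n)%N ->
    whp P (p / 4) (fun w => forall ck : C * 'I_K,
      `|\sum_(i < n`!) midp (v ck.1) t n`! i w *
       (S ck.1 ck.2 (grid t n`! i.+1) w - S ck.1 ck.2 (grid t n`! i) w -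
        midp (X ck.1 ck.2) t n`! i w * incr (beta ck.2) t n`! i w)| <= eps).
  apply: whp_eventually_fin p4 => -[c k] q q0.
  have S00 w : S c k 0 w = 0 by rewrite /S ltxx.
  have [N1 N10 HN1] := whp_stratonovich_midpoint hF hbeta t0 (av c) (cv c) (qv c)
    (aX c k) (ccX c k) (qX c k) (hS c k) S00 eps0 q0.
  exists N1 => n N1n; apply: HN1; last exact: fact_gt0.
  by apply: dvdn_fact; rewrite N10.
(* A factorial is divisible by the moduli of all pairs [(c, k)] once [n >= n2], and as [n! >= n] the
   mesh is below the modulus of continuity. *)
pose n := maxn n2 (Num.truncn (t * n1.+1%:R)).+1; pose N := n`!.
have N0 : (0 < N)%N by exact: fact_gt0.
have tN : t / N%:R < n1.+1%:R^-1.
  rewrite ltr_pdivrMr ?ltr0n// mulrC ltr_pdivlMr ?ltr0n//.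
  apply: lt_le_trans (truncnS_gt _) _; rewrite ler_nat.
  by apply: leq_trans (fact_geq n); rewrite leq_maxr.
have Heq : whp P (p / 4) (fun w => forall i, (i < N.+1)%N -> forall c : C,
    v c (grid t N i) w = v c 0 w +
    \int[lebesgue_measure]_(r in `[0, grid t N i]) f c r w + \sum_k S c k (grid t N i) w).
  apply: whp_forall p4 => i _ q q0; apply: whp_ae (ltW q0) _.
  by apply: eqn; rewrite grid_ge0// ltW.
have cfA : {ae P, forall w, forall c, {within `[0, +oo[, continuous (f c ^~ w)}}.
  by apply: filter_forall => c'; exact: cf.
have := whpI (whpI (whpI HL Hmod) (whpI (Hkey n (leq_maxl _ _)) Heq)) (whp_ae (lexx 0) cfA).
apply: whpS => [|w [[[hL hm] [hk he]] hc]]; first by lra.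
have mid c i : v c (grid t N i.+1) w ^+ 2 - v c (grid t N i) w ^+ 2 =
    2 * (midp (v c) t N i w * (v c (grid t N i.+1) w - v c (grid t N i) w)).
  by rewrite /midp; field.
pose A c i := \int[lebesgue_measure]_(r in `[0, grid t N i.+1]) f c r w -
  \int[lebesgue_measure]_(r in `[0, grid t N i]) f c r w.
have dv c i : (i < N)%N -> v c (grid t N i.+1) w - v c (grid t N i) w =
    A c i + \sum_k (S c k (grid t N i.+1) w - S c k (grid t N i) w).
  move=> iN; rewrite (he i.+1 iN c) (he i (ltnW iN) c) sumrB /A; ring.
pose D c k i := S c k (grid t N i.+1) w - S c k (grid t N i) w -
  midp (X c k) t N i w * incr (beta k) t N i w.
(* the midpoint products cancel since the noise acts by multiplication by [i] *)
have noise0 k i : \sum_c midp (v c) t N i w * midp (X c k) t N i w = 0.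
  rewrite -(pair_bigA _ (fun b j => midp (v (b, j)) t N i w * midp (X (b, j) k) t N i w)).
  rewrite big_bool -big_split big1// => j _; cbv beta.
  by rewrite /midp !XE /=; field.
have -> : \sum_c v c t w ^+ 2 - \sum_c v c 0 w ^+ 2 =
    2 * (\sum_(i < N) \sum_c midp (v c) t N i w * A c i) +
    2 * (\sum_(ck : C * 'I_K) \sum_(i < N) midp (v ck.1) t N i w * D ck.1 ck.2 i).
  pose g i := \sum_c v c (grid t N i) w ^+ 2.
  have -> : \sum_c v c t w ^+ 2 - \sum_c v c 0 w ^+ 2 = \sum_(i < N) (g i.+1 - g i).
    rewrite -(big_mkord xpredT (fun i => g i.+1 - g i)) telescope_sumr// /g.
    by rewrite gridn// grid0.
  rewrite [X in _ + 2 * X]exchange_big -mulrDr -big_split mulr_sumr /=.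
  apply: eq_bigr => i _; rewrite /g -sumrB.
  rewrite (eq_bigr (fun c => 2 * (midp (v c) t N i w * (A c i +
      \sum_k (S c k (grid t N i.+1) w - S c k (grid t N i) w))))); last first.
    by move=> c _; rewrite -dv// -mid.
  rewrite -mulr_sumr; congr (_ * _).
  rewrite -(pair_bigA _ (fun c k => midp (v c) t N i w * D c k i)) /=.
  under eq_bigr do rewrite mulrDr.
  rewrite big_split /=; congr (_ + _).
  rewrite exchange_big /=; under eq_bigr do rewrite mulr_sumr.
  rewrite exchange_big /=; apply: eq_bigr => k _; rewrite /D.
  under [RHS]eq_bigr do rewrite mulrBr mulrA.
  by rewrite sumrB -mulr_suml noise0 mul0r subr0.
have h1 : `|\sum_(i < N) \sum_c midp (v c) t N i w * A c i| <= e / 4.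
  have uf0 r : 0 <= r -> \sum_c v c r w * f c r w = 0 by move=> _; exact: sum_part_drift.
  have := @drift_midpoint_le R {: C} (fun c r => v c r w) (fun c r => f c r w) hc uf0
    t rho L N t0 N0 _ (ltW rho0) hL.
  move=> /(_ _ _) H; apply: le_trans (H _ _) _ => //.
    move=> c r r' rt r't rr'; apply: hm => //; exact: le_lt_trans rr' tN.
  have D0 : 0 < (nC + 1) * (L + 1) * t by rewrite !mulr_gt0// ltr_wpDl.
  have L00 : 0 <= L by [].
  rewrite -/nC (_ : _ * t = e / 4 * (nC * L * t) / ((nC + 1) * (L + 1) * t)); last first.
    by rewrite /rho; ring.
  rewrite ler_pdivrMr//; apply: ler_wpM2l; first by rewrite divr_ge0// ltW.
  by apply: ler_wpM2r; [exact: ltW | apply: ler_pM => //; rewrite lerDl].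
have h2 : `|\sum_(ck : C * 'I_K) \sum_(i < N) midp (v ck.1) t N i w * D ck.1 ck.2 i| <= e / 4.
  apply: le_trans (ler_norm_sum _ _ _) _.
  apply: (@le_trans _ _ (\sum_(ck : C * 'I_K) eps)); first by apply: ler_sum => ck _; exact: hk.
  rewrite sumr_const card_prod card_ord -[_ *+ _]mulr_natr natrM -/nC /eps.
  by rewrite mulrAC ler_pdivrMr ?ltr_wpDl ?mulr_ge0// ler_wpM2l ?lerDl// divr_ge0// ltW.
apply: le_trans (ler_normD _ _) _; rewrite !normrM (ger0_norm (_ : 0 <= 2))//; lra.
Qed.

Lemma ae_charge_conserved (t : R) : 0 <= t ->
  {ae P, forall w, charge_norm (U t w) ^+ 2 = charge_norm (U 0 w) ^+ 2}.
Proof.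
rewrite le_eqVlt => /predU1P[<-|t0]; first exact: aeW.
have H : {ae P, forall w, forall n,
    `|\sum_c v c t w ^+ 2 - \sum_c v c 0 w ^+ 2| <= n.+1%:R^-1}.
  by apply/ae_foralln => n; apply: ae_whp => p p0; apply: charge_whp => //; rewrite invr_gt0.
apply: filterS H => w H; rewrite !charge_normE; apply/eqP.
rewrite -subr_eq0 -normr_le0 leNgt; apply/negP => d0.
have := H (Num.truncn (`|\sum_c v c t w ^+ 2 - \sum_c v c 0 w ^+ 2|^-1)).
apply/negP; rewrite -ltNge -[ltRHS]invrK ltf_pV2 ?posrE ?invr_gt0 ?ltr0n//.
exact: truncnS_gt.
Qed.

(** One null set serves all nonnegative rationals, enumerated by [unpickle]; continuity of the paths
    extends the identity to every real time. *)
Lemma ae_charge_conserved_all :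
  {ae P, forall w, forall t, 0 <= t -> charge_norm (U t w) ^+ 2 = charge_norm (U 0 w) ^+ 2}.
Proof.
have HQ : {ae P, forall w, forall n, forall q : rat, unpickle n = Some q ->
    0 <= ratr q :> R -> charge_norm (U (ratr q) w) ^+ 2 = charge_norm (U 0 w) ^+ 2}.
  apply/ae_foralln => n; case: (unpickle n) => [q|]; last exact: aeW.
  have [q0|q0] := leP 0 (ratr q : R).
    by apply: filterS (ae_charge_conserved q0) => w E _ [<-].
  by apply: aeW => w _ [<-]; rewrite leNgt q0.
have cvA : \forall w \ae P, forall c, {within `[0, +oo[, continuous (v c ^~ w)}.
  by apply: filter_forall => c'; exact: cv.
apply: filterS2 HQ cvA => w HQ cw t t0.
rewrite !charge_normE; pose g s := \sum_c v c s w ^+ 2.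
rewrite -/(g t) -/(g 0).
have cg : {within `[0, +oo[, continuous g}.
  move=> r; apply: cvg_big => [|c _]; first exact: add_continuous.
  by apply: cvgM; exact: cw.
apply/eqP; rewrite -subr_eq0 -normr_le0 leNgt; apply/negP => d0.
have [del del0 H] := within_continuous_cvg cg t0 d0.
(* Approaching [t] from the right keeps the rational time nonnegative, even at [t = 0]. *)
have /rat_in_itvoo[q] : t < t + del by rewrite ltrDl.
rewrite in_itv /= => /andP[tq qt].
have q0 : 0 <= ratr q :> R := le_trans t0 (ltW tq).
have := H _ q0; rewrite ger0_norm ?subr_ge0 ?ltW// ltrBlDl => /(_ qt).
have := HQ (pickle q) q (pickleK q) q0; rewrite !charge_normE -/(g _) -/(g 0) => ->.
by rewrite distrC ltxx.
Qed.

End charge.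

Theorem proposition2p1 (R : realType) (d : measure_display) (T : measurableType d)
  (P : probability T R) (F : R -> set (set T)) (hF : filtration F)
  (M K : nat) (hMK : (M <= K)%N)
  (beta : 'I_K -> R -> T -> R) (hbeta : brownian_motion P F beta)
  (eta : nat -> R) (heta_pos : forall k, (1 <= k)%N -> 0 < eta k)
  (heta_sum : cvgn (series (fun k => eta k.+1)))
  (lambda : R) (hlambda : lambda = 1 \/ lambda = -1)
  (u0 : R -> R[i]) (c_star : R[i])
  (U : R -> T -> 'cV[R[i]]_M)
  (hU : stratonovich_solution P F (nls_drift lambda) (nls_noise K eta) beta
          (nls_init M c_star u0) U) :
  {ae P, forall w, forall t, 0 <= t ->
    charge_norm (U t w) ^+ 2 = charge_norm (U 0 w) ^+ 2}.
Proof. exact: (ae_charge_conserved_all hF hMK hbeta heta_pos hU). Qed.
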